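(* Let $n \geq 1$ be an integer. Then there exist infinitely many totally real bi-quadratic fields $K$ (i.e. Galois extensions $K/\mathbb{Q}$ of degree $4$ with Galois group $\mathbb{Z}/2\mathbb{Z}\times\mathbb{Z}/2\mathbb{Z}$, all of whose embeddings into $\mathbb{C}$ are real) whose P\'olya group satisfies $Po(K) \simeq (\mathbb{Z}/2\mathbb{Z})^{n}$.
   Context: For a number field $K$ with ring of integers $\mathcal{O}_K$ and ideal class group $Cl_K$, and for a positive integer $q$, let $\Pi_q(K)$ be the product of all prime ideals $\mathfrak{p}$ of $\mathcal{O}_K$ with absolute norm $N\mathfrak{p} = q$ if $q$ is a prime power, and $\Pi_q(K) = \mathcal{O}_K$ otherwise. The P\'olya group $Po(K)$ is the subgroup of $Cl_K$ generated by the ideal classes $[\Pi_q(K)]$ for all $q$. *)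

(* Defs.v *)
From HB Require Import structures.
From mathcomp Require Import all_boot all_order all_fingroup all_algebra all_field.
From mathcomp Require Import finmap boolp classical_sets functions cardinality.
From mathcomp Require Import fsbigop generic_quotient.
From mathcomp Require Import reals Rstruct complex.

Set Implicit Arguments.
Unset Strict Implicit.
Unset Printing Implicit Defensive.

Import Order.TTheory GRing.Theory Num.Theory.

Local Open Scope ring_scope.
Local Open Scope classical_set_scope.
Local Open Scope quotient_scope.

Section RingOfIntegers.
Variable K : fieldExtType rat.

Definition ringOfIntegers : set K :=
  [set x | integralOver (intr : int -> K) x].

Local Notation OK := ringOfIntegers.

Lemma OK_0 : OK 0. Proof. exact: integral0. Qed.
Lemma OK_1 : OK 1. Proof. exact: integral1. Qed.
Lemma OK_add x y : OK x -> OK y -> OK (x + y).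
Proof. exact: integral_add. Qed.
Lemma OK_mul x y : OK x -> OK y -> OK (x * y).
Proof. exact: integral_mul. Qed.

(* The zero ideal is excluded. Closure under opposites and finite generation
   are automatic. *)
Definition is_fracIdeal (I : set K) : Prop :=
  [/\ exists2 x, I x & x != 0,
      forall x y, I x -> I y -> I (x + y),
      forall a x, OK a -> I x -> I (a * x) &
      exists2 d, OK d /\ d != 0 & forall x, I x -> OK (d * x)].

Record fracIdeal := FracIdeal {
  ideal_set :> set K;
  fracIdeal_asbool : `[< is_fracIdeal ideal_set >] }.

HB.instance Definition _ := [isSub for ideal_set].
HB.instance Definition _ := [Choice of fracIdeal by <:].

Lemma fracIdealP (I : fracIdeal) : is_fracIdeal I.
Proof. exact/asboolP/fracIdeal_asbool. Qed.

Lemma fracIdeal0 (I : fracIdeal) : ideal_set I 0.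
Proof.
have [[x Ix _] _ IM _] := fracIdealP I.
by rewrite -(mul0r x); apply: IM => //; exact: OK_0.
Qed.

Lemma fracIdeal_eq (I J : fracIdeal) : I `<=` J -> J `<=` I -> I = J.
Proof. by move=> IJ JI; apply: val_inj; apply/seteqP. Qed.

Definition ideal_prod (I J : set K) : set K :=
  [set z | exists2 s : seq (K * K),
     {in s, forall p, I p.1 /\ J p.2} & z = \sum_(p <- s) p.1 * p.2].

Lemma ideal_prodM (I J : set K) x y : I x -> J y -> ideal_prod I J (x * y).
Proof.
move=> Ix Jy; exists [:: (x, y)]; last by rewrite big_seq1.
by move=> p; rewrite inE => /eqP ->.
Qed.

Lemma ideal_prodD (I J : set K) x y :
  ideal_prod I J x -> ideal_prod I J y -> ideal_prod I J (x + y).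
Proof.
move=> [s sP ->] [t tP ->]; exists (s ++ t); last by rewrite big_cat.
by move=> p; rewrite mem_cat => /orP[/sP|/tP].
Qed.

Lemma ideal_prod_sub (I J L : set K) : L 0 ->
  (forall x y, L x -> L y -> L (x + y)) ->
  (forall x y, I x -> J y -> L (x * y)) -> ideal_prod I J `<=` L.
Proof.
move=> L0 LD LM z [s sP ->]; rewrite big_seq.
by apply: (big_ind L) => // p /sP[? ?]; exact: LM.
Qed.

Fact fracIdeal_one_subproof : `[< is_fracIdeal OK >].
Proof.
apply/asboolP; split; [|exact: OK_add|exact: OK_mul|].
- by exists 1; [exact: OK_1|exact: oner_neq0].
- exists 1; first by split; [exact: OK_1|exact: oner_neq0].
  by move=> x; rewrite mul1r.
Qed.
Definition fracIdeal_one := FracIdeal fracIdeal_one_subproof.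

Fact fracIdeal_mul_subproof (I J : fracIdeal) :
  `[< is_fracIdeal (ideal_prod I J) >].
Proof.
have [[x Ix x0] ID IM [d [dO d0] dP]] := fracIdealP I.
have [[y Jy y0] JD JM [e [eO e0] eP]] := fracIdealP J.
apply/asboolP; split; [|exact: ideal_prodD| |].
- by exists (x * y); [exact: ideal_prodM|rewrite mulf_neq0].
- move=> a z aO.
  pose L := [set z | ideal_prod I J (a * z)].
  suff : ideal_prod I J `<=` L by exact.
  apply: ideal_prod_sub.
  + by rewrite /L /= mulr0 -(mulr0 0); apply: ideal_prodM; exact: fracIdeal0.
  + by move=> u v; rewrite /L /= mulrDr; exact: ideal_prodD.
  + by move=> u v Iu Jv; rewrite /L /= mulrA; apply: ideal_prodM => //; exact: IM.
- exists (d * e); first by split; [exact: OK_mul|rewrite mulf_neq0].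
  pose L := [set z | OK (d * e * z)].
  suff : ideal_prod I J `<=` L by exact.
  apply: ideal_prod_sub.
  + by rewrite /L /= mulr0; exact: OK_0.
  + by move=> u v; rewrite /L /= mulrDr; exact: OK_add.
  + move=> u v Iu Jv; rewrite /L /= mulrACA.
    by apply: OK_mul; [exact: dP|exact: eP].
Qed.
Definition fracIdeal_mul (I J : fracIdeal) :=
  FracIdeal (fracIdeal_mul_subproof I J).

Lemma fracIdeal_mulC : commutative fracIdeal_mul.
Proof.
have sub (I J : fracIdeal) : fracIdeal_mul I J `<=` fracIdeal_mul J I.
  apply: ideal_prod_sub; [exact: fracIdeal0|exact: ideal_prodD|].
  by move=> x y Ix Jy; rewrite mulrC; exact: ideal_prodM.
by move=> I J; apply: fracIdeal_eq; exact: sub.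
Qed.

Lemma fracIdeal_mulA : associative fracIdeal_mul.
Proof.
have sub (I J L : fracIdeal) :
    fracIdeal_mul I (fracIdeal_mul J L) `<=`
    fracIdeal_mul (fracIdeal_mul I J) L.
  apply: ideal_prod_sub; [exact: fracIdeal0|exact: ideal_prodD|].
  move=> x w Ix.
  pose M := [set w | ideal_set (fracIdeal_mul (fracIdeal_mul I J) L) (x * w)].
  suff : fracIdeal_mul J L `<=` M by exact.
  apply: ideal_prod_sub.
  - by rewrite /M /= mulr0; exact: (fracIdeal0 (fracIdeal_mul (fracIdeal_mul I J) L)).
  - by move=> u v; rewrite /M /= mulrDr; exact: ideal_prodD.
  - move=> y z Jy Lz; rewrite /M /= mulrA.
    by apply: ideal_prodM => //; exact: ideal_prodM.
move=> I J L; apply: fracIdeal_eq; first exact: sub.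
rewrite (fracIdeal_mulC (fracIdeal_mul I J)) (fracIdeal_mulC I J).
rewrite (fracIdeal_mulC I) (fracIdeal_mulC J L).
exact: sub.
Qed.

Lemma fracIdeal_mul1 : left_id fracIdeal_one fracIdeal_mul.
Proof.
move=> I; have [_ ID IM _] := fracIdealP I; apply: fracIdeal_eq.
  by apply: ideal_prod_sub => //; exact: fracIdeal0.
by move=> x Ix; rewrite -(mul1r x); apply: ideal_prodM => //; exact: OK_1.
Qed.

Lemma fracIdeal_mulr1 : right_id fracIdeal_one fracIdeal_mul.
Proof. by move=> I; rewrite fracIdeal_mulC fracIdeal_mul1. Qed.

HB.instance Definition _ := isMonoid.Build fracIdeal
  fracIdeal_mulA fracIdeal_mul1 fracIdeal_mulr1.

Definition same_class (I J : fracIdeal) : bool :=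
  `[< exists2 a : K, a != 0 & (J : set K) = [set a * x | x in I] >].

Lemma same_class_refl : reflexive same_class.
Proof.
move=> I; apply/asboolP; exists 1; first exact: oner_neq0.
apply/seteqP; split=> x /=; first by move=> Ix; exists x; rewrite ?mul1r.
by case=> y Iy <-; rewrite mul1r.
Qed.

Lemma same_class_sym : symmetric same_class.
Proof.
suff sub I J : same_class I J -> same_class J I.
  by move=> I J; apply/idP/idP; exact: sub.
move=> /asboolP[a a0 JE]; apply/asboolP; exists a^-1; first by rewrite invr_eq0.
rewrite JE.
apply/seteqP; split=> [x Ix|x [_ [y Iy <-] <-]]; last by rewrite mulKf.
by exists (a * x); [exists x|rewrite mulKf].
Qed.

Lemma same_class_trans : transitive same_class.
Proof.
move=> J I L /asboolP[a a0 JE] /asboolP[b b0 LE]; apply/asboolP.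
exists (b * a); first by rewrite mulf_neq0.
rewrite LE JE; apply/seteqP; split=> x.
  by case=> _ [z Iz <-] <-; exists z; rewrite ?mulrA.
by case=> z Iz <-; exists (a * z); [exists z|rewrite mulrA].
Qed.

Canonical same_class_equiv :=
  EquivRel same_class same_class_refl same_class_sym same_class_trans.

Definition classGroup := {eq_quot same_class}.
HB.instance Definition _ := Choice.on classGroup.
HB.instance Definition _ := EqQuotient.on classGroup.

Definition ideal_class (I : fracIdeal) : classGroup := \pi_classGroup I.

Definition class_one : classGroup := ideal_class 1%g.
Definition class_mul : classGroup -> classGroup -> classGroup :=
  fun c d => ideal_class (repr c * repr d)%g.

Lemma same_class_mull (I I' J : fracIdeal) :
  same_class I I' -> same_class (I * J)%g (I' * J)%g.
Proof.
move=> /asboolP[a a0 IE]; apply/asboolP; exists a => //; apply/seteqP; split.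
  apply: ideal_prod_sub.
  - by exists 0; rewrite ?mulr0 //; exact: (fracIdeal0 (fracIdeal_mul I J)).
  - move=> _ _ [x Ix <-] [y Iy <-]; exists (x + y); last by rewrite mulrDr.
    exact: ideal_prodD.
  - move=> x y; rewrite IE => -[z Iz <-] Jy.
    by exists (z * y); [exact: ideal_prodM|rewrite mulrA].
move=> _ [x IJx <-].
pose L := [set x | ideal_set (I' * J)%g (a * x)].
suff : (I * J)%g `<=` L by exact.
apply: ideal_prod_sub.
- by rewrite /L /= mulr0; exact: (fracIdeal0 (fracIdeal_mul I' J)).
- by move=> u v; rewrite /L /= mulrDr; exact: ideal_prodD.
- move=> u v Iu Jv; rewrite /L /= mulrA; apply: ideal_prodM => //.
  by rewrite IE; exists u.
Qed.

Lemma ideal_class_eq (I J : fracIdeal) :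
  ideal_class I = ideal_class J <-> same_class I J.
Proof. by split=> [/eqmodP|?]; [|apply/eqmodP]. Qed.

Lemma ideal_class_repr (c : classGroup) : ideal_class (repr c) = c.
Proof. exact: reprK. Qed.

Lemma ideal_classM (I J : fracIdeal) :
  ideal_class (I * J)%g = class_mul (ideal_class I) (ideal_class J).
Proof.
apply/ideal_class_eq.
have reprP (L : fracIdeal) : same_class L (repr (ideal_class L)).
  by apply/ideal_class_eq; rewrite ideal_class_repr.
apply: (@same_class_trans (repr (ideal_class I) * J)%g).
  exact: same_class_mull.
rewrite ![(repr _ * _)%g]fracIdeal_mulC.
exact: same_class_mull.
Qed.

Lemma class_mulC : commutative class_mul.
Proof. by move=> c d; rewrite /class_mul [(_ * _)%g]fracIdeal_mulC. Qed.

Lemma class_mulA : associative class_mul.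
Proof.
move=> c d e; rewrite -[c]ideal_class_repr -[d]ideal_class_repr.
by rewrite -[e]ideal_class_repr -!ideal_classM mulgA.
Qed.

Lemma class_mul1 : left_id class_one class_mul.
Proof.
by move=> c; rewrite -[c]ideal_class_repr -ideal_classM mul1g.
Qed.

Lemma class_mulr1 : right_id class_one class_mul.
Proof. by move=> c; rewrite class_mulC class_mul1. Qed.

(* Every fractional ideal of a number field is invertible, so this commutative
   monoid is a group; its inverses are not needed as an operation, see
   [is_subgroup]. *)
HB.instance Definition _ := isMonoid.Build classGroup
  class_mulA class_mul1 class_mulr1.

Definition prime_ideal (P : fracIdeal) : Prop :=
  [/\ P `<` OK &
      forall x y, OK x -> OK y ->
        ideal_set P (x * y) -> ideal_set P x \/ ideal_set P y].

Definition cosets (I : fracIdeal) : set (set K) :=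
  [set [set x + y | y in I] | x in OK].

(* The index of I in the ring of integers, with value 0 if it is infinite. *)
Definition absNorm (I : fracIdeal) : nat := #|` fset_set (cosets I) |%fset.

Definition prime_power (q : nat) : Prop :=
  exists p k : nat, [/\ prime p, (0 < k)%N & q = (p ^ k)%N].

(* The set of primes of norm q is finite, so the finitely supported product
   below does not fall back to its default value 1. *)
Definition ostrowskiIdeal (q : nat) : fracIdeal :=
  if `[< prime_power q >] then
    \big[(fun I J : fracIdeal => (I * J)%g)/1%g]_(P \in
      [set P : fracIdeal | prime_ideal P /\ absNorm P = q]) P
  else 1%g.

Definition is_subgroup (S : set classGroup) : Prop :=
  [/\ S 1%g,
      forall c d : classGroup, S c -> S d -> S (c * d)%g &
      forall c d : classGroup, S c -> (c * d)%g = 1%g -> S d].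

Definition polyaGroup : set classGroup :=
  smallest is_subgroup
    [set ideal_class (ostrowskiIdeal q) | q in [set q | (0 < q)%N]].

Definition totally_real : Prop :=
  forall (f : {rmorphism K -> Rdefinitions.R[i]}) (x : K), complex.Im (f x) = 0.

(* The monoid morphism f is a bijection from (Z/2Z)^n onto S; here 'Z_2 is the
   ring Z/2Z, used additively. *)
Definition isom_elementary (n : nat) (S : set classGroup) : Prop :=
  exists f : 'rV['Z_2]_n -> classGroup,
    {morph f : u v / u + v >-> (u * v)%g} /\ set_bij setT S f.

End RingOfIntegers.

Arguments ostrowskiIdeal : clear implicits.
Arguments polyaGroup : clear implicits.

(* A normal extension of Q is a [splittingFieldType rat]. *)
Definition biquadratic (K : splittingFieldType rat) : Prop :=
  [/\ galois 1 {:K}, \dim {:K} = 4%N &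
      'Gal({:K} / 1) \isog [set: 'Z_2 * 'Z_2]%SET].

Definition field_isomorphic (K L : fieldExtType rat) : Prop :=
  exists f : {rmorphism K -> L}, bijective f.

(* Infinitely many pairwise non-isomorphic fields; for Galois extensions of Q,
   this is the same as infinitely many subfields of the complex numbers. *)
Definition infinitely_many (P : splittingFieldType rat -> Prop) : Prop :=
  exists K : nat -> splittingFieldType rat,
    (forall i, P (K i)) /\
    (forall i j, i <> j -> ~ field_isomorphic (K i) (K j)).

(* Main.v *)
(** Take K = Q(sqrt 5, sqrt b) with b = 3 * 7 * 13 * l_1 * ... * l_n, where the primes
    l_i are = 1 mod 4 and nonresidues of 5; there are infinitely many of them, among the
    prime factors of numbers x^2 + 1. Let R_p be the radical of pO. The Galois group
    permutes the primes over p transitively, so the ideals Pi_q are O, R_p or pO, and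
    R_p^2 = pO exactly for the n + 4 prime factors p of 5b. Hence Po(K) is the quotient
    of F_2^(n+4) by the subspace of those d | 5b for which R_d is principal, that is,
    d u = x^2 for a unit u of O_K. The norms of x to the three quadratic subfields show
    that, modulo squares and sqrt 5, sqrt b, such d come from units of norm 1 of
    Q(sqrt 5), Q(sqrt b), Q(sqrt 5b) (norm -1 is impossible modulo 3): the unit
    e = (X + Y sqrt D)/2 contributes X + 2, as (1 + e)^2 = e (X + 2). Since e is a power
    of the fundamental unit, the relations are spanned by 5, b, A and C, where
    A u^2 - B v^2 = 4 and C w^2 - D z^2 = 4 with AB = b and CD = 5b come from the
    fundamental solutions for b and 5b. Residue symbols modulo the prime factors of b show
    that these four are independent, whatever A and C are, so Po(K) has rank n. *)

From HB Require Import structures.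
Require Import Defs.
From mathcomp Require Import all_boot all_order all_fingroup all_algebra all_solvable all_field.
From mathcomp Require Import finmap boolp classical_sets functions cardinality fsbigop.
From mathcomp Require Import reals Rstruct complex.
From mathcomp Require Import ring lra zify.

Set Implicit Arguments.
Unset Strict Implicit.
Unset Printing Implicit Defensive.

Import Order.TTheory GRing.Theory Num.Theory.

(** Neither unique factorisation of ideals nor the unit theorem is used. R_d is given elementwise by
    integrality of x^2/d, so products of such ideals are compared through their squares; O/pO is
    finite because an integer of [K] is determined modulo p by finitely many traces; units matter
    only modulo squares, so the index of the units coming from the subfields never has to be known.
    The constants: 5 and b are 1 modulo 4 (21 = 1 makes up for 3 and 7), which keeps 2 unramified.
    In Q(sqrt 5) every X + 2 is a square or 5 times a square, so this field adds no relation beyond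
    5. As 5 is a nonresidue modulo each prime factor of b, moving 5 from one side of an equation to
    the other changes a quadratic character; this separates the solution for b from the one for 5b.
    The characters of -1 and -5 tell 3 and 7 from the other factors and force a factor 21 in the
    stubborn cases; 13 is there for the residual equations, such as 21 v^2 = 4, which it makes
    impossible. Infinitely many fields arise by varying a single l_i. *)

Lemma absz_sqr (z : int) : Posz (absz z ^ 2) = (z ^+ 2)%R.
Proof. by rewrite -natz natrX natz abszE real_normK ?num_real. Qed.

Definition perfect_square (n : nat) : Prop := exists k, n = (k ^ 2)%N.

(** * Pell's equation *)

Section Pell.
Local Open Scope ring_scope.
Variables (R : rcfType) (d : nat).
Hypothesis d_nsq : ~ perfect_square d.

Let th : R := Num.sqrt d%:R.

Let th2 : th ^+ 2 = d%:R. Proof. by rewrite sqr_sqrtr ?ler0n. Qed.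
Let th_ge0 : 0 <= th. Proof. exact: sqrtr_ge0. Qed.

Lemma floor_mul_sqrt (k : nat) : exists s : nat, s%:R <= k%:R * th < s%:R + 1.
Proof.
have th_led : th <= d%:R.
  rewrite -th2 expr2; case: (posnP d) => [d0|d_gt0].
    by rewrite /th d0 sqrtr0 mul0r.
  have : 1 <= th by rewrite -[1]sqrtr1 ler_wsqrtr // ler1n.
  nra.
have ex0 : exists s : nat, (s%:R <= k%:R * th).
  by exists 0%N; rewrite mulr_ge0 ?ler0n.
have bnd s : s%:R <= k%:R * th -> (s <= k * d)%N.
  move=> h; rewrite -(ler_nat R) natrM; apply: le_trans h _.
  by rewrite ler_wpM2l ?ler0n.
case: (ex_maxnP ex0 bnd) => s hs hmax; exists s; rewrite hs /= ltNge.
by apply/negP; rewrite natr1 => /hmax; rewrite ltnn.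
Qed.

(** Pigeonhole: the fractional parts of k sqrt d for k = 0, ..., N fall into N intervals of length
    1/N. *)
Lemma dirichlet_approx (N : nat) : (0 < N)%N ->
  exists x y : nat, (0 < y <= N)%N /\ N%:R * `|x%:R - y%:R * th| < 1.
Proof.
move=> N_gt0; have /boolp.choice[s sP] := floor_mul_sqrt.
have mono k k' : (k <= k')%N -> (s k <= s k')%N.
  move=> kk'; have /andP[h1 _] := sP k; have /andP[_ h2] := sP k'.
  rewrite -ltnS -(ltr_nat R) -natr1.
  have : k%:R * th <= k'%:R * th by rewrite ler_wpM2r // ler_nat.
  lra.
(* [s (N * k) - N * s k] is the floor of N times the fractional part of k sqrt d, that is, the
   number of the interval containing it. *)
have buck k : (N * s k <= s (N * k)%N < N * s k + N)%N.
  have /andP[h1 h2] := sP k; have /andP[h3 h4] := sP (N * k)%N.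
  have N1 : 1 <= N%:R :> R by rewrite ler1n.
  move: h3 h4; rewrite natrM -mulrA => h3 h4.
  apply/andP; split.
    rewrite -ltnS -(ltr_nat R) -natr1 natrM; apply: le_lt_trans h4.
    by rewrite ler_wpM2l ?ler0n.
  rewrite -(ltr_nat R) natrD natrM; apply: le_lt_trans h3 _.
  rewrite -[X in _ < _ + X]mulr1 -mulrDr ltr_pM2l //; lra.
have valc (k : nat) : (s (N * k)%N - N * s k < N)%N by have := buck k; lia.
pose c' (k : 'I_N.+1) : 'I_N := Ordinal (valc k).
have : ~~ injectiveb c'.
  by apply/negP=> /injectiveP /leq_card; rewrite !card_ord ltnn.
move=> /injectivePn[i [j ij cij]].
wlog lt_ij : i j ij cij / (i < j)%N.
  move=> W; case: (ltngtP i j) => [lt|lt|/val_inj E].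
  - exact: (W i j).
  - by apply: (W j i) => //; rewrite eq_sym.
  - by rewrite E eqxx in ij.
have {}cij : (s (N * i) - N * s i = s (N * j) - N * s j)%N by have /(congr1 val) := cij.
exists (s j - s i)%N, (j - i)%N; split.
  by have := ltn_ord j; lia.
have sij : (s i <= s j)%N by apply: mono; lia.
rewrite !natrB ?(ltnW lt_ij) //.
have /andP[h1 h2] := sP (N * i)%N; have /andP[h3 h4] := sP (N * j)%N.
have E : (s (N * j) + N * s i = s (N * i) + N * s j)%N.
  by have := buck i; have := buck j; lia.
have ER : (s (N * j)%N)%:R + N%:R * (s i)%:R = (s (N * i)%N)%:R + N%:R * (s j)%:R :> R.
  by rewrite -!natrM -!natrD E.
rewrite -[N%:R]ger0_norm ?ler0n // -normrM ltr_norml.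
move: h1 h2 h3 h4 ER; rewrite !natrM => *; apply/andP; split; lra.
Qed.

Lemma norm_form_neq0 (x y : nat) : (0 < y)%N -> (x ^ 2 != d * y ^ 2)%N.
Proof.
move=> y_gt0; apply/eqP => E; apply: d_nsq.
have : (y ^ 2 %| x ^ 2)%N by rewrite E dvdn_mull.
rewrite dvdn_pexp2r // => /dvdnP[k xE]; exists k; apply/eqP.
rewrite -(eqn_pmul2r (m := (y ^ 2)%N)) ?expn_gt0 ?y_gt0 //.
by rewrite -expnMn -xE E.
Qed.

Lemma small_norm_pairs (M : nat) : exists x y : nat,
  [/\ (M < y)%N, (x ^ 2 <= d * y ^ 2 + (2 * d + 1))%N &
      (d * y ^ 2 <= x ^ 2 + (2 * d + 1))%N].
Proof.
have d_gt0 : (0 < d)%N by case: posnP d_nsq => // -> [] //; exists 0%N.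
have th1 : 1 <= th by rewrite -[1]sqrtr1 ler_wsqrtr // ler1n.
have thd : th <= d%:R by rewrite -th2 expr2; nra.
(* [N] exceeds 2 M d + 1: since |x^2 - d y^2| >= 1, having y <= M would force |x - y sqrt d| >= 1/(2
   M d + 1). *)
pose N := (M * d + 1 + M * d).+1.
have [x [y [/andP[y_gt0 yN] hN]]] := @dirichlet_approx N isT.
have N1 : 1 <= N%:R :> R by rewrite ler1n.
set D : R := x%:R - y%:R * th in hN.
have y1 : 1 <= y%:R :> R by rewrite ler1n.
have x0 : 0 <= x%:R :> R by rewrite ler0n.
have D1 : `|D| < 1.
  by apply: le_lt_trans hN; rewrite ler_peMl.
have nE : (x%:R ^+ 2 - d%:R * y%:R ^+ 2 : R) = D * (x%:R + y%:R * th).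
  by rewrite -th2 /D; ring.
have Dlt : - 1 < D < 1 by rewrite -ltr_norml.
have n1 : 1 <= `|x%:R ^+ 2 - d%:R * y%:R ^+ 2 : R|.
  have /eqP := norm_form_neq0 x y_gt0.
  rewrite -!natrX -natrM => ne.
  case: (ltngtP (x ^ 2)%N (d * y ^ 2)%N) => [lt|lt|//].
    rewrite distrC -natrB ?(ltnW lt) // ger0_norm ?ler0n // ler1n subn_gt0 //.
  by rewrite -natrB ?(ltnW lt) // ger0_norm ?ler0n // ler1n subn_gt0.
have S0 : 0 <= x%:R + y%:R * th by rewrite addr_ge0 ?mulr_ge0 ?ler0n.
have Sle : x%:R + y%:R * th <= 2 * (y%:R * th) + 1 by move: Dlt; rewrite /D; lra.
have nle : `|x%:R ^+ 2 - d%:R * y%:R ^+ 2 : R| < (2 * d + 1)%:R + 1.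
  rewrite nE normrM [X in _ * X]ger0_norm // natrD natrM.
  have yNR : y%:R <= N%:R :> R by rewrite ler_nat.
  have : `|D| * (x%:R + y%:R * th) <= `|D| * (2 * (y%:R * th) + 1) by rewrite ler_wpM2l.
  have : `|D| * y%:R <= N%:R * `|D| by rewrite mulrC ler_wpM2r.
  have : 0 <= `|D| by [].
  nra.
exists x, y; split.
- rewrite ltnNge; apply/negP=> yM.
  suff : N%:R * `|D| >= 1 by lra.
  apply: le_trans n1 _; rewrite nE normrM mulrC ler_wpM2r // ger0_norm //.
  apply: le_trans Sle _.
  have : y%:R * th <= (M * d)%:R by rewrite natrM ler_pM ?ler0n // ler_nat.
  rewrite /N -addn1 !natrD; lra.
- have := ler_norm (x%:R ^+ 2 - d%:R * y%:R ^+ 2 : R) => h.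
  rewrite -ltnS -(ltr_nat R) -natr1 !natrD natrM natrX natrX; move: nle h; rewrite !natrD; lra.
- have := ler_norm (- (x%:R ^+ 2 - d%:R * y%:R ^+ 2 : R)); rewrite normrN => h.
  rewrite -ltnS -(ltr_nat R) -natr1 !natrD natrM natrX natrX; move: nle h; rewrite !natrD; lra.
Qed.

(** The quotient of x1 + y1 sqrt d by x2 + y2 sqrt d is integral because the two are congruent
    modulo their common norm n; it is u - w sqrt d in the proof. Distinct y1^2 and y2^2 ensure w !=
    0. *)
Lemma pell_of_congruent_norms (n x1 y1 x2 y2 : int) :
  n != 0 -> y1 ^+ 2 != y2 ^+ 2 ->
  x1 ^+ 2 - d%:Z * y1 ^+ 2 = n -> x2 ^+ 2 - d%:Z * y2 ^+ 2 = n ->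
  (n %| x1 - x2)%Z -> (n %| y1 - y2)%Z ->
  exists x y : nat, (0 < y)%N /\ (x ^ 2 = d * y ^ 2 + 1)%N.
Proof.
move=> n0 y12 e1 e2 /dvdzP [s sE] /dvdzP [t tE].
have x2E : x2 = x1 - s * n by rewrite -sE; ring.
have y2E : y2 = y1 - t * n by rewrite -tE; ring.
pose u := 1 - (x1 * s - d%:Z * y1 * t); pose w := s * y1 - t * x1.
have uE : u * n = x1 * x2 - d%:Z * y1 * y2 by rewrite /u x2E y2E -e1; ring.
have wE : w * n = x1 * y2 - x2 * y1 by rewrite /w x2E y2E; ring.
have pell : u ^+ 2 - d%:Z * w ^+ 2 = 1.
  have n2 : n ^+ 2 != 0 by rewrite expf_neq0.
  apply: (mulIf n2).
  have -> : (u ^+ 2 - d%:Z * w ^+ 2) * n ^+ 2 = (u * n) ^+ 2 - d%:Z * (w * n) ^+ 2 by ring.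
  have -> : 1 * n ^+ 2 = (x1 ^+ 2 - d%:Z * y1 ^+ 2) * (x2 ^+ 2 - d%:Z * y2 ^+ 2).
    by rewrite e1 e2; ring.
  by rewrite uE wE; ring.
have w0 : w != 0.
  apply: contra_neq y12 => w0; move: wE; rewrite w0 mul0r => /esym/eqP.
  rewrite subr_eq0 => /eqP E; apply: (mulIf n0).
  rewrite -{1}e2 -e1.
  have : (x1 * y2) ^+ 2 = (x2 * y1) ^+ 2 by rewrite E.
  rewrite !exprMn => E2; rewrite !mulrBr [y1 ^+ 2 * _]mulrC -E2; ring.
exists `|u|%N, `|w|%N; split; first by rewrite absz_gt0.
by move: pell; rewrite -!absz_sqr; move: (_ ^ 2)%N (_ ^ 2)%N => a b; clear; lia.
Qed.

(** Iterating [small_norm_pairs] gives pairs of bounded norm with increasing second coordinate; two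
    of them share the norm and the residues modulo it. *)
Lemma pell_exists : exists x y : nat, (0 < y)%N /\ (x ^ 2 = d * y ^ 2 + 1)%N.
Proof.
set C := (2 * d + 1)%N.
have /boolp.choice[f /boolp.choice[g fgP]] := small_norm_pairs.
pose h := fix h i := if i is i'.+1 then g (h i') else 0%N.
have hS i : (h i < h i.+1)%N by have [] := fgP (h i).
have h_mono i j : (i < j)%N -> (h i < h j)%N.
  elim: j => // j IH; rewrite ltnS leq_eqVlt => /orP[/eqP->|/IH lt]; first exact: hS.
  exact: ltn_trans lt (hS j).
pose X i := f (h i); pose Y i := g (h i).
have XY i : (X i ^ 2 <= d * Y i ^ 2 + C)%N /\ (d * Y i ^ 2 <= X i ^ 2 + C)%N.
  by have [] := fgP (h i).
pose nm i : int := (X i)%:Z ^+ 2 - d%:Z * (Y i)%:Z ^+ 2.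
have nmb i : (`|nm i| <= C)%N by have := XY i; rewrite /nm; lia.
pose T := ('I_(2 * C).+1 * ('I_C.+1 * 'I_C.+1))%type.
(* Adding [C] moves the norm from [-C, C] into [0, 2C], so [inord] loses no information. *)
pose col i : T := (inord (absz (nm i + C%:Z)),
  (inord (absz (modz (X i)%:Z (nm i))), inord (absz (modz (Y i)%:Z (nm i))))).
have : ~~ injectiveb (fun i : 'I_#|{: T}|.+1 => col i).
  by apply/negP=> /injectiveP /leq_card; rewrite card_ord ltnn.
move=> /injectivePn[i [j ij]].
have {}ij : (i : nat) != j := ij.
have nm0 k : nm k != 0.
  rewrite /nm subr_eq0; apply/eqP => E.
  have Yk : (0 < Y k)%N by apply: leq_ltn_trans (hS k).
  by have /eqP := norm_form_neq0 (X k) Yk; lia.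
case=> /(congr1 val) /=; rewrite !inordK; [|have := nmb j; lia|have := nmb i; lia].
move=> e1.
have enm : nm i = nm j by have := nmb j; have := nmb i; lia.
have modb k (z : int) : (absz (modz z (nm k)) < C.+1)%N.
  have := nmb k; have := modz_ge0 z (nm0 k); have := ltz_mod z (nm0 k); lia.
move=> /(congr1 val) /=; rewrite !inordK ?modb // => e2.
move=> /(congr1 val) /=; rewrite !inordK ?modb // => e3.
have em (a b : int) : absz (modz a (nm i)) = absz (modz b (nm j)) -> (nm i %| a - b)%Z.
  rewrite -eqz_mod_dvd -enm => E; apply/eqP.
  move: E (modz_ge0 a (nm0 i)) (modz_ge0 b (nm0 i)).
  by move: (modz _ _) (modz _ _) => u v; clear; lia.
apply: (@pell_of_congruent_norms (nm i) (X i) (Y i) (X j) (Y j)) => //.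
- have Yij : Y i <> Y j.
    move=> E; case: (ltngtP (i : nat) (j : nat)) ij => // lt _.
      by have := h_mono i.+1 j.+1 lt; rewrite -[h i.+1]/(Y i) E ltnn.
    by have := h_mono j.+1 i.+1 lt; rewrite -[h i.+1]/(Y i) E ltnn.
  rewrite eqrXn2 // eqz_nat; exact/eqP.
- exact: em.
- exact: em.
Qed.

End Pell.

(** * Squarefree numbers and Pell classes *)

Definition squarefree (n : nat) : Prop := (0 < n)%N /\ forall p, (logn p n <= 1)%N.

Lemma even_logn_square n : (0 < n)%N -> (forall p, ~~ odd (logn p n)) -> perfect_square n.
Proof.
move=> n_gt0 ev; exists (\prod_(p <- primes n) p ^ (logn p n)./2).
rewrite {1}(prod_prime_decomp n_gt0) prime_decompE big_map /=.
rewrite (big_morph (expn^~ 2) (fun a b => expnMn a b 2) (exp1n 2)).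
by apply: eq_bigr => p _; rewrite -expnM muln2 even_halfK.
Qed.

Lemma square_even_logn n p : perfect_square n -> ~~ odd (logn p n).
Proof. by case=> k ->; rewrite lognX oddM. Qed.

Lemma squarefree_dvd m n : (m %| n)%N -> squarefree n -> squarefree m.
Proof.
move=> mn [n0 h]; split; first exact: dvdn_gt0 mn.
by move=> p; apply: leq_trans (h p); apply: dvdn_leq_log.
Qed.

Lemma squarefree_mul_square m n :
  squarefree m -> squarefree n -> perfect_square (m * n) -> m = n.
Proof.
move=> [m0 hm] [n0 hn] sq; apply: eqn_from_log => // p.
have := square_even_logn p sq; rewrite lognM // oddD.
by case: (logn p m) (hm p) => [|[]] //; case: (logn p n) (hn p) => [|[]].
Qed.

Lemma squarefree_coprimeM m n : squarefree (m * n) -> coprime m n.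
Proof.
move=> [mn0 h]; have [m0 n0] : (0 < m /\ 0 < n)%N by move: mn0; rewrite muln_gt0 => /andP.
rewrite coprime_has_primes //; apply/hasPn => p; rewrite !mem_primes => /and3P[pp _ pn].
apply/negP => /and3P[_ _ pm]; have := h p; rewrite lognM //.
by rewrite leqNgt => /negP[]; apply: (@leq_add 1 1); rewrite logn_gt0 mem_primes pp ?m0 ?n0.
Qed.

Lemma squarefreeM m n : squarefree m -> squarefree n -> coprime m n -> squarefree (m * n).
Proof.
move=> [m0 hm] [n0 hn] co; split; first by rewrite muln_gt0 m0.
move=> p; rewrite lognM //.
case: (posnP (logn p m)) => [->|]; first exact: hn.
case: (posnP (logn p n)) => [->|]; first by rewrite addn0.
rewrite !logn_gt0 => pn pm; move: co; rewrite coprime_has_primes // => /hasPn/(_ _ pn).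
by rewrite pm.
Qed.

Lemma squarefree_prime p : prime p -> squarefree p.
Proof.
move=> pp; split; first exact: prime_gt0.
by move=> q; rewrite logn_prime //; case: eqP.
Qed.

Lemma perfect_square_mull a n : (0 < a)%N -> perfect_square (a ^ 2 * n) -> perfect_square n.
Proof.
move=> a0 [k E].
have : (a ^ 2 %| k ^ 2)%N by rewrite -E dvdn_mulr.
rewrite dvdn_pexp2r // => /dvdnP[m km]; exists m; apply/eqP.
rewrite -(eqn_pmul2l (m := (a ^ 2)%N)) ?expn_gt0 ?a0 //.
by rewrite E km mulnC expnMn.
Qed.

Lemma coprime_mul_square m n : coprime m n -> perfect_square (m * n) -> perfect_square m.
Proof.
case: (posnP m) => [-> _ _|m0]; first by exists 0%N.
case: (posnP n) => [->|n0]; first by rewrite /coprime gcdn0 => /eqP-> _; exists 1%N.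
move=> co sq; apply: even_logn_square => // p.
have := square_even_logn p sq; rewrite lognM // oddD.
case: (posnP (logn p m)) => [->//|pm].
suff -> : logn p n = 0%N by rewrite addbF.
apply/eqP; rewrite -leqn0 leqNgt; apply/negP => pn.
move: co pm pn; rewrite !logn_gt0 coprime_has_primes // => /hasPn h pm /h.
by rewrite pm.
Qed.

(** Take A = gcd(m, d). As d is squarefree, m/A is prime to d/A, so d/A divides n, and what remains
    of m and n are coprime factors of y^2. *)
Lemma coprime_mul_eq d m n y : squarefree d -> coprime m n -> (m * n = d * y ^ 2)%N ->
  (0 < m)%N -> exists A B u v, [/\ (A * B = d)%N, (m = A * u ^ 2)%N & (n = B * v ^ 2)%N].
Proof.
move=> sd co E m0; have d0 := sd.1.
pose A := gcdn m d; pose B := (d %/ A)%N.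
have AB : (A * B = d)%N by rewrite mulnC divnK // dvdn_gcdr.
have A0 : (0 < A)%N by rewrite gcdn_gt0 m0.
have [m' mE] : exists m', (m = A * m')%N by exists (m %/ A)%N; rewrite mulnC divnK // dvdn_gcdl.
have E2 : (m' * n = B * y ^ 2)%N.
  by apply/eqP; rewrite -(eqn_pmul2l A0) mulnA -mE E mulnA AB.
have cAB : coprime A B by apply: squarefree_coprimeM; rewrite AB.
have coB : coprime m' B.
  apply/eqP; set g := gcdn _ _.
  have gm : (A * g %| m)%N by rewrite mE dvdn_pmul2l // dvdn_gcdl.
  have gd : (A * g %| d)%N by rewrite -AB dvdn_pmul2l // dvdn_gcdr.
  have : (A * g %| A)%N by rewrite dvdn_gcd gm gd.
  by rewrite -{2}[A]muln1 dvdn_pmul2l // dvdn1 => /eqP.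
have [n' nE] : exists n', (n = B * n')%N.
  have : (B %| m' * n)%N by rewrite E2 dvdn_mulr.
  rewrite Gauss_dvdr 1?coprime_sym // => /dvdnP[n' ->]; exists n'; exact: mulnC.
have B0 : (0 < B)%N by move: d0; rewrite -AB muln_gt0 => /andP[].
have E3 : (m' * n' = y ^ 2)%N.
  by apply/eqP; rewrite -(eqn_pmul2l B0) -E2 nE mulnCA.
have co' : coprime m' n'.
  by move: co; rewrite mE nE coprimeMl !coprimeMr => /andP[_ /andP[]].
have [u uE] : perfect_square m' by apply: coprime_mul_square co' _; exists y.
have [v vE] : perfect_square n'.
  by apply: (@coprime_mul_square _ m'); [rewrite coprime_sym|exists y; rewrite mulnC].
by exists A, B, u, v; rewrite AB mE nE uE vE.
Qed.

Section PellClasses.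
Variable d : nat.
Hypotheses (d_sqf : squarefree d) (d_mod4 : (d %% 4 = 1)%N).

(* Units of norm 1 of Q(sqrt d), for d = 1 mod 4, are the (X + Y sqrt d)/2. *)
Definition pell4 X Y := (X ^ 2 = d * Y ^ 2 + 4)%N.

Lemma pell4_split X Y : pell4 X Y -> exists A B u v,
  [/\ (A * B = d)%N, (X + 2 = A * u ^ 2)%N & (X = B * v ^ 2 + 2)%N].
Proof.
rewrite /pell4 => E; have X2 : (2 <= X)%N by nia.
have E' : ((X + 2) * (X - 2) = d * Y ^ 2)%N by nia.
have dq : (d = 4 * (d %/ 4) + 1)%N by rewrite {1}(divn_eq d 4) d_mod4 mulnC.
case oX: (odd X).
  have co : coprime (X + 2) (X - 2).
    have oX2 : odd (X - 2) by rewrite oddB // oX.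
    have -> : (X + 2 = X - 2 + 2 ^ 2)%N by lia.
    by rewrite coprime_sym /coprime gcdnDl -/(coprime _ _) coprimeXr // coprimen2.
  have [|A [B [u [v [h1 h2 h3]]]]] := coprime_mul_eq d_sqf co E'; first by lia.
  by exists A, B, u, v; split => //; lia.
have [x xE] : exists x, X = (2 * x)%N by exists X./2; lia.
have dodd : odd d by lia.
have [y yE] : exists y, Y = (2 * y)%N.
  have : ~~ odd (d * Y ^ 2) by have := E; lia.
  by rewrite oddM dodd /= oddX /= => eY; exists Y./2; lia.
have E1 : (x ^ 2 = d * y ^ 2 + 1)%N by nia.
(* An even x would give d y^2 = -1 modulo 4, impossible for d = 1 modulo 4. *)
have ox : odd x.
  apply/negPn/negP => ex; have [z zE] : exists z, x = (2 * z)%N by exists x./2; lia.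
  case oy: (odd y).
    have [w wE] : exists w, y = (2 * w + 1)%N by exists y./2; lia.
    move: E1; rewrite dq zE wE; lia.
  have [w wE] : exists w, y = (2 * w)%N by exists y./2; lia.
  move: E1; rewrite dq zE wE; lia.
have [k kE] : exists k, x = (2 * k + 1)%N by exists x./2; lia.
have [w wE] : exists w, y = (2 * w)%N.
  have : ~~ odd (d * y ^ 2) by have := E1; rewrite kE; lia.
  by rewrite oddM dodd /= oddX /= => eY; exists y./2; lia.
have E2 : ((k + 1) * k = d * w ^ 2)%N.
  move: E1; have -> : (x ^ 2 = 4 * ((k + 1) * k) + 1)%N by rewrite kE; ring.
  have -> : (d * y ^ 2 = 4 * (d * w ^ 2))%N by rewrite wE; ring.
  by move: ((k + 1) * k)%N (d * w ^ 2)%N => s t; clear; lia.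
have co : coprime (k + 1) k by rewrite addn1 coprimeSn.
have [|A [B [u [v [h1 h2 h3]]]]] := coprime_mul_eq d_sqf co E2; first by lia.
exists A, B, (2 * u)%N, (2 * v)%N.
have -> : (A * (2 * u) ^ 2 = 4 * (A * u ^ 2))%N by ring.
have -> : (B * (2 * v) ^ 2 = 4 * (B * v ^ 2))%N by ring.
by rewrite -h2 -h3; split => //; move: xE kE; clear; lia.
Qed.

Hypothesis d_gt1 : (1 < d)%N.

Lemma squarefree_nonsquare : ~ perfect_square d.
Proof.
move=> sq; have := @squarefree_mul_square d 1 d_sqf; rewrite muln1 => h.
by move: d_gt1; rewrite h // ; split => // p; rewrite logn1.
Qed.

(** [2 < X] discards the unit 1, which has X = 2; among units larger than 1 of norm 1, the trace X
    grows with the unit. *)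
Definition fundamental X Y :=
  [/\ pell4 X Y, (2 < X)%N & forall X' Y', pell4 X' Y' -> (2 < X')%N -> (X <= X')%N].

Lemma fundamental_exists (R : rcfType) : exists X Y, fundamental X Y.
Proof.
have [x [y [y0 E]]] := pell_exists R squarefree_nonsquare.
have ex : exists X, `[< (2 < X)%N /\ exists Y, pell4 X Y >].
  exists (2 * x)%N; apply/asboolP; split; first by nia.
  by exists (2 * y)%N; rewrite /pell4 !expnMn E; lia.
case: (ex_minnP ex) => X /asboolP[X2 [Y XY]] Xmin; exists X, Y; split => //.
by move=> X' Y' h h2; apply: Xmin; apply/asboolP; split => //; exists Y'.
Qed.

(* The unit e of a solution X satisfies (1 + e)^2 = e (X + 2), so X + 2 represents e
   modulo squares. Dividing e by the fundamental unit yields a smaller solution Z, and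
   (X + 2) (Z + 2) (X1 + 2) = (2 + X + Z + X1)^2. *)
Lemma pell4_class X1 Y1 : fundamental X1 Y1 -> forall X Y, pell4 X Y ->
  perfect_square (X + 2) \/ perfect_square ((X + 2) * (X1 + 2)).
Proof.
move=> [E1 X1_gt2 X1min] X; elim/ltn_ind: X => X IH Y E.
have X2 : (2 <= X)%N by move: E; rewrite /pell4; nia.
case: (ltngtP 2 X) X2 => // [lt2 _|<- _]; last by left; exists 2%N.
have X1X := X1min _ _ E lt2.
have dq : (d = 4 * (d %/ 4) + 1)%N by rewrite {1}(divn_eq d 4) d_mod4 mulnC.
have par Z W : pell4 Z W -> odd Z = odd W.
  move=> /(congr1 odd); rewrite oddX oddD oddM oddX /=.
  have -> : odd d by lia.
  by rewrite addbF.
have /= p0 := par _ _ E; have p1 := par _ _ E1.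
rewrite /pell4 in E E1.
pose p := (d * Y ^ 2)%N; pose q := (d * Y1 ^ 2)%N; pose t := (d * (Y * Y1))%N.
have t2 : (t ^ 2 = p * q)%N by rewrite /t /p /q; ring.
have lt1 : (t < X * X1)%N.
  rewrite -(ltn_exp2r _ _ (isT : 0 < 2)%N) expnMn E E1 t2 -/p -/q.
  by move: (p) (q) => p' q'; clear; nia.
(* (Z + W sqrt d)/2, with [W] introduced below, is the product of (X + Y sqrt d)/2 and (X1 - Y1 sqrt
   d)/2, the quotient by the fundamental unit. *)
have [Z ZE] : exists Z, (X * X1 = t + 2 * Z)%N.
  exists (X * X1 - t)./2.
  have : ~~ odd (X * X1 - t).
    rewrite oddB ?(ltnW lt1) // !oddM p0 p1; have -> : odd d by lia.
    by rewrite /= addbb.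
  by move: lt1; clear; lia.
have Y1Y : (Y1 ^ 2 <= Y ^ 2)%N.
  rewrite -(leq_pmul2l (m := d)) ?(ltnW d_gt1) // -(leq_add2r 4) -E -E1.
  by rewrite leq_exp2r.
have YX : (X * Y1 <= Y * X1)%N.
  rewrite -(leq_exp2r _ _ (isT : 0 < 2)%N) !expnMn E E1.
  by move: Y1Y; move: (Y ^ 2)%N (Y1 ^ 2)%N; clear; nia.
have [W WE] : exists W, (Y * X1 = X * Y1 + 2 * W)%N.
  exists (Y * X1 - X * Y1)./2.
  have : ~~ odd (Y * X1 - X * Y1) by rewrite oddB // !oddM p0 p1 addbb.
  by move: YX; clear; lia.
have EZ : pell4 Z W.
  have h1 : ((2 * Z) ^ 2 + 2 * (X * X1 * t) = (p + 4) * (q + 4) + p * q)%N.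
    by rewrite -E -E1 -t2 -expnMn ZE; ring.
  have h2 : (d * (2 * W) ^ 2 + 2 * (X * X1 * t) = p * (q + 4) + (p + 4) * q)%N.
    have -> : (p * (q + 4) + (p + 4) * q = d * ((Y * X1) ^ 2 + (X * Y1) ^ 2))%N.
      by rewrite -E -E1 /p /q; ring.
    have -> : (X * X1 * t = d * ((Y * X1) * (X * Y1)))%N by rewrite /t; ring.
    by rewrite WE; ring.
  rewrite /pell4; move: h1 h2.
  have -> : (d * (2 * W) ^ 2 = 4 * (d * W ^ 2))%N by ring.
  have -> : ((2 * Z) ^ 2 = 4 * Z ^ 2)%N by ring.
  move: (Z ^ 2)%N (d * W ^ 2)%N (X * X1 * t)%N => z w s; move: (p) (q) => p' q'; clear; lia.
(* If X <= Z, put a = X1 - 2. Then t <= X a, and t^2 = p q with q = a (a + 4) gives p <= a, that is,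
   X^2 <= X1 + 2 <= X + 2, against X > 2. *)
have ZX : (Z < X)%N.
  rewrite ltnNge; apply/negP => XZ.
  have [a aE] : exists a, X1 = (a + 2)%N by exists (X1 - 2)%N; lia.
  have h : (t ^ 2 <= (X * a) ^ 2)%N.
    by rewrite leq_exp2r //; move: ZE XZ; rewrite aE; clear; nia.
  have a0 : (0 < a)%N by move: X1_gt2; rewrite aE; clear; lia.
  have qE : q = (a * (a + 4))%N by move: E1; rewrite -/q aE; clear; nia.
  have : (p * (a + 4) <= X ^ 2 * a)%N.
    rewrite -(leq_pmul2l a0); move: h; rewrite t2 qE expnMn; clear.
    by move: (X ^ 2)%N; lia.
  move=> h2; have pa : (p <= a)%N.
    by move: h2; rewrite E -/p; move: (p) => p'; clear; lia.
  by move: E pa X1X lt2; rewrite -/p aE; move: (p) => p'; clear; nia.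
have key : ((X + 2) * (Z + 2) * (X1 + 2) = (2 + X + Z + X1) ^ 2)%N.
  have h1 : (t * Z + 2 * Z ^ 2 = X * X1 * Z)%N by rewrite ZE; ring.
  have h2 : ((p + 4) * (q + 4) = p * q + 4 * (t * Z) + 4 * Z ^ 2)%N.
    by rewrite -E -E1 -t2 -expnMn ZE; ring.
  have h : (X ^ 2 + X1 ^ 2 + Z ^ 2 = X * X1 * Z + 4)%N.
    rewrite E E1 -/p -/q; move: h1 h2; move: (Z ^ 2)%N (t * Z)%N (X * X1 * Z)%N.
    by move: (p) (q) => p' q'; clear; lia.
  by move: h; clear; nia.
have X0 : (0 < Z + 2)%N by rewrite addn2.
case: (IH Z ZX W EZ) => sq; [right|left].
  have [k kE] := sq; rewrite kE in key X0.
  have k0 : (0 < k)%N by case: (k) X0.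
  apply: (perfect_square_mull k0); exists (2 + X + Z + X1)%N; rewrite -key; ring.
have [k kE] := sq.
have k0 : (0 < k)%N by case: (posnP k) kE => // ->; rewrite !addn2.
apply: (perfect_square_mull k0); exists (2 + X + Z + X1)%N; rewrite -key -kE; ring.
Qed.

(** A square X + 2 forces A = 1, so X + 2 = u^2 and X - 2 = d v^2. Then (u, v) is a solution with
    smaller trace: the fundamental unit would be the square of another unit. *)
Lemma fundamental_not_square X Y : fundamental X Y -> ~ perfect_square (X + 2).
Proof.
move=> [E X2 Xmin] [k kE].
have [A [B [u [v [AB uE vE]]]]] := pell4_split E.
have A1 : A = 1%N.
  have sA : squarefree A by apply: squarefree_dvd d_sqf; rewrite -AB dvdn_mulr.
  apply: squarefree_mul_square => //; first by split => // p; rewrite logn1.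
  have u0 : (0 < u)%N by case: (posnP u) uE => // ->; rewrite muln0 addn2.
  apply: (perfect_square_mull u0); exists k; rewrite -kE uE; ring.
rewrite A1 !mul1n in AB uE; subst B.
have u2 : (2 < u)%N by move: uE X2; clear; nia.
have : (X <= u)%N.
  by apply: (Xmin u v) => //; rewrite /pell4 -uE vE -addnA.
by move: uE u2; clear; nia.
Qed.

End PellClasses.

Local Open Scope ring_scope.

(** * Primes modulo which 5 is not a square *)

Section FiveNonResidue.

Definition mx22 (R : nzRingType) (a b c d : R) : 'M[R]_2 :=
  \matrix_(i, j) (if i == 0 then (if j == 0 then a else b) else (if j == 0 then c else d)).

Lemma mx22M (R : nzRingType) (a b c d a' b' c' d' : R) :
  mx22 a b c d * mx22 a' b' c' d' =
  mx22 (a * a' + b * c') (a * b' + b * d') (c * a' + d * c') (c * b' + d * d').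
Proof.
apply/matrixP => i j; rewrite !mxE !big_ord_recl big_ord0 !mxE /= addr0.
by case: i => [[|[|//]] ?]; case: j => [[|[|//]] ?].
Qed.

Lemma mx22_1 (R : nzRingType) : mx22 1 0 0 1 = 1 :> 'M[R]_2.
Proof. by apply/matrixP => [[[|[|//]] ?] [[|[|//]] ?]]; rewrite !mxE. Qed.

(* A root w of X^2 + X - 1 is the trace of a primitive fifth root of unity, realised
   here as a matrix of trace w and determinant 1; so 5 divides #|GL_2(F)|. *)
Lemma golden_GL2_order5 (F : finFieldType) (w : F) : w ^+ 2 = 1 - w ->
  exists g : {'GL_2[F]}, #[g]%g = 5%N.
Proof.
move=> w2; pose M := mx22 0 (-1) 1 w.
have M2 : M ^+ 2 = mx22 (-1) (- w) w (- w).
  by rewrite expr2 mx22M; congr mx22; rewrite -?expr2 ?w2; ring.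
have M4 : M ^+ 4 = mx22 w 1 (-1) 0.
  rewrite (exprM M 2 2) M2 expr2 mx22M; congr mx22.
  - have -> : -1 * -1 + - w * w = 1 - w ^+ 2 by ring.
    by rewrite w2; ring.
  - have -> : -1 * - w + - w * - w = w + w ^+ 2 by ring.
    by rewrite w2; ring.
  - have -> : w * -1 + - w * w = - w - w ^+ 2 by ring.
    by rewrite w2; ring.
  - by ring.
have M5 : M ^+ 5 = 1.
  by rewrite exprSr M4 mx22M -mx22_1; congr mx22; ring.
have uM : M \is a GRing.unit.
  by have [] : M \in unitmx /\ M ^+ 4 \in unitmx by apply: mulmx1_unit; rewrite mulmxE -exprS.
pose g : {'GL_2[F]} := FinRing.Unit uM.
have g5 : (g ^+ 5 = 1)%g by apply: val_inj; exact: M5.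
exists g; have : (#[g]%g %| 5)%N by rewrite order_dvdn g5.
rewrite dvdn_divisors // inE => /orP[|]; last by rewrite inE => /eqP.
rewrite order_eq1 => /eqP /(congr1 val) /= E.
have := congr1 (fun A : 'M[F]_2 => A 0 0) E.
by rewrite !mxE /= => /eqP; rewrite eq_sym oner_eq0.
Qed.

(** A root x of 5 makes (x - 1)/2 a root of w^2 = 1 - w, whence an element of order 5 in GL_2(F_q).
    The order of this group has only the prime factors of q, q - 1 and q + 1, so q would be 0, 1 or
    4 modulo 5. *)
Lemma five_nonresidue q (x : 'F_q) : prime q -> odd q ->
  (q %% 5 = 2 \/ q %% 5 = 3)%N -> x ^+ 2 <> 5%:R.
Proof.
move=> q_pr q_odd q5 x2.
have n2 : 2%:R != 0 :> 'F_q.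
  rewrite -(dvdn_pcharf (pchar_Fp q_pr)) dvdn_prime2 //; by apply/eqP => q2; rewrite q2 in q_odd.
have n4 : 4%:R != 0 :> 'F_q by rewrite (natrM _ 2 2) mulf_neq0.
pose w : 'F_q := (x - 1) / 2%:R.
have [g og] : exists g : {'GL_2['F_q]}, #[g]%g = 5%N.
  apply: (@golden_GL2_order5 _ w).
  have : w ^+ 2 * 4%:R = (1 - w) * 4%:R.
    have -> : w ^+ 2 * 4%:R = x ^+ 2 - 2%:R * x + 1 by rewrite /w; field.
    by rewrite x2 /w; field.
  exact: mulIf.
have := order_dvdG (finset.in_setT g); rewrite og card_GL_2 card_Fp // !Euclid_dvdM//.
move=> h; have q0 := prime_gt0 q_pr.
have {h} : [|| 5 %| q, 5 %| q.-1 | 5 %| q.+1]%N.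
  by case/orP: h => [/orP[->//|/orP[]->]|->]; rewrite ?orbT.
by case: q5; lia.
Qed.

End FiveNonResidue.

(* By reciprocity 5 is not a square modulo such a prime, while -1 is. *)
Definition good_prime (l : nat) : Prop :=
  [/\ prime l, (l %% 4 = 1)%N, (l %% 5 = 2)%N \/ (l %% 5 = 3)%N &
      exists x, (l %| x ^ 2 + 1)%N].

Lemma good_prime13 : good_prime 13.
Proof. by split => //; [right|exists 5%N]. Qed.

(** If l = 3 modulo 4, then (l - 1)/2 is odd and x^(l - 1) = (-1)^((l - 1)/2) = -1 contradicts
    Fermat. *)
Lemma minus1_square_mod4 l x : prime l -> odd l -> (l %| x ^ 2 + 1)%N -> (l %% 4 = 1)%N.
Proof.
move=> l_pr l_odd lx.
have E : (x%:R : 'F_l) ^+ 2 = -1.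
  apply/eqP; rewrite -subr_eq0 opprK -natrX natr1 -addn1 -(dvdn_pcharf (pchar_Fp l_pr)) //.
have x0 : (x%:R : 'F_l) != 0.
  by apply: contra_eq_neq E => ->; rewrite expr0n /= eq_sym oppr_eq0 oner_eq0.
have F : (x%:R : 'F_l) ^+ l.-1 = 1.
  have := expf_card (x%:R : 'F_l); rewrite card_Fp // => e.
  apply: (mulfI x0); rewrite -exprS mulr1 prednK ?prime_gt0 //.
have n2 : 2%:R != 0 :> 'F_l.
  rewrite -(dvdn_pcharf (pchar_Fp l_pr)) dvdn_prime2 //; by apply/eqP => q2; rewrite q2 in l_odd.
case: (eqVneq (l %% 4)%N 1%N) => // l4.
have l3 : (l.-1 = 2 * (2 * (l %/ 4) + 1))%N by lia.
move: F; rewrite l3 exprM E exprD exprM sqrrN expr1n expr1n mul1r => /eqP.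
by rewrite -subr_eq0 -opprD oppr_eq0 -[1 + 1]/(2%:R) (negPf n2).
Qed.

(** P collects the numbers up to M + 2 prime to 5, so P^4 = 1 and N = P^8 + 1 = 2 modulo 5. Primes
    that are 1 or 4 modulo 5 multiply to 1 or 4 only, so N has another prime factor l. It does not
    divide P, hence l > M + 2, which also excludes 2; and N = (P^4)^2 + 1 makes -1 a square modulo
    l. *)
Lemma good_prime_exists (M : nat) : exists2 l, good_prime l & (M < l)%N.
Proof.
pose P := (\prod_(i < M.+2 | ~~ (5 %| i.+1)) i.+1)%N.
have dvP i : (0 < i <= M.+2)%N -> ~~ (5 %| i)%N -> (i %| P)%N.
  case: i => // i /andP[_ iM] i5.
  by rewrite /P (bigD1 (Ordinal iM)) //= dvdn_mulr.
have P5 : ~~ (5 %| P)%N.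
  rewrite /P; apply: (big_ind (fun m => ~~ (5 %| m)%N)) => // a b a5 b5.
  by rewrite Euclid_dvdM // negb_or a5.
pose N := ((P ^ 4) ^ 2 + 1)%N.
have N5 : (N %% 5 = 2)%N.
  have : (P %% 5)%N \in [:: 1; 2; 3; 4]%N.
    have := ltn_pmod P (isT : 0 < 5)%N; move: P5; rewrite /dvdn.
    by case: (P %% 5)%N => [|[|[|[|[|]]]]].
  rewrite /N -modnDml -!expnM -modnXm.
  by rewrite !inE => /or4P[]/eqP->.
have N0 : (0 < N)%N by rewrite /N addn1.
have [l l_pr [lN l5]] : exists2 l, prime l & (l %| N)%N /\ ~ ((l %% 5 = 1)%N \/ (l %% 5 = 4)%N).
  apply: contrapT => h.
  have : (N %% 5 \in [:: 1; 4])%N.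
    rewrite (prod_prime_decomp N0) prime_decompE big_map /= big_seq.
    apply: (big_ind (fun m => (m %% 5 \in [:: 1; 4])%N)) => //.
      by move=> a b; rewrite -modnMm !inE => /orP[]/eqP-> /orP[]/eqP->.
    move=> p; rewrite mem_primes => /and3P[p_pr _ pN].
    have : (p %% 5 \in [:: 1; 4])%N.
      apply: contrapT => np; apply: h; exists p => //; split => //.
      by case=> e; apply: np; rewrite e.
    elim: (logn p N) => // k IH pk; rewrite expnS -modnMm.
    by move: pk (IH pk); rewrite !inE => /orP[]/eqP-> /orP[]/eqP->.
  by rewrite N5.
have l5' : ~~ (5 %| l)%N.
  rewrite dvdn_prime2 //; by apply/eqP => E; move: lN; rewrite -E /dvdn N5.
have lP : ~~ (l %| P)%N.
  apply/negP => lP; have : (l %| 1)%N.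
    by rewrite -(dvdn_addr (m := (P ^ 4) ^ 2)%N) // !dvdn_exp.
  by rewrite dvdn1 => /eqP l1; rewrite l1 in l_pr.
have lM : (M.+2 < l)%N.
  by rewrite ltnNge; apply: contra lP => lM; apply: dvP; rewrite ?prime_gt0.
exists l; last by lia.
have l_odd : odd l.
  have := even_prime l_pr; case => // E; rewrite E in lM; lia.
split => //.
- exact: minus1_square_mod4 lN.
- have := ltn_pmod l (isT : 0 < 5)%N; move: l5 l5'; rewrite /dvdn.
  case: (l %% 5)%N => [|[|[|[|[|]]]]] // h; by [left|right|case: h; left|case: h; right].
- by exists (P ^ 4)%N.
Qed.

(** * Independence of the relations *)

Section Independence.
Variable ls : seq nat.
Hypotheses (ls_good : forall l, l \in ls -> good_prime l) (ls_uniq : uniq ls)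
  (ls13 : 13%N \in ls).

(* The factors 3 and 7 make -1 a nonresidue, which rules out units of norm -1. *)
Definition radicand (s : seq nat) : nat := (21 * \prod_(l <- s) l)%N.

Local Notation b := (radicand ls).

Lemma good_prime_odd l : good_prime l -> odd l.
Proof. by case=> _ l4 _ _; lia. Qed.

Lemma prime_dvd_prod (s : seq nat) q : prime q -> (forall l, l \in s -> prime l) ->
  (q %| \prod_(l <- s) l)%N -> q \in s.
Proof.
move=> q_pr; elim: s => [|l s IH] sP.
  by rewrite big_nil dvdn1 => /eqP q1; rewrite q1 in q_pr.
rewrite big_cons Euclid_dvdM // inE => /orP[|h].
  by rewrite (dvdn_prime2 q_pr (sP _ (mem_head _ _))) => ->.
by rewrite IH ?orbT // => l' l's; apply: sP; rewrite inE l's orbT.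
Qed.

Lemma prime_dvd_radicand q : prime q -> (q %| b)%N -> q \in [:: 3, 7 & ls]%N.
Proof.
move=> q_pr; rewrite Euclid_dvdM // => /orP[q21|/prime_dvd_prod qls].
  have : q \in primes 21 by rewrite mem_primes q_pr.
  by rewrite !inE => /orP[->|->]; rewrite ?orbT.
by rewrite !inE qls ?orbT // => l /ls_good[].
Qed.

Lemma dvd_radicand l : l \in [:: 3, 7 & ls]%N -> (l %| b)%N.
Proof.
rewrite !inE /radicand => /or3P[/eqP->|/eqP->|lls].
- by rewrite dvdn_mulr.
- by rewrite dvdn_mulr.
- by rewrite dvdn_mull // (big_rem l) //= dvdn_mulr.
Qed.

Lemma radicand_primes q : q \in [:: 3, 7 & ls]%N ->
  [/\ prime q, odd q & (q %% 5 = 2)%N \/ (q %% 5 = 3)%N].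
Proof.
rewrite !inE => /or3P[/eqP->|/eqP->|/ls_good h].
- by split => //; right.
- by split => //; left.
- by split; [case: h|exact: good_prime_odd|case: h].
Qed.

Lemma squarefree_prod_primes (s : seq nat) : uniq s -> (forall l, l \in s -> prime l) ->
  squarefree (\prod_(l <- s) l)%N.
Proof.
elim: s => [|l s IH] /=; first by rewrite big_nil; split => // p; rewrite logn1.
move=> /andP[ls' us] sP; rewrite big_cons; apply: squarefreeM.
- by apply: squarefree_prime; apply: sP; rewrite mem_head.
- by apply: IH => // l' l's; apply: sP; rewrite inE l's orbT.
- rewrite prime_coprime ?sP ?mem_head //; apply: contra ls' => h.
  by apply: prime_dvd_prod => //; [exact/sP/mem_head|move=> l' l's; apply: sP; rewrite inE l's orbT].
Qed.

Lemma radicand5_squarefree : squarefree (5 * b).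
Proof.
have -> : (5 * b = \prod_(l <- [:: 5, 3, 7 & ls]) l)%N by rewrite !big_cons /radicand; ring.
apply: squarefree_prod_primes => [|l]; last first.
  by rewrite inE => /orP[/eqP->//|/radicand_primes[]].
rewrite /= !inE /= ls_uniq andbT; apply/and3P; split; apply/negP => /ls_good[] //.
by move=> _ _ [].
Qed.

Lemma radicand_squarefree : squarefree b.
Proof. by apply: squarefree_dvd radicand5_squarefree; rewrite dvdn_mull. Qed.

Lemma radicand_mod4 : (b %% 4 = 1)%N.
Proof.
rewrite /radicand -modnMml mul1n big_seq.
apply: (big_ind (fun m => m %% 4 = 1)%N) => //.
  by move=> x y x1 y1; rewrite -modnMm x1 y1.
by move=> l /ls_good[].
Qed.

Lemma radicand5_mod4 : (5 * b %% 4 = 1)%N.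
Proof. by rewrite -modnMm radicand_mod4. Qed.

Lemma radicand_gt1 : (1 < b)%N.
Proof.
have [b0 _] := radicand_squarefree; rewrite ltn_neqAle b0 andbT.
by apply/eqP => b1; have := dvd_radicand (mem_head 3%N _); rewrite -b1.
Qed.

(** * Quadratic characters of 5, -1 and -5 modulo the prime factors of the radicand *)

Section ModPrime.
Variable q : nat.
Hypothesis qb : q \in [:: 3, 7 & ls]%N.
Let q_pr : prime q. Proof. by have [] := radicand_primes qb. Qed.
Let q_odd : odd q. Proof. by have [] := radicand_primes qb. Qed.
Let q5 : (q %% 5 = 2)%N \/ (q %% 5 = 3)%N. Proof. by have [] := radicand_primes qb. Qed.

Lemma natr4_neq0 : 4%:R != 0 :> 'F_q.
Proof.
have n2 : 2%:R != 0 :> 'F_q.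
  rewrite -(dvdn_pcharf (pchar_Fp q_pr)) dvdn_prime2 //.
  by apply/eqP => q2; move: q_odd; rewrite q2.
by rewrite (natrM _ 2 2) mulf_neq0.
Qed.

Lemma natr_eq0 n : (q %| n)%N -> n%:R = 0 :> 'F_q.
Proof. by rewrite (dvdn_pcharf (pchar_Fp q_pr)) => /eqP. Qed.

(** Of the possible ratios 5, -1 and -5 between squares, 5 never occurs, -1 only modulo primes of
    [ls], and -5 only modulo 3 and 7, by the two lemmas that follow. *)
Lemma five_ratio (x y : 'F_q) : y != 0 -> x ^+ 2 <> 5%:R * y ^+ 2.
Proof.
move=> y0 E; apply: (@five_nonresidue q (x / y)) => //.
by rewrite expr_div_n E mulfK // expf_neq0.
Qed.

Lemma minus1_ratio (x y : 'F_q) : y != 0 -> x ^+ 2 = - y ^+ 2 -> q \in ls.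
Proof.
move=> y0 E; have E1 : (x / y) ^+ 2 = -1 by rewrite expr_div_n E mulNr divff ?expf_neq0.
have q4 : (q %% 4 = 1)%N.
  apply: (@minus1_square_mod4 q (x / y : 'F_q)) => //.
  rewrite (dvdn_pcharf (pchar_Fp q_pr)) natrD natrX natr_Zp E1 addNr //.
by move: qb q4; rewrite !inE => /or3P[/eqP->|/eqP->|].
Qed.

Lemma minus5_ratio (x y : 'F_q) : y != 0 -> x ^+ 2 = - (5%:R * y ^+ 2) -> q \notin ls.
Proof.
move=> y0 E; apply/negP => /ls_good[_ _ _ [z qz]].
have z2 : z%:R ^+ 2 = -1 :> 'F_q.
  by have := natr_eq0 qz; rewrite natrD natrX => /eqP; rewrite addr_eq0 => /eqP.
apply: (@five_ratio (z%:R * x) y) => //.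
by rewrite exprMn z2 E mulN1r opprK.
Qed.

End ModPrime.

Lemma nat_eqF q (m n : nat) : m = n -> m%:R = n%:R :> 'F_q.
Proof. by move=> ->. Qed.

Lemma prime_factor_radicand A : (A %| b)%N -> A != 1%N ->
  exists2 q, q \in [:: 3, 7 & ls]%N & (q %| A)%N.
Proof.
move=> Ab A1; exists (pdiv A); last exact: pdiv_dvd.
have A0 : (0 < A)%N by apply: dvdn_gt0 Ab; case: radicand_squarefree.
apply: prime_dvd_radicand; last exact: dvdn_trans (pdiv_dvd _) Ab.
by apply: pdiv_prime; rewrite ltn_neqAle eq_sym A1.
Qed.

(** Once characters have sorted the primes, B can only be made of 3 and 7, and has both. This leaves
    a single equation with coefficient 21, to be refuted modulo 13. *)
Lemma split21 A B : (A * B = b)%N ->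
  (forall q, q \in [:: 3, 7 & ls]%N -> (q %| A)%N -> q \in ls) ->
  (forall q, q \in [:: 3, 7 & ls]%N -> (q %| B)%N -> q \notin ls) ->
  B = 21%N /\ (13 %| A)%N.
Proof.
move=> AB hA hB.
have sq := radicand_squarefree; rewrite -AB in sq.
have cAB := squarefree_coprimeM sq.
have B21 : (21 %| B)%N.
  have h q : q \in [:: 3; 7]%N -> (q %| B)%N.
    move=> q37; have qin : q \in [:: 3, 7 & ls]%N.
      by move: q37; rewrite !inE => /orP[]->; rewrite ?orbT.
    have := dvd_radicand qin; rewrite -AB Euclid_dvdM; last by have [] := radicand_primes qin.
    case/orP => // /(hA _ qin) /ls_good[_ q4 _ _].
    by move: q37 q4; rewrite !inE => /orP[]/eqP->.
  by rewrite (@Gauss_dvd 3 7) // !h.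
have [B' BE] := dvdnP B21; split.
  case: (eqVneq B' 1%N) => [B1|B1]; first by rewrite BE B1.
  have Bb : (B %| b)%N by rewrite -AB dvdn_mull.
  have [q qin qB'] := @prime_factor_radicand B' (dvdn_trans (eq_ind_r (fun x => B' %| x)%N (dvdn_mulr _ (dvdnn _)) BE) Bb) B1.
  have nq : q \notin ls by apply: hB => //; rewrite BE dvdn_mulr.
  have sB : squarefree B by apply: squarefree_dvd sq; rewrite dvdn_mull.
  have co : coprime B' 21 by apply: squarefree_coprimeM; rewrite -BE.
  move: (coprime_dvdl qB' co); move: qin nq.
  by rewrite !inE => /or3P[/eqP->|/eqP->|->].
have in13 : 13%N \in [:: 3, 7 & ls]%N by rewrite !inE ls13 !orbT.
have := dvd_radicand in13; rewrite -AB Euclid_dvdM // => /orP[//|/(hB _ in13)].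
by rewrite ls13.
Qed.

(** 21 = 8 is a nonresidue modulo 13, whereas 4 and -4 are both nonzero squares. *)
Lemma mod13 v : ((21 * v ^ 2 + 4) %% 13 <> 0)%N /\ ((21 * v ^ 2) %% 13 <> 4)%N.
Proof.
rewrite -modnDml -modnMmr -modnXm.
have := ltn_pmod v (isT : 0 < 13)%N.
by case: (v %% 13)%N => [|[|[|[|[|[|[|[|[|[|[|[|[|]]]]]]]]]]]]].
Qed.

(** * Solutions for b and 5b whose factorisations would be related *)

Section Cases.
Variables (A B C D u v w z : nat).
Hypotheses (AB : (A * B = b)%N) (A1 : A != 1%N) (B1 : B != 1%N)
  (E2 : (A * u ^ 2 = B * v ^ 2 + 4)%N).

Let Ab : (A %| b)%N. Proof. by rewrite -AB dvdn_mulr. Qed.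
Let Bb : (B %| b)%N. Proof. by rewrite -AB dvdn_mull. Qed.

Let E2F q : A%:R * u%:R ^+ 2 = B%:R * v%:R ^+ 2 + 4%:R :> 'F_q.
Proof. by rewrite -!natrX -!natrM -natrD E2. Qed.

Let cancel_sq (F : fieldType) (a x y k e : F) :
  e != 0 -> a * x ^+ 2 = e -> a * (k * y ^+ 2) = e -> y != 0 /\ x ^+ 2 = k * y ^+ 2.
Proof.
move=> e0 ex ey; have a0 : a != 0 by apply: contra_neq e0 => a0; rewrite -ex a0 mul0r.
split; first by apply: contra_neq e0 => y0; rewrite -ey y0 expr0n /= !mulr0.
by apply: (mulfI a0); rewrite ex ey.
Qed.

(** Modulo a prime factor of A, both B v^2 and 5 B z^2 equal -4, so 5 would be a square. [no_5A_B]
    argues in the same way with a prime factor of B. *)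
Lemma no_A_5B : (A * w ^ 2 <> 5 * B * z ^ 2 + 4)%N.
Proof.
move=> E3; have [q qb qA] := prime_factor_radicand Ab A1.
have n4 := natr4_neq0 qb; have nn4 : - 4%:R != 0 :> 'F_q by rewrite oppr_eq0.
have := E2F q; have /(nat_eqF q) := E3.
rewrite !(natrD, natrM, natrX) (natr_eq0 qb qA) !mul0r => e3 e2.
have [||z0] := @cancel_sq _ B%:R v%:R z%:R 5%:R _ nn4.
- by apply/eqP; rewrite -addr_eq0 -e2.
- by apply/eqP; rewrite -addr_eq0 mulrCA mulrA -e3.
exact: (five_ratio qb).
Qed.

Lemma no_5A_B : (5 * A * w ^ 2 <> B * z ^ 2 + 4)%N.
Proof.
move=> E3; have [q qb qB] := prime_factor_radicand Bb B1.
have n4 := natr4_neq0 qb; have nn4 : - 4%:R != 0 :> 'F_q by rewrite oppr_eq0.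
have := E2F q; have /(nat_eqF q) := E3.
rewrite !(natrD, natrM, natrX) (natr_eq0 qb qB) !mul0r !add0r => e3 e2.
have [||w0] := @cancel_sq _ A%:R u%:R w%:R 5%:R 4%:R n4; first by [].
- by rewrite mulrCA mulrA.
exact: (five_ratio qb).
Qed.

(** Modulo q dividing A, B w^2 = 4 and B v^2 = -4 make -1 a square, so q is in [ls]; modulo q
    dividing B, A u^2 = 4 and 5 A z^2 = -4 make -5 a square, so q is 3 or 7. Thus B = 21 and 13
    divides A, and 21 v^2 = -4 modulo 13. *)
Lemma no_B_5A : (B * w ^ 2 <> 5 * A * z ^ 2 + 4)%N.
Proof.
move=> E3.
have [||B21 A13] := @split21 A B AB.
- move=> q qb qA; have := E2F q; have /(nat_eqF q) := E3.
  rewrite !(natrD, natrM, natrX) (natr_eq0 qb qA) !(mul0r, mulr0) !add0r => e3 e2.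
  have [||v0] := @cancel_sq _ B%:R w%:R v%:R (-1) 4%:R (natr4_neq0 qb); first by [].
  - by rewrite mulN1r mulrN; apply/eqP; rewrite eq_sym -addr_eq0 addrC -e2.
  by rewrite mulN1r; apply: (minus1_ratio qb).
- move=> q qb qB; have := E2F q; have /(nat_eqF q) := E3.
  rewrite !(natrD, natrM, natrX) (natr_eq0 qb qB) !(mul0r, mulr0) !add0r => e3 e2.
  have [||z0] := @cancel_sq _ A%:R u%:R z%:R (- 5%:R) 4%:R (natr4_neq0 qb); first by [].
  - by rewrite mulNr mulrN mulrCA mulrA; apply/eqP; rewrite eq_sym -addr_eq0 addrC -e3.
  by rewrite mulNr; apply: (minus5_ratio qb).
have [h _] := mod13 v; apply: h; rewrite -B21 -E2.
by apply/eqP; apply: dvdn_mulr.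
Qed.

(** As for [no_B_5A] with A and B exchanged: A = 21, 13 divides B, and 21 u^2 = 4 modulo 13. *)
Lemma no_5B_A : (5 * B * w ^ 2 <> A * z ^ 2 + 4)%N.
Proof.
move=> E3.
have [||A21 B13] := @split21 B A (etrans (mulnC _ _) AB).
- move=> q qb qB; have := E2F q; have /(nat_eqF q) := E3.
  rewrite !(natrD, natrM, natrX) (natr_eq0 qb qB) !(mul0r, mulr0) !add0r => e3 e2.
  have [||z0] := @cancel_sq _ A%:R u%:R z%:R (-1) 4%:R (natr4_neq0 qb); first by [].
  - by rewrite mulN1r mulrN; apply/eqP; rewrite eq_sym -addr_eq0 addrC -e3.
  by rewrite mulN1r; apply: (minus1_ratio qb).
- move=> q qb qA; have := E2F q; have /(nat_eqF q) := E3.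
  rewrite !(natrD, natrM, natrX) (natr_eq0 qb qA) !(mul0r, mulr0) => e3 e2.
  have nn4 : - 4%:R != 0 :> 'F_q by rewrite oppr_eq0 natr4_neq0.
  have [||w0] := @cancel_sq _ B%:R v%:R w%:R (- 5%:R) _ nn4.
  - by apply/eqP; rewrite -addr_eq0 -e2.
  - by rewrite mulNr mulrN mulrCA mulrA e3 add0r.
  by rewrite mulNr; apply: (minus5_ratio qb).
have [_ h] := mod13 u; apply: h; rewrite -A21 E2 -modnDml.
by have /eqP -> : (13 %| B * v ^ 2)%N by apply: dvdn_mulr.
Qed.

End Cases.

Lemma no_negative_pell x y : (b * x ^ 2 <> y ^ 2 + 4)%N.
Proof.
move=> E; have : ((y ^ 2 + 4) %% 3 = 0)%N.
  by rewrite -E; apply/eqP/dvdn_mulr/dvd_radicand/mem_head.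
rewrite -modnDml -modnXm; have := ltn_pmod y (isT : 0 < 3)%N.
by case: (y %% 3)%N => [|[|[|]]].
Qed.

Lemma no_negative_pell5 x y : (5 * b * x ^ 2 <> y ^ 2 + 4)%N.
Proof.
move=> E; have : ((y ^ 2 + 4) %% 3 = 0)%N.
  by rewrite -E -mulnA; apply/eqP/dvdn_mull/dvdn_mulr/dvd_radicand/mem_head.
rewrite -modnDml -modnXm; have := ltn_pmod y (isT : 0 < 3)%N.
by case: (y %% 3)%N => [|[|[|]]].
Qed.

Lemma no_5_b x y : (5 * x ^ 2 <> b * y ^ 2 + 4)%N.
Proof.
move=> E; have : ((5 * x ^ 2) %% 3 = 1)%N.
  rewrite E -modnDml; have /eqP -> // : (3 %| b * y ^ 2)%N.
  exact/dvdn_mulr/dvd_radicand/mem_head.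
rewrite -modnMmr -modnXm; have := ltn_pmod x (isT : 0 < 3)%N.
by case: (x %% 3)%N => [|[|[|]]].
Qed.

(** Modulo 13 this reads 5 y^2 = -4, where 5 is a nonresidue and -1 = 5^2. *)
Lemma no_b_5 x y : (b * x ^ 2 <> 5 * y ^ 2 + 4)%N.
Proof.
move=> E; have : ((5 * y ^ 2 + 4) %% 13 = 0)%N.
  by rewrite -E; apply/eqP/dvdn_mulr/dvd_radicand; rewrite !inE ls13 !orbT.
rewrite -modnDml -modnMmr -modnXm.
have := ltn_pmod y (isT : 0 < 13)%N.
by case: (y %% 13)%N => [|[|[|[|[|[|[|[|[|[|[|[|[|]]]]]]]]]]]]].
Qed.

(* A dependency involving C would force C to be one of 1, 5, b, 5b, A, 5A, B, 5B; each
   value makes C w^2 - D z^2 = 4 contradict A u^2 - B v^2 = 4 modulo a prime factor of b,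
   or contradicts minimality or the absence of units of norm -1. *)
Lemma relations_independent X2 Y2 X3 Y3 A B C D u v w z (i j k l : bool) :
  fundamental b X2 Y2 -> fundamental (5 * b) X3 Y3 ->
  (A * B = b)%N -> (X2 + 2 = A * u ^ 2)%N -> (X2 = B * v ^ 2 + 2)%N ->
  (C * D = 5 * b)%N -> (X3 + 2 = C * w ^ 2)%N -> (X3 = D * z ^ 2 + 2)%N ->
  perfect_square (5 ^ i * b ^ j * A ^ k * C ^ l) -> [&& ~~ i, ~~ j, ~~ k & ~~ l].
Proof.
move=> f2 f3 AB uE vE CD wE zE.
have s5b := radicand5_squarefree; have sb := radicand_squarefree.
have s1 : squarefree 1 by split => // p; rewrite logn1.
have n2 := fundamental_not_square sb radicand_mod4 f2; have n3 := fundamental_not_square s5b radicand5_mod4 f3.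
have A1 : A != 1%N by apply: contra_not_neq n2 => A1; exists u; rewrite uE A1 mul1n.
have C1 : C != 1%N by apply: contra_not_neq n3 => C1; exists w; rewrite wE C1 mul1n.
have E2 : (A * u ^ 2 = B * v ^ 2 + 4)%N by rewrite -uE vE -addnA.
have E3 : (C * w ^ 2 = D * z ^ 2 + 4)%N by rewrite -wE zE -addnA.
have B1 : B != 1%N.
  apply/eqP => B1; apply: (@no_negative_pell u v).
  by rewrite -AB B1 muln1 E2 B1 mul1n.
have D1 : D != 1%N.
  apply/eqP => D1; apply: (@no_negative_pell5 w z).
  by rewrite -CD D1 muln1 E3 D1 mul1n.
have [b0 _] := sb.
have A0 : (0 < A)%N by move: b0; rewrite -AB muln_gt0 => /andP[].
have B0 : (0 < B)%N by move: b0; rewrite -AB muln_gt0 => /andP[].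
have C0 : (0 < C)%N by have [] := s5b; rewrite -CD muln_gt0 => /andP[].
have sC : squarefree C by apply: squarefree_dvd s5b; rewrite -CD dvdn_mulr.
have s5A : squarefree (5 * A) by apply: squarefree_dvd s5b; rewrite -AB mulnA dvdn_mulr.
have s5B : squarefree (5 * B) by apply: squarefree_dvd s5b; rewrite -AB mulnCA dvdn_mull.
have s5i (n : nat) (e : bool) : squarefree (5 * n) -> squarefree (5 ^ e * n).
  by case: e => // h; rewrite mul1n; apply: squarefree_dvd h; rewrite dvdn_mull.
have DE n m : C = n -> (n * m = 5 * b)%N -> D = m.
  by move=> Cn; rewrite -CD -Cn => /eqP; rewrite eqn_pmul2l // => /eqP.
have b1 : b <> 1%N by have := radicand_gt1; case: (b) => [|[]].
case: l => /=; last first.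
  rewrite andbT muln1; case: k => /=; last first.
    rewrite andbT muln1 => sq.
    suff : (5 ^ i * b ^ j = 1)%N.
      by case: (i); case: (j) => //; rewrite ?muln1 ?mul1n // => /eqP; rewrite ?muln_eq1.
    apply: squarefree_mul_square => //; last by rewrite muln1.
    by apply: s5i; case: (j) => //; apply: squarefree_prime.
  case: j => /= sq.
    have : (5 ^ i * B = 1)%N.
      apply: squarefree_mul_square (s5i _ _ s5B) s1 _; rewrite muln1.
      apply: (perfect_square_mull A0); move: sq; rewrite -AB.
      by congr perfect_square; ring.
    by move/eqP; rewrite muln_eq1 (negPf B1) andbF.
  have : (5 ^ i * A = 1)%N.
    apply: squarefree_mul_square (s5i _ _ s5A) s1 _; rewrite muln1.
    by move: sq; rewrite expn0 muln1.
  by move/eqP; rewrite muln_eq1 (negPf A1) andbF.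
rewrite expn1 !andbF => sq; exfalso; move: sq; case: k => /=; rewrite ?expn1 ?expn0.
  case: j; rewrite ?expn1 ?expn0 ?muln1 => sq.
    (* b A = A^2 B: dropping the square A^2 compares C with 5^i B. *)
    have CE : C = (5 ^ i * B)%N.
      apply: squarefree_mul_square sC (s5i _ _ s5B) _.
      apply: (perfect_square_mull A0); move: sq; rewrite -AB.
      by congr perfect_square; ring.
    move: E3; rewrite CE; case: (i) CE => /= CE; rewrite ?expn1 ?expn0 ?mul1n.
      by rewrite (DE _ A CE) ?expn1 -?AB; [apply: no_5B_A E2|ring].
    by rewrite (DE _ (5 * A)%N CE) ?expn0 -?AB; [apply: no_B_5A E2|ring].
  have CE : C = (5 ^ i * A)%N.
    by apply: squarefree_mul_square sC (s5i _ _ s5A) _; move: sq; rewrite mulnC.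
  move: E3; rewrite CE; case: (i) CE => /= CE; rewrite ?expn1 ?expn0 ?mul1n.
    by rewrite (DE _ B CE) ?expn1 -?AB; [apply: no_5A_B E2|ring].
  by rewrite (DE _ (5 * B)%N CE) ?expn0 -?AB; [apply: no_A_5B E2|ring].
(* Here C is 1, 5, b or 5b: minimality excludes 1, the absence of units of norm -1 excludes 5b, and
   congruences modulo 3 and 13 exclude 5 and b. *)
rewrite muln1 => sq.
have CE : C = (5 ^ i * b ^ j)%N.
  apply: squarefree_mul_square sC _ _; last by move: sq; rewrite mulnC.
  by apply: s5i; case: (j) => //; apply: squarefree_prime.
move: E3 C1 D1; rewrite CE; case: (i) CE => /= CE; case: (j) CE => /= CE; rewrite ?expn1 ?expn0 ?mul1n ?muln1 //.
- by rewrite (DE _ 1%N CE) ?expn1 ?muln1.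
- by rewrite (DE _ b CE) ?expn1 ?expn0 ?muln1 // => /no_5_b.
- have -> : D = 5%N by apply: DE CE _; rewrite expn0 expn1 mul1n mulnC.
  by move/no_b_5.
Qed.

End Independence.

Local Open Scope classical_set_scope.

(** * Ideals with a rational square *)

Section NumberField.
Variable K : fieldExtType rat.
Local Notation OK := (@ringOfIntegers K).

Lemma natK_eq0 (n : nat) : (n%:R == 0 :> K) = (n == 0%N).
Proof.
by rewrite -(rmorph_nat (in_alg K)) fmorph_eq0 pnatr_eq0.
Qed.

Lemma alg_ratE (q : rat) : q%:A = (numq q)%:~R / (denq q)%:~R :> K.
Proof.
by rewrite -{1}[q]divq_num_den -[LHS]/(in_alg K _) rmorphM fmorphV !rmorph_int.
Qed.

Lemma natK_neq0 (n : nat) : (0 < n)%N -> n%:R != 0 :> K.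
Proof. by rewrite natK_eq0 lt0n. Qed.

Lemma OK_int (m : int) : OK m%:~R.
Proof. exact: integral_id. Qed.

Lemma OK_nat (n : nat) : OK n%:R.
Proof. exact: integral_nat. Qed.

Lemma OK_opp (x : K) : OK x -> OK (- x).
Proof. exact: integral_opp. Qed.

Lemma OK_sub (x y : K) : OK x -> OK y -> OK (x - y).
Proof. exact: integral_sub. Qed.

Lemma OK_exp (x : K) n : OK x -> OK (x ^+ n).
Proof.
by move=> hx; elim: n => [|n IH]; rewrite ?expr0 ?exprS; [exact: OK_1|exact: OK_mul].
Qed.

(** Most integrality claims below are checked on the square of the element, where they follow from
    explicit formulas. *)
Lemma OK_root (x : K) n : (0 < n)%N -> OK (x ^+ n) -> OK x.
Proof.
move=> n0 hx; apply: (@integral_root_monic _ _ _ _ ('X^n - (x ^+ n)%:P)).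
- exact: monicXnsubC.
- by rewrite /root !hornerE subrr.
- move=> y /(nthP 0)[i _ <-]; rewrite coefB coefXn coefC.
  by case: ifP => _; [apply: integral_sub => //|rewrite subr0]; apply: integral_nat.
Qed.

Lemma OK_sum (I : Type) (r : seq I) (P : pred I) (F : I -> K) :
  (forall i, P i -> OK (F i)) -> OK (\sum_(i <- r | P i) F i).
Proof. by move=> h; apply: (big_ind (fun x => OK x)) => //; [exact: OK_0|exact: OK_add]. Qed.

Lemma OK_rmorph (f : {rmorphism K -> K}) x : OK x -> OK (f x).
Proof.
move=> [p mp rp]; exists p => //.
have -> : map_poly intr p = map_poly f (map_poly intr p) :> {poly K}.
  by rewrite -map_poly_comp; apply: eq_map_poly => m; rewrite /= rmorph_int.
by rewrite fmorph_root.
Qed.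

Lemma OK_rat (q : rat) : OK q%:A -> exists m : int, q = m%:~R.
Proof.
move=> [p mp rp].
have : (ratr q : algC) \in Num.int.
  apply: Cint_rat_Aint; first exact: Crat_rat.
  apply: (@root_monic_Aint (map_poly intr p)).
  - have -> : map_poly intr p = map_poly (ratr : rat -> algC) (map_poly intr p).
      by rewrite -map_poly_comp; apply: eq_map_poly => m; rewrite /= rmorph_int.
    rewrite fmorph_root -(fmorph_root (in_alg K)) /=.
    rewrite -map_poly_comp.
    by have -> : map_poly (in_alg K \o intr) p = map_poly intr p;
       first by apply: eq_map_poly => m; exact: (rmorph_int (in_alg K)).
  - exact: monic_map.
  - by apply/polyOverP => i; rewrite coef_map /= intr_int.
move=> /intrP[m mE]; exists m; apply: (fmorph_inj (ratr : rat -> algC)).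
by apply: (etrans mE); rewrite rmorph_int.
Qed.

Lemma fracIdealD (I : fracIdeal K) x y : ideal_set I x -> ideal_set I y -> ideal_set I (x + y).
Proof. by case: (fracIdealP I) => _ h _ _; apply: h. Qed.

Lemma fracIdealM (I : fracIdeal K) a x : OK a -> ideal_set I x -> ideal_set I (a * x).
Proof. by case: (fracIdealP I) => _ _ h _; apply: h. Qed.

Lemma fracIdealN (I : fracIdeal K) x : ideal_set I x -> ideal_set I (- x).
Proof. by move=> h; rewrite -mulN1r; apply: fracIdealM => //; apply/OK_opp/OK_1. Qed.

Lemma fracIdealB (I : fracIdeal K) x y : ideal_set I x -> ideal_set I y -> ideal_set I (x - y).
Proof. by move=> hx hy; apply: fracIdealD => //; apply: fracIdealN. Qed.

Lemma fracIdeal_sum (I : fracIdeal K) (J : Type) (r : seq J) (P : pred J) (F : J -> K) :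
  (forall i, P i -> ideal_set I (F i)) -> ideal_set I (\sum_(i <- r | P i) F i).
Proof.
by move=> h; apply: (big_ind (fun x => ideal_set I x)) => //; [exact: fracIdeal0|exact: fracIdealD].
Qed.

Lemma fracIdeal_mulP (I J : fracIdeal K) x y : ideal_set I x -> ideal_set J y -> ideal_set (I * J)%g (x * y).
Proof. exact: ideal_prodM. Qed.

Lemma fracIdeal_mul_sub (I J L : fracIdeal K) :
  (forall x y, ideal_set I x -> ideal_set J y -> ideal_set L (x * y)) -> (I * J)%g `<=` L.
Proof.
move=> h; apply: ideal_prod_sub => //; [exact: fracIdeal0|exact: fracIdealD].
Qed.

Section RadicalIdeals.

Fact nat_ideal_subproof (n : nat) : (0 < n)%N ->
  `[< is_fracIdeal [set x : K | OK (x / n%:R)] >].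
Proof.
move=> n0; apply/asboolP; split.
- by exists n%:R; [rewrite /= divff ?natK_neq0 //; apply: OK_1|exact: natK_neq0].
- by move=> x y /= hx hy; rewrite mulrDl; apply: OK_add.
- by move=> u x hu /= hx; rewrite -mulrA; apply: OK_mul.
- exists 1; first by split; [exact: OK_1|exact: oner_neq0].
  move=> x /= hx; rewrite mul1r -[x](mulfVK (natK_neq0 n0)).
  by apply: OK_mul => //; apply: OK_nat.
Qed.
Definition nat_ideal n (n0 : (0 < n)%N) := FracIdeal (nat_ideal_subproof n0).

Lemma radical_OK (d : nat) (x : K) : (0 < d)%N -> OK (x ^+ 2 / d%:R) -> OK x.
Proof.
move=> d0 hx; apply: (@OK_root _ 2) => //.
by rewrite -[x ^+ 2](mulfVK (natK_neq0 d0)); apply: OK_mul => //; apply: OK_nat.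
Qed.

(** One computation for three uses: the cross term when R_d is shown closed under addition, the
    inclusion of R_d^2 in dO, and that of R_d R_e in c R_h when d e = h c^2. *)
Lemma radical_cross (d e h : nat) (x y c : K) : (0 < h)%N ->
  OK (x ^+ 2 / d%:R) -> OK (y ^+ 2 / e%:R) ->
  (d%:R * e%:R = h%:R * c ^+ 2) -> c != 0 -> OK ((x * y / c) ^+ 2 / h%:R).
Proof.
move=> h0 hx hy E c0.
have -> : (x * y / c) ^+ 2 / h%:R = (x ^+ 2 / d%:R) * (y ^+ 2 / e%:R).
  by rewrite mulf_div E; field; rewrite c0 natK_neq0.
exact: OK_mul.
Qed.

(* The largest ideal with square inside dO. For d a product of ramified primes it is
   the product of the ideals over them, and its square is dO. *)
Fact radical_subproof (d : nat) : (0 < d)%N ->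
  `[< is_fracIdeal [set x : K | OK (x ^+ 2 / d%:R)] >].
Proof.
move=> d0; have d0K := natK_neq0 d0; apply/asboolP; split.
- by exists d%:R; rewrite /= ?expr2 ?mulfK //; apply: OK_nat.
- move=> x y /= hx hy; rewrite sqrrD mulrDl mulrDl; apply: OK_add => //; apply: OK_add => //.
  rewrite -mulr_natl -mulrA.
  apply: OK_mul; first exact: OK_nat.
  apply: (@OK_root _ 2) => //.
  rewrite -[X in OK X]divr1; apply: (@radical_cross d d 1 x y d%:R) => //.
  by rewrite mul1r expr2.
- by move=> u x hu /= hx; rewrite exprMn -mulrA; apply: OK_mul => //; apply: OK_exp.
- exists 1; first by split; [exact: OK_1|exact: oner_neq0].
  by move=> x /= hx; rewrite mul1r; apply: radical_OK hx.
Qed.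
Definition radical d (d0 : (0 < d)%N) := FracIdeal (radical_subproof d0).

Lemma fracIdeal_natcomb (I : fracIdeal K) (m n g : nat) :
  (0 < m)%N -> gcdn m n = g -> ideal_set I m%:R -> ideal_set I n%:R -> ideal_set I g%:R.
Proof.
move=> m0 gE Im In; have [u v uvE _] := egcdnP n m0.
have -> : g%:R = u%:R * m%:R - v%:R * n%:R :> K.
  by rewrite -!natrM uvE natrD addrAC subrr add0r gE.
by apply: fracIdealB; apply: fracIdealM => //; apply: OK_nat.
Qed.

(** The point is that d lies in R_d^2: this ideal contains d^2 and w^2 = N, and gcd(d^2, N) = d
    because N is squarefree. *)
Lemma radical_sqr (d N : nat) (w : K) (d0 : (0 < d)%N) :
  w ^+ 2 = N%:R -> squarefree N -> (d %| N)%N ->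
  (radical d0 * radical d0)%g = nat_ideal d0.
Proof.
move=> w2 sN dN; have d0K := natK_neq0 d0; apply: fracIdeal_eq.
  apply: fracIdeal_mul_sub => x y /= hx hy; apply: (@OK_root _ 2) => //.
  by rewrite -[X in OK X]divr1; apply: (@radical_cross d d 1 x y d%:R) => //; rewrite mul1r expr2.
have dR : ideal_set (radical d0) d%:R by rewrite /= expr2 mulfK //; apply: OK_nat.
have wR : ideal_set (radical d0) w.
  by rewrite /= w2; case/dvdnP: dN => k ->; rewrite natrM mulfK //; apply: OK_nat.
have : ideal_set (radical d0 * radical d0)%g d%:R.
  apply: (@fracIdeal_natcomb _ (d * d) N); first by rewrite muln_gt0 d0.
  - case/dvdnP: dN sN => k -> sN; rewrite -muln_gcdl.
    rewrite gcdnC; have := squarefree_coprimeM sN; rewrite /coprime => /eqP ->.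
    by rewrite mul1n.
  - by rewrite natrM; apply: fracIdeal_mulP.
  - by rewrite -w2 expr2; apply: fracIdeal_mulP.
move=> dRR x hx; rewrite -[x](mulfVK d0K); exact: fracIdealM.
Qed.

(** Cancellation without inverses: for y in J, the element c y lies in y I I, and y I is contained
    in J J = cO. *)
Lemma fracIdeal_sqr_inj (I J : fracIdeal K) c (c0 : (0 < c)%N) :
  I `<=` J -> (I * I)%g = nat_ideal c0 -> (J * J)%g = nat_ideal c0 -> I = J.
Proof.
move=> IJ II JJ; apply: fracIdeal_eq => // y Jy.
have c0K := natK_neq0 c0.
have : ideal_set (I * I)%g c%:R by rewrite II /= divff //; apply: OK_1.
pose L := [set z : K | ideal_set I (y * z / c%:R)].
suff sub : (I * I)%g `<=` L by move/sub; rewrite /L /= mulfK.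
apply: ideal_prod_sub; rewrite /L /=.
- by rewrite mulr0 mul0r; apply: fracIdeal0.
- by move=> u v hu hv; rewrite mulrDr mulrDl; apply: fracIdealD.
- move=> u v Iu Iv; have -> : y * (u * v) / c%:R = (y * u / c%:R) * v by ring.
  apply: fracIdealM => //.
  have : ideal_set (J * J)%g (y * u) by apply: fracIdeal_mulP => //; apply: IJ.
  by rewrite JJ.
Qed.

Lemma same_class_nat_ideal (I : fracIdeal K) n (n0 : (0 < n)%N) :
  ideal_class (nat_ideal n0 * I)%g = ideal_class I.
Proof.
symmetry; apply/ideal_class_eq/asboolP; exists n%:R; first exact: natK_neq0.
have n0K := natK_neq0 n0; apply/seteqP; split.
  apply: ideal_prod_sub.
  - by exists 0; rewrite ?mulr0 //; apply: fracIdeal0.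
  - by move=> _ _ [x Ix <-] [y Iy <-]; exists (x + y); rewrite ?mulrDr //; apply: fracIdealD.
  - move=> x y /= hx Iy; exists (x / n%:R * y); first exact: fracIdealM.
    by rewrite mulrA [n%:R * _]mulrC mulfVK.
move=> _ [x Ix <-]; apply: fracIdeal_mulP => //=.
by rewrite divff //; apply: OK_1.
Qed.

Lemma ideal_class_nat_ideal n (n0 : (0 < n)%N) :
  ideal_class (nat_ideal n0) = 1%g :> classGroup K.
Proof. by rewrite -[nat_ideal n0]mulg1 same_class_nat_ideal. Qed.

(** R_d R_e is contained in g R_h, and both have square deO, so they coincide. *)
Lemma ideal_class_radicalM (d e h g N : nat) (w : K)
    (d0 : (0 < d)%N) (e0 : (0 < e)%N) (h0 : (0 < h)%N) :
  w ^+ 2 = N%:R -> squarefree N -> (d %| N)%N -> (e %| N)%N -> (h %| N)%N ->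
  (d * e = h * g ^ 2)%N ->
  (ideal_class (radical d0) * ideal_class (radical e0))%g = ideal_class (radical h0).
Proof.
move=> w2 sN dN eN hN E.
have de0 : (0 < d * e)%N by rewrite muln_gt0 d0.
have g0 : (0 < g)%N by move: de0; rewrite E muln_gt0 expn_gt0 /= => /andP[_]; rewrite orbF.
have g0K := natK_neq0 g0.
rewrite -[LHS](ideal_classM (radical d0) (radical e0)) -(same_class_nat_ideal (radical h0) g0).
have nat_idealM m n (m0 : (0 < m)%N) (n0 : (0 < n)%N) (mn0 : (0 < m * n)%N) :
    (nat_ideal m0 * nat_ideal n0)%g = nat_ideal mn0.
  have m0K := natK_neq0 m0; have n0K := natK_neq0 n0.
  apply: fracIdeal_eq.
    apply: fracIdeal_mul_sub => x y /= hx hy; rewrite natrM -mulf_div.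
    exact: OK_mul.
  move=> x hx; have -> : x = (x / (m * n)%:R) * (m%:R * n%:R).
    by rewrite natrM mulfVK // mulf_neq0.
  apply: fracIdealM => //; apply: fracIdeal_mulP => /=; rewrite divff //; exact: OK_1.
congr (ideal_class _); apply: (@fracIdeal_sqr_inj _ _ _ de0).
- apply: fracIdeal_mul_sub => x y hx hy.
  have -> : x * y = g%:R * (x * y / g%:R) by rewrite [g%:R * _]mulrC mulfVK.
  apply: fracIdeal_mulP => /=; first by rewrite divff //; apply: OK_1.
  by apply: (@radical_cross d e h x y g%:R) => //; rewrite -natrX -!natrM E.
- have -> : (radical d0 * radical e0 * (radical d0 * radical e0))%g =
            ((radical d0 * radical d0) * (radical e0 * radical e0))%g.
    rewrite !mulgA; congr (_ * _)%g; rewrite -!mulgA; congr (_ * _)%g.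
    exact: fracIdeal_mulC.
  by rewrite (radical_sqr _ w2) // (radical_sqr _ w2).
- have -> : (nat_ideal g0 * radical h0 * (nat_ideal g0 * radical h0))%g =
            ((nat_ideal g0 * nat_ideal g0) * (radical h0 * radical h0))%g.
    rewrite !mulgA; congr (_ * _)%g; rewrite -!mulgA; congr (_ * _)%g.
    exact: fracIdeal_mulC.
  have gg0 : (0 < g * g)%N by rewrite muln_gt0 g0.
  rewrite (radical_sqr _ w2) // (nat_idealM _ _ _ _ gg0).
  have ggh0 : (0 < g * g * h)%N by rewrite muln_gt0 gg0.
  rewrite (nat_idealM _ _ _ _ ggh0); apply: val_inj => /=.
  by rewrite E mulnC mulnn.
Qed.

(** If R_d = xO, then R_d^2 = dO makes x^2/d a unit. Conversely (y/x)^2 = (y^2/d) u^-1 shows that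
    R_d is exactly xO. *)
Lemma ideal_class_radical_eq1 (d : nat) (d0 : (0 < d)%N) :
  (radical d0 * radical d0)%g = nat_ideal d0 ->
  (ideal_class (radical d0) = 1%g <->
   exists x u : K, [/\ x != 0, OK u, OK u^-1 & x ^+ 2 = d%:R * u]).
Proof.
move=> RR; have d0K := natK_neq0 d0; split.
  move=> /esym/ideal_class_eq/asboolP[x x0 RE].
  have Rx : ideal_set (radical d0) x by rewrite RE; exists 1; rewrite ?mulr1 //; apply: OK_1.
  exists x, (x ^+ 2 / d%:R); split => //; last by rewrite mulrCA divff // mulr1.
  have : ideal_set (radical d0 * radical d0)%g d%:R by rewrite RR /= divff //; apply: OK_1.
  have x20 : x ^+ 2 != 0 by rewrite expf_neq0.
  pose L := [set z : K | OK (z / x ^+ 2)].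
  suff sub : (radical d0 * radical d0)%g `<=` L by move/sub; rewrite /L /= invf_div.
  apply: ideal_prod_sub; rewrite /L /=.
  - by rewrite mul0r; apply: OK_0.
  - by move=> u v hu hv; rewrite mulrDl; apply: OK_add.
  - move=> u v; rewrite -[OK (u ^+ 2 / _)]/(ideal_set (radical d0) u) -[OK (v ^+ 2 / _)]/(ideal_set (radical d0) v).
    rewrite RE => -[u' hu' <-] [v' hv' <-].
    have -> : x * u' * (x * v') / x ^+ 2 = u' * v' by field.
    exact: OK_mul.
move=> [x [u [x0 hu hu' E]]]; symmetry; apply/ideal_class_eq/asboolP; exists x => //.
apply/seteqP; split => [y /= hy|_ [y hy <-] /=].
  exists (y / x); last by rewrite mulrC mulfVK.
  apply: (@OK_root _ 2) => //; rewrite expr_div_n E invfM mulrA.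
  exact: OK_mul.
rewrite exprMn E; have -> : d%:R * u * y ^+ 2 / d%:R = u * y ^+ 2 by field.
by apply: OK_mul => //; apply: OK_exp.
Qed.

End RadicalIdeals.

End NumberField.

(** * Prime ideals over a rational prime *)

Section PrimesOver.
Variable K : fieldExtType rat.
Local Notation OK := (@ringOfIntegers K).
Implicit Types P Q I J : fracIdeal K.

Definition residue_system P (T : finType) (g : T -> K) : Prop :=
  [/\ forall t, OK (g t),
      forall x, OK x -> exists t, ideal_set P (x - g t) &
      forall t t', ideal_set P (g t - g t') -> t = t'].

Lemma absNorm_residue_system P (T : finType) (g : T -> K) :
  residue_system P g -> absNorm P = #|T|.
Proof.
move=> [gO gS gI].
pose co x : set K := [set x + y | y in ideal_set P].
have coE x x' : ideal_set P (x - x') -> co x = co x'.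
  move=> h; apply/seteqP; split => _ [y Py <-].
    exists (x - x' + y); first exact: fracIdealD.
    by rewrite addrA [x' + _]addrC subrK.
  exists (y - (x - x')); first exact: fracIdealB.
  by rewrite opprB addrC -addrA subrK addrC.
have coI t t' : co (g t) = co (g t') -> t = t'.
  move=> E; apply: gI; have : co (g t) (g t) by exists 0; rewrite ?addr0 //; apply: fracIdeal0.
  by rewrite E => -[y Py <-]; rewrite addrC addKr.
have -> : absNorm P = #|` [fset co (g t) | t in T]|%fset.
  rewrite /absNorm; congr (#|` _|)%fset.
  rewrite -[RHS]set_fsetK; congr fset_set; apply/seteqP; split => /= C.
    move=> [x Ox <-]; have [t Pt] := gS x Ox.
    by apply/imfsetP; exists t => //=; exact: coE.
  by move=> /imfsetP[t _ ->]; exists (g t).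
by rewrite card_imfset //= cardE.
Qed.

Variables (p : nat) (T : finType) (c : K -> T).
Hypothesis p_pr : prime p.
Hypothesis c_mod : forall x y, OK x -> OK y -> c x = c y -> OK ((x - y) / p%:R).
Let p0K : p%:R != 0 :> K. Proof. exact/natK_neq0/prime_gt0. Qed.

(** The colouring [c] stands for the finiteness of O/pO: equal colours imply congruence modulo p,
    which is all that pigeonhole arguments require. *)
Lemma same_colour_sub P x y : ideal_set P p%:R -> OK x -> OK y -> c x = c y ->
  ideal_set P (x - y).
Proof.
move=> Pp Ox Oy cxy; rewrite -[x - y](mulfVK p0K); apply: fracIdealM => //.
exact: c_mod.
Qed.

Lemma prime_ideal1 P : prime_ideal P -> ~ ideal_set P 1.
Proof.
move=> [[_ nP] _] P1; apply: nP => x Ox; rewrite -[x]mulr1; exact: fracIdealM.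
Qed.

Lemma prime_ideal_sub P x : prime_ideal P -> ideal_set P x -> OK x.
Proof. by move=> [[h _] _]; apply: h. Qed.

Lemma prime_idealX P x n : prime_ideal P -> OK x -> ideal_set P (x ^+ n) -> ideal_set P x.
Proof.
move=> hP Ox; elim: n => [|n IH]; first by rewrite expr0 => /(prime_ideal1 hP).
rewrite exprS; case: hP => _ h /h; case => //; exact: OK_exp.
Qed.

(** O/P is a finite domain, hence a field: two powers of y have the same colour, so P contains y^i
    (1 - y^(j - i)) with i < j, and not y^i. *)
Lemma prime_ideal_maximal P y : prime_ideal P -> ideal_set P p%:R ->
  OK y -> ~ ideal_set P y -> exists2 a, OK a & ideal_set P (1 - a * y).
Proof.
move=> hP Pp Oy nPy.
have : ~~ injectiveb (fun i : 'I_#|T|.+1 => c (y ^+ i)).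
  by apply/negP=> /injectiveP /leq_card; rewrite card_ord ltnn.
move=> /injectivePn[i [j ij cij]].
wlog lt_ij : i j ij cij / (i < j)%N.
  move=> W; case: (ltngtP i j) => [lt|lt|/val_inj E].
  - exact: (W i j).
  - by apply: (W j i) => //; rewrite eq_sym.
  - by rewrite E eqxx in ij.
have := same_colour_sub Pp (OK_exp i Oy) (OK_exp j Oy) cij.
have -> : y ^+ i - y ^+ j = y ^+ i * (1 - y ^+ (j - i).-1 * y).
  by rewrite mulrBr mulr1 -exprSr prednK ?subn_gt0 // -exprD subnKC // ltnW.
have Oa := OK_exp (j - i).-1 Oy.
case: (hP) => _ h /h[]; [exact: OK_exp|apply: OK_sub; [exact: OK_1|exact: OK_mul]| |].
  by move/(prime_idealX hP Oy).
by exists (y ^+ (j - i).-1).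
Qed.

Lemma prime_ideal_sub_eq P Q : prime_ideal P -> prime_ideal Q -> ideal_set P p%:R ->
  P `<=` Q -> P = Q.
Proof.
move=> hP hQ Pp PQ; apply: fracIdeal_eq => // y Qy; apply: contrapT => nPy.
have Oy := prime_ideal_sub hQ Qy.
have [a Oa Pa] := prime_ideal_maximal hP Pp Oy nPy.
apply: (prime_ideal1 hQ); rewrite -[1](subrK (a * y)); apply: fracIdealD; first exact: PQ.
exact: fracIdealM.
Qed.

Lemma prime_product_not_sub (s : seq (fracIdeal K)) Q :
  prime_ideal Q -> (forall P, P \in s -> exists2 y, ideal_set P y & OK y /\ ~ ideal_set Q y) ->
  exists2 y, ideal_set (\big[(fun I J => (I * J)%g)/1%g]_(P <- s) P) y &
    OK y /\ ~ ideal_set Q y.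
Proof.
move=> hQ; elim: s => [|P s IH] h.
  by rewrite big_nil; exists 1; [exact: OK_1|split; [exact: OK_1|exact: prime_ideal1]].
have [|y hy [Oy nQy]] := IH; first by move=> P' P's; apply: h; rewrite inE P's orbT.
have [z Pz [Oz nQz]] := h P (mem_head _ _).
exists (z * y); first by rewrite big_cons; apply: fracIdeal_mulP.
by split; [exact: OK_mul|case: hQ => _ hQ /hQ[]].
Qed.

(** Chinese remaindering: the product M of the other primes contains some y outside Q, invertible
    modulo Q with inverse a, and x = a (x y) + (1 - a y) x puts a common element x into Q M. *)
Lemma prime_product_cap (s : seq (fracIdeal K)) : uniq s ->
  (forall P, P \in s -> prime_ideal P /\ ideal_set P p%:R) ->
  forall x, ideal_set (\big[(fun I J => (I * J)%g)/1%g]_(P <- s) P) x <->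
    OK x /\ forall P, P \in s -> ideal_set P x.
Proof.
elim: s => [_ _ x|Q s IH /= /andP[nQs us] h x]; first by rewrite big_nil; split => [?|[]].
have hs P : P \in s -> prime_ideal P /\ ideal_set P p%:R.
  by move=> Ps; apply: h; rewrite inE Ps orbT.
have [hQ Qp] := h Q (mem_head _ _).
rewrite big_cons; set M := \big[_/_]_(_ <- _) _ in IH *; split.
  have sub : (Q * M)%g `<=` [set x | OK x /\ forall P, P \in Q :: s -> ideal_set P x].
    apply: ideal_prod_sub => /=.
    - by split=> [|P _]; [exact: OK_0|exact: fracIdeal0].
    - move=> u v [Ou hu] [Ov hv]; split=> [|P Ps]; first exact: OK_add.
      by apply: fracIdealD; [exact: hu|exact: hv].
    - move=> u v Qu Mv; have [Ov hv] := (IH us hs v).1 Mv.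
      have Ou := prime_ideal_sub hQ Qu.
      split=> [|P]; first exact: OK_mul.
      rewrite inE => /orP[/eqP->|Ps]; first by rewrite mulrC; apply: fracIdealM.
      by apply: fracIdealM => //; apply: hv.
  exact: sub.
move=> [Ox hx].
have [|y My [Oy nQy]] := @prime_product_not_sub s Q hQ.
  move=> P Ps; have [hP Pp] := hs P Ps; apply: contrapT => no.
  have PQ : P `<=` Q.
    move=> y Py; apply: contrapT => nQy; apply: no; exists y => //; split => //.
    exact: prime_ideal_sub hP Py.
  by move: nQs; rewrite -(prime_ideal_sub_eq hP hQ Pp PQ) Ps.
have [a Oa Qa] := prime_ideal_maximal hQ Qp Oy nQy.
have Qx : ideal_set Q x by apply: hx; rewrite mem_head.
have Mx : ideal_set M x by apply/(IH us hs); split => // P Ps; apply: hx; rewrite inE Ps orbT.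
have -> : x = a * (x * y) + (1 - a * y) * x by ring.
by apply: fracIdealD; [apply: fracIdealM => //|]; apply: fracIdeal_mulP.
Qed.

(* A generating family of O/P over Z of minimal size is a basis over F_p. *)
Lemma residue_system_exists P : ideal_set P p%:R -> ~ ideal_set P 1 ->
  exists2 k : nat, (0 < k)%N &
    exists g : {ffun 'I_k -> 'I_p} -> K, residue_system P g.
Proof.
move=> Pp nP1.
pose spans k (y : 'I_k -> K) := (forall i, OK (y i)) /\
  forall x, OK x -> exists m : 'I_k -> int, ideal_set P (x - \sum_i (m i)%:~R * y i).
have ex : exists k, `[< exists y : 'I_k -> K, spans k y >].
  (* One representative per colour is a generating family, with a single coefficient 1 and the
     others 0. *)
  exists #|T|; apply/asboolP.
  pose rep t := xget 0 [set x | OK x /\ c x = t].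
  exists (fun i => rep (enum_val i)); split.
    move=> i; rewrite /rep; case: xgetP => [_ -> []//|_]; exact: OK_0.
  move=> x Ox; exists (fun i => (i == enum_rank (c x))%:Z).
  rewrite (bigD1 (enum_rank (c x))) //= eqxx mul1r big1 ?addr0; last first.
    by move=> i /negPf ->; rewrite mul0r.
  rewrite enum_rankK /rep; case: xgetP => [_ -> [Oy cy]|/(_ x)[]//].
  exact: same_colour_sub.
case: (ex_minnP ex) => k /asboolP[y [yO yS]] kmin.
have k0 : (0 < k)%N.
  rewrite lt0n; apply/eqP => k0; apply: nP1.
  have [m] := yS 1 (@OK_1 K); rewrite big1 ?subr0 // => i.
  by have := ltn_ord i; rewrite {2}k0.
exists k => //; exists (fun f : {ffun 'I_k -> 'I_p} => \sum_i (f i : nat)%:R * y i); split.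
- by move=> f; apply: OK_sum => i _; apply: OK_mul => //; apply: OK_nat.
- move=> x Ox; have [m hm] := yS x Ox.
  have mp i : (absz (modz (m i) p) < p)%N.
    have p0 : p%:Z != 0 by rewrite eqz_nat -lt0n prime_gt0.
    have := modz_ge0 (m i) p0; have := ltz_mod (m i) p0.
    by move: (modz _ _) => z; clear; lia.
  exists [ffun i => Ordinal (mp i)].
  have -> : x - \sum_i ([ffun i => Ordinal (mp i)] i : nat)%:R * y i =
    x - \sum_i (m i)%:~R * y i + (\sum_i (divz (m i) p)%:~R * y i) * p%:R.
    rewrite -addrA; congr (x + _); rewrite addrC; apply/eqP.
    rewrite -opprB eqr_opp eq_sym subr_eq eq_sym; apply/eqP.
    rewrite big_distrl /= -big_split /=; apply: eq_bigr => i _; rewrite ffunE /=.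
    have p0 : p%:Z != 0 by rewrite eqz_nat -lt0n prime_gt0.
    rewrite [in RHS](divz_eq (m i) p) intrD intrM mulrDl mulrAC.
    rewrite addrC; congr (_ + _); rewrite -[X in X%:R]/(absz _) pmulrn gez0_abs //.
    exact: modz_ge0.
  apply: fracIdealD => //; rewrite mulrC; rewrite mulrC; apply: fracIdealM => //.
  by apply: OK_sum => i _; apply: OK_mul => //; apply: OK_int.
(* Two distinct vectors of digits with equal sums give a relation whose coefficient at some [i0] is
   invertible modulo p. It expresses [y i0] by the other generators, against minimality. *)
- move=> f f' hff; apply/ffunP => i0; apply/eqP/negPn/negP => ne.
  pose dl i : int := (f i)%:Z - (f' i)%:Z.
  have hd : ideal_set P (\sum_i (dl i)%:~R * y i).
    move: hff; rewrite -sumrB; congr (ideal_set P _); apply: eq_bigr => i _.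
    by rewrite -mulrBl /dl intrB.
  have [u [v uv]] : exists u v : int, u * dl i0 + v * p%:Z = 1.
    have : coprimez (dl i0) p.
      rewrite coprimezE /= coprime_sym prime_coprime //; apply/negP => dv.
      have f1 := ltn_ord (f i0); have f2 := ltn_ord (f' i0).
      have : (0 < absz (dl i0))%N.
        by rewrite absz_gt0 subr_eq0 eqz_nat.
      move=> /dvdn_leq /(_ dv); rewrite /dl; move: f1 f2; clear; lia.
    by move=> /coprimezP[[u v] uv]; exists u, v.
  have hy : ideal_set P (y i0 + u%:~R * \sum_(i | i != i0) (dl i)%:~R * y i).
    have -> : y i0 + u%:~R * \sum_(i | i != i0) (dl i)%:~R * y i =
       (v%:~R * y i0) * p%:R + u%:~R * \sum_i (dl i)%:~R * y i.
      rewrite [in RHS](bigD1 i0) //= mulrDr addrA; congr (_ + _).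
      have : (u%:~R * (dl i0)%:~R + v%:~R * p%:R : K) = 1.
        by rewrite -[p%:R]/(p%:Z%:~R) -!intrM -intrD uv.
      move: (u%:~R : K) ((dl i0)%:~R : K) (v%:~R : K) (p%:R : K) (y i0) => U D V Q Y e.
      by rewrite -[LHS]mul1r -e; ring.
    apply: fracIdealD; apply: fracIdealM => //; last exact: OK_int.
    by apply: OK_mul => //; apply: OK_int.
  case: k k0 y yO yS kmin f f' i0 {hff} ne dl hd uv hy => // k _ y yO yS kmin f f' i0 ne dl hd uv hy.
  suff : (k < k)%N by rewrite ltnn.
  apply: kmin; apply/asboolP; exists (fun j => y (lift i0 j)); split => // x Ox.
  have [m hm] := yS x Ox.
  exists (fun j => m (lift i0 j) - m i0 * u * dl (lift i0 j)).
  have := fracIdealD hm (fracIdealM (OK_int K (m i0)) hy).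
  congr (ideal_set P _).
  rewrite (bigD1_ord i0) //=.
  have -> : \sum_(i | i != i0) (dl i)%:~R * y i = \sum_j (dl (lift i0 j))%:~R * y (lift i0 j).
    have L : \sum_i (dl i)%:~R * y i = (dl i0)%:~R * y i0 +
        \sum_j (dl (lift i0 j))%:~R * y (lift i0 j) by rewrite (bigD1_ord i0).
    by rewrite (bigD1 i0) //= in L; apply: (addrI _ L).
  have -> : \sum_j (m (lift i0 j) - m i0 * u * dl (lift i0 j))%:~R * y (lift i0 j) =
      \sum_j (m (lift i0 j))%:~R * y (lift i0 j) -
      (m i0)%:~R * u%:~R * \sum_j (dl (lift i0 j))%:~R * y (lift i0 j).
    rewrite big_distrr /= -sumrB; apply: eq_bigr => j _.
    by rewrite intrB !intrM mulrBl mulrA.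
  move: (\sum_j _) (\sum_j _) ((m i0)%:~R : K) (u%:~R : K) (y i0) => s1 s2 M U Y.
  ring.
Qed.

Lemma absNorm_conj P Q k (g : {ffun 'I_k -> 'I_p} -> K) (f : {rmorphism K -> K}) :
  involutive f -> (forall x, ideal_set Q x <-> ideal_set P (f x)) ->
  residue_system P g -> residue_system Q (f \o g).
Proof.
move=> fK QP [gO gS gI]; split => [t|x Ox|t t'] /=.
- exact: OK_rmorph.
- have [t ht] := gS _ (OK_rmorph f Ox); exists t; apply/QP.
  by rewrite rmorphB fK.
- by rewrite -rmorphB => /QP; rewrite fK; apply: gI.
Qed.

(** A maximal ideal without Zorn: among proper ideals containing p, take one meeting the most
    colours. If x is outside I, then I meets no element of the colour of x, so I + xO meets strictly
    more colours and must contain 1. *)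
Lemma prime_ideal_exists : exists2 P : fracIdeal K, prime_ideal P & ideal_set P p%:R.
Proof.
pose good (I : fracIdeal K) := [/\ ideal_set I p%:R, I `<=` OK & ~ ideal_set I 1].
pose cnt (I : fracIdeal K) := #|[set t | `[< exists2 x, ideal_set I x & c x = t >]]%SET|.
have ex : exists n, `[< exists2 I, good I & cnt I = n >].
  exists (cnt (nat_ideal K (prime_gt0 p_pr))); apply/asboolP.
  exists (nat_ideal K (prime_gt0 p_pr)) => //; split => /=.
  - by rewrite divff //; apply: OK_1.
  - by move=> x /= h; rewrite -[x](mulfVK p0K); apply: OK_mul => //; apply: OK_nat.
  - have -> : 1 / p%:R = (p%:R^-1 : rat)%:A :> K.
      by rewrite div1r -[RHS]/(in_alg K _) fmorphV rmorph_nat.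
    move=> /OK_rat[m mE].
    have : (1 : rat) = (m * p%:Z)%:~R.
      by rewrite intrM -mE mulVf // pnatr_eq0 -lt0n prime_gt0.
    move=> /eqP; rewrite -[1 : rat]/(1%:~R) eqr_int => /eqP mp.
    have := congr1 absz mp; rewrite abszM => /esym/eqP.
    by rewrite muln_eq1 andbC => /andP[/eqP p1]; move: p_pr; rewrite -[p]/(absz p) p1.
have bnd n : `[< exists2 I, good I & cnt I = n >] -> (n <= #|T|)%N.
  by move=> /asboolP[I _ <-]; apply: max_card.
case: (ex_maxnP ex bnd) => n /asboolP[I [Ip IO nI1] In] nmax; exists I => //; split.
  by split => // h; apply: nI1; apply: h; apply: OK_1.
move=> x y Ox Oy Ixy; case: (pselect (ideal_set I x)) => [|nIx]; [by left|right].
pose J : set K := [set z | exists i a, [/\ ideal_set I i, OK a & z = i + a * x]].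
have Jf : `[< is_fracIdeal J >].
  apply/asboolP; split.
  - by exists p%:R => //; exists p%:R, 0; split; rewrite ?mul0r ?addr0 //; apply: OK_0.
  - move=> _ _ [i [a [Ii Oa ->]]] [i' [a' [Ii' Oa' ->]]].
    exists (i + i'), (a + a'); split; [exact: fracIdealD|exact: OK_add|].
    by rewrite mulrDl addrACA.
  - move=> a _ Oa [i [a' [Ii Oa' ->]]]; exists (a * i), (a * a').
    by split; [exact: fracIdealM|exact: OK_mul|rewrite mulrDr mulrA].
  - exists 1; first by split; [exact: OK_1|exact: oner_neq0].
    move=> _ [i [a [Ii Oa ->]]]; rewrite mul1r; apply: OK_add; first exact: IO.
    exact: OK_mul.
case: (pselect (J 1)) => [[i [a [Ii Oa E]]]|nJ1].
  have -> : y = y * i + a * (x * y) by rewrite [a * _]mulrA [_ * y]mulrC -mulrDr -E mulr1.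
  by apply: fracIdealD; exact: fracIdealM.
have IJ : I `<=` J.
  by move=> z Iz; exists z, 0; split; rewrite ?mul0r ?addr0 //; apply: OK_0.
have Jx : J x by exists 0, 1; split; rewrite ?mul1r ?add0r //; [exact: fracIdeal0|exact: OK_1].
have JO : J `<=` OK.
  by move=> _ [i [a [Ii Oa ->]]]; apply: OK_add; [exact: IO|exact: OK_mul].
have : (cnt (FracIdeal Jf) <= n)%N.
  apply: nmax; apply/asboolP; exists (FracIdeal Jf) => //; split => //=; exact: IJ.
rewrite -In leqNgt => /negP[]; apply: proper_card; apply/properP; split.
  by apply/fintype.subsetP => t; rewrite !finset.in_set => /asboolP[z /IJ Jz cz]; apply/asboolP; exact: (ex_intro2 _ _ z Jz cz).
exists (c x); rewrite finset.in_set; first by apply/asboolP; exact: (ex_intro2 _ _ x Jx erefl).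
apply/negP => /asboolP[z Iz cz]; apply: nIx.
rewrite -[x](subrK z); apply: fracIdealD => //.
by apply: same_colour_sub => //; exact: IO.
Qed.

End PrimesOver.

(** * Biquadratic fields *)

Lemma absz_modz_lt (z : int) (n : nat) : (0 < n)%N -> (absz (modz z n) < n.+1)%N.
Proof.
move=> n0; have n0' : n%:Z != 0 by rewrite eqz_nat -lt0n.
have := modz_ge0 z n0'; have := ltz_mod z n0'.
by move: (modz z n) => r; clear; lia.
Qed.

Lemma absz_modz_dvd (z w : int) (n : nat) : (0 < n)%N ->
  absz (modz z n) = absz (modz w n) -> (n %| z - w)%Z.
Proof.
move=> n0 e; have n0' : n%:Z != 0 by rewrite eqz_nat -lt0n.
rewrite -eqz_mod_dvd -(gez0_abs (modz_ge0 z n0')) -(gez0_abs (modz_ge0 w n0')).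
by rewrite e.
Qed.

Section Biquadratic.
Variables (K : fieldExtType rat) (a b : nat) (ra rb : K) (s t : {rmorphism K -> K}).
Local Notation OK := (@ringOfIntegers K).
Hypotheses (ra2 : ra ^+ 2 = a%:R) (rb2 : rb ^+ 2 = b%:R)
  (s_ra : s ra = - ra) (s_rb : s rb = rb) (t_ra : t ra = ra) (t_rb : t rb = - rb)
  (dec : forall x : K, exists x0 x1 x2 x3 : rat,
     x = x0%:A + x1%:A * ra + x2%:A * rb + x3%:A * (ra * rb))
  (ab_sqf : squarefree (a * b)) (a_mod4 : (a %% 4 = 1)%N) (b_mod4 : (b %% 4 = 1)%N).

Lemma rmorph_ratK (f : {rmorphism K -> K}) (q : rat) : f q%:A = q%:A.
Proof. by rewrite alg_ratE rmorphM fmorphV !rmorph_int. Qed.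

Lemma s_involutive : involutive s.
Proof.
move=> x; have [x0 [x1 [x2 [x3 ->]]]] := dec x.
by rewrite !(rmorphD, rmorphM, rmorphN, rmorph_ratK, s_ra, s_rb) /=; ring.
Qed.

Lemma t_involutive : involutive t.
Proof.
move=> x; have [x0 [x1 [x2 [x3 ->]]]] := dec x.
by rewrite !(rmorphD, rmorphM, rmorphN, rmorph_ratK, t_ra, t_rb) /=; ring.
Qed.

Lemma st_comm x : s (t x) = t (s x).
Proof.
have [x0 [x1 [x2 [x3 ->]]]] := dec x.
by rewrite !(rmorphD, rmorphM, rmorphN, rmorph_ratK, t_ra, t_rb, s_ra, s_rb) /=; ring.
Qed.

Definition trace (x : K) : K := x + s x + t x + s (t x).

Lemma trace_rat x : exists q : rat, trace x = q%:A.
Proof.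
have [x0 [x1 [x2 [x3 ->]]]] := dec x; exists (x0 *+ 4).
rewrite /trace !(rmorphD, rmorphM, rmorphN, rmorph_ratK, t_ra, t_rb, s_ra, s_rb) /=.
rewrite -scalerMnl -[RHS]mulr_natr; ring.
Qed.

Lemma OK_trace x : OK x -> exists m : int, trace x = m%:~R.
Proof.
move=> Ox; have [q qE] := trace_rat x.
have : OK (trace x) by do !apply: OK_add => //; do ?apply: OK_rmorph.
rewrite qE => /OK_rat[m ->]; exists m.
exact: (rmorph_int (in_alg K)).
Qed.

Lemma fixed_rat x : s x = x -> t x = x -> exists q : rat, x = q%:A.
Proof.
move=> sx tx; have [q] := trace_rat x; rewrite /trace tx !sx => E.
exists (q / 4); have n4 := @natK_neq0 K 4 isT.
apply: (mulIf n4); rewrite -[RHS]/(in_alg K _ * _) rmorphM fmorphV rmorph_nat mulfVK //.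
by rewrite -[RHS]E; ring.
Qed.

Definition half_a (i : bool) : K := if i then (1 + ra) / 2 else 1.
Definition half_b (i : bool) : K := if i then (1 + rb) / 2 else 1.
Definition dual_a (i : bool) : K := if i then ra else (a%:R - ra) / 2.
Definition dual_b (i : bool) : K := if i then rb else (b%:R - rb) / 2.

Let n2 : 2 != 0 :> K. Proof. exact: (@natK_neq0 K 2 isT). Qed.

(* [dual_a] divided by a is the trace-dual basis of [half_a] in Q(ra). *)
Lemma trace_dual x : (a * b)%:R * x =
  \sum_i \sum_j trace (x * half_a i * half_b j) * (dual_a i * dual_b j).
Proof.
rewrite !big_bool /trace /half_a /half_b /dual_a /dual_b.
rewrite !(rmorphM, rmorphD, rmorph1, fmorphV, rmorph_nat, s_ra, s_rb, t_ra, t_rb, rmorphN) /=.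
rewrite -ra2 -rb2; field; exact: n2.
Qed.

Lemma OK_half (r : K) d : r ^+ 2 = d%:R -> (d %% 4 = 1)%N -> OK ((1 + r) / 2).
Proof.
move=> r2 d4; apply: (@integral_root_monic _ _ _ _ ('X^2 - 'X - ((d %/ 4)%:R)%:P)).
- have -> : 'X^2 - 'X - ((d %/ 4)%:R)%:P = 'X^2 - ('X + ((d %/ 4)%:R)%:P) :> {poly K} by ring.
  by rewrite monicE lead_coefDl ?lead_coefXn // size_polyXn size_polyN size_XaddC.
- rewrite /root !hornerE; apply/eqP.
  have dE : d%:R = 4 * (d %/ 4)%:R + 1 :> K by rewrite {1}(divn_eq d 4) d4 natrD natrM mulrC.
  have : r ^+ 2 - d%:R = 0 by rewrite r2 subrr.
  rewrite dE => e; have n4 := @natK_neq0 K 4 isT; apply: (mulIf n4).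
  rewrite mul0r -e; field; exact: n2.
- move=> y /(nthP 0)[i _ <-]; rewrite !coefB coefXn coefX coefC.
  apply: integral_sub; first by apply: integral_sub; apply: integral_nat.
  by case: ifP => _; [apply: integral_nat|apply: integral0].
Qed.

Lemma OK_sqrt (r : K) d : r ^+ 2 = d%:R -> OK r.
Proof. by move=> r2; apply: (@OK_root K _ 2) => //; rewrite r2; apply: OK_nat. Qed.

Lemma OK_half_a i : OK (half_a i).
Proof. by case: i; [exact: OK_half ra2 a_mod4|exact: OK_1]. Qed.
Lemma OK_half_b i : OK (half_b i).
Proof. by case: i; [exact: OK_half rb2 b_mod4|exact: OK_1]. Qed.

Lemma dual_aE i : exists2 c, OK c & dual_a i = ra * c.
Proof.
case: i; first by exists 1; [exact: OK_1|rewrite mulr1].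
exists ((1 + ra) / 2 - 1); first by apply: OK_sub; [exact: OK_half ra2 a_mod4|exact: OK_1].
by rewrite /= -ra2; field.
Qed.

Lemma dual_bE i : exists2 c, OK c & dual_b i = rb * c.
Proof.
case: i; first by exists 1; [exact: OK_1|rewrite mulr1].
exists ((1 + rb) / 2 - 1); first by apply: OK_sub; [exact: OK_half rb2 b_mod4|exact: OK_1].
by rewrite /= -rb2; field.
Qed.

(** The dual family is divisible by ra rb, so the denominator of x is only sqrt(ab), not ab; for
    primes dividing ab this gain is what yields the radical. *)
Lemma trace_dvd (x : K) (M : nat) :
  (forall i j, exists m : int, trace (x * half_a i * half_b j) = M%:R * m%:~R) ->
  exists2 w, OK w & (a * b)%:R * x = M%:R * (ra * rb * w).
Proof.
move=> h; suff [w Ow ->] : exists2 w, OK w &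
    (a * b)%:R * x = M%:R * (ra * rb * w) by exists w.
rewrite trace_dual; apply: (big_ind (fun z => exists2 w, OK w & z = M%:R * (ra * rb * w))).
- by exists 0; rewrite ?mulr0 //; exact: OK_0.
- by move=> _ _ [u Ou ->] [v Ov ->]; exists (u + v); [exact: OK_add|rewrite -!mulrDr].
move=> i _; apply: (big_ind (fun z => exists2 w, OK w & z = M%:R * (ra * rb * w))).
- by exists 0; rewrite ?mulr0 //; exact: OK_0.
- by move=> _ _ [u Ou ->] [v Ov ->]; exists (u + v); [exact: OK_add|rewrite -!mulrDr].
move=> j _; have [m ->] := h i j.
have [u Ou ->] := dual_aE i; have [v Ov ->] := dual_bE j.
exists (m%:~R * (u * v)); last by ring.
by apply: OK_mul; [exact: OK_int|exact: OK_mul].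
Qed.

Let ra0 : ra != 0.
Proof. by apply/eqP => r0; move: ra2 a_mod4; rewrite r0 expr0n /= => /esym/eqP; rewrite natK_eq0 => /eqP->. Qed.
Let rb0 : rb != 0.
Proof. by apply/eqP => r0; move: rb2 b_mod4; rewrite r0 expr0n /= => /esym/eqP; rewrite natK_eq0 => /eqP->. Qed.

Lemma natcomb_coprime (P : K -> Prop) (m n : nat) (x : K) :
  (forall u v, P u -> P v -> P (u + v)) -> (forall c u, OK c -> P u -> P (c * u)) ->
  coprime m n -> (0 < m)%N -> P (m%:R * x) -> P (n%:R * x) -> P x.
Proof.
move=> PD PM /eqP co m0 hm hn; have [u v uvE _] := egcdnP n m0.
have -> : x = u%:R * (m%:R * x) + - v%:R * (n%:R * x).
  have : u%:R * m%:R = v%:R * n%:R + 1 :> K by rewrite -!natrM uvE natrD co.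
  by move=> e; rewrite !mulrA e; ring.
by apply: PD; apply: PM => //; [exact: OK_nat|apply/OK_opp/OK_nat].
Qed.

Section Prime.
Variables (p : nat) (p_pr : prime p).
Let p0 : (0 < p)%N := prime_gt0 p_pr.
Let p0K : p%:R != 0 :> K. Proof. exact: natK_neq0. Qed.

(* The radical of pO in both cases, since p is unramified when it does not divide ab. *)
Definition ideal_over : fracIdeal K :=
  if (p %| a * b)%N then radical K p0 else nat_ideal K p0.

Lemma ideal_over_square x : ideal_set ideal_over x -> OK (x ^+ 2 / p%:R).
Proof.
rewrite /ideal_over; case: ifP => _ //= hx.
have -> : x ^+ 2 / p%:R = x / p%:R * (x / p%:R) * p%:R by field; exact: p0K.
by apply: OK_mul; [exact: OK_mul|exact: OK_nat].
Qed.

(** If ab = c p, then c x = ra rb w has square c p w^2 ab/(c p) = ab w^2, divisible by p, so c x and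
    p x lie in R_p with c prime to p. If p does not divide ab, then ab x and p x both lie in pO. *)
Lemma trace_dvd_ideal_over x : OK x ->
  (forall z, OK z -> exists m : int, trace (x * z) = p%:R * m%:~R) ->
  ideal_set ideal_over x.
Proof.
move=> Ox h; have [|w Ow E] := @trace_dvd x p.
  by move=> i j; rewrite -mulrA; apply: h; apply: OK_mul; [exact: OK_half_a|exact: OK_half_b].
have ab0 : (0 < a * b)%N by case: ab_sqf.
have Ora := OK_sqrt ra2; have Orb := OK_sqrt rb2.
rewrite /ideal_over; case: ifP => [pab|/negbT pab] /=.
  have [c cE] := dvdnP pab.
  apply: (@natcomb_coprime (ideal_set (radical K p0)) c p x).
  - exact: fracIdealD.
  - exact: fracIdealM.
  - by apply: squarefree_coprimeM; rewrite -cE.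
  - by move: ab0; rewrite cE muln_gt0 => /andP[].
  - have -> : c%:R * x = ra * rb * w.
      by apply: (mulfI p0K); rewrite -E cE natrM; ring.
    rewrite /= !exprMn ra2 rb2 -natrM cE natrM.
    have -> : c%:R * p%:R * w ^+ 2 / p%:R = c%:R * w ^+ 2 by field; exact: p0K.
    by apply: OK_mul; [exact: OK_nat|exact: OK_exp].
  - rewrite /=; have -> : (p%:R * x) ^+ 2 / p%:R = p%:R * x ^+ 2 by field; exact: p0K.
    by apply: OK_mul; [exact: OK_nat|exact: OK_exp].
apply: (@natcomb_coprime (fun x => OK (x / p%:R)) (a * b) p x) => //.
- by move=> u v hu hv; rewrite mulrDl; apply: OK_add.
- by move=> u v hu hv; rewrite -mulrA; apply: OK_mul.
- by rewrite coprime_sym prime_coprime.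
- by rewrite E mulrC mulKf //; do ?apply: OK_mul.
- by rewrite mulrC mulKf.
Qed.

Definition trace_int (x : K) : int := xget 0 [set m : int | trace x = m%:~R].

Lemma trace_intE x : OK x -> trace x = (trace_int x)%:~R.
Proof.
by move=> /OK_trace[m mE]; rewrite /trace_int; case: xgetP => [_ -> //|/(_ m)].
Qed.

(** Traces against an integral family, taken modulo abp instead of p to absorb the denominator lost
    in [trace_dual]. *)
Definition colour (x : K) : {ffun bool * bool -> 'I_(a * b * p).+1} :=
  [ffun ij => inord (absz (modz (trace_int (x * half_a ij.1 * half_b ij.2)) (a * b * p)%N))].

Lemma colour_mod x y : OK x -> OK y -> colour x = colour y -> OK ((x - y) / p%:R).
Proof.
move=> Ox Oy cxy; have ab0 : (0 < a * b)%N by case: ab_sqf.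
have abp0 : (0 < a * b * p)%N by rewrite muln_gt0 ab0.
have [i j|w Ow E] := @trace_dvd (x - y) (a * b * p).
  have Oz z : OK z -> OK (z * half_a i * half_b j).
    by move=> hz; apply: OK_mul; [apply: OK_mul => //; exact: OK_half_a|exact: OK_half_b].
  have -> : trace ((x - y) * half_a i * half_b j) =
      trace (x * half_a i * half_b j) - trace (y * half_a i * half_b j).
    by rewrite /trace !mulrBl !rmorphB /=; ring.
  rewrite !trace_intE; try exact: Oz.
  have := congr1 (fun f : {ffun bool * bool -> _} => val (f (i, j))) cxy.
  rewrite !ffunE /=; move: (trace_int _) (trace_int _) => m m'.
  rewrite !inordK; try exact: absz_modz_lt.
  move/(absz_modz_dvd abp0).
  move=> /dvdzP[k kE]; exists k.
  by rewrite -intrB kE intrM mulrC.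
have -> : (x - y) / p%:R = ra * rb * w.
  have abK : (a * b)%:R != 0 :> K by exact: natK_neq0.
  apply: (mulfI abK); rewrite mulrA E [(a * b * p)%:R]natrM; field.
  exact: p0K.
by apply: OK_mul => //; apply: OK_mul; [exact: OK_sqrt ra2|exact: OK_sqrt rb2].
Qed.

End Prime.

(** * Galois conjugates of ideals and the primes over p *)

Fact conj_ideal_subproof (f : {rmorphism K -> K}) (P : fracIdeal K) : involutive f ->
  `[< is_fracIdeal [set x | ideal_set P (f x)] >].
Proof.
move=> fK; have [[x Px x0] _ _ [d [Od d0] dP]] := fracIdealP P; apply/asboolP; split.
- by exists (f x); rewrite /= ?fK // fmorph_eq0.
- by move=> y z /= hy hz; rewrite rmorphD; apply: fracIdealD.
- by move=> c y Oc /= hy; rewrite rmorphM; apply: fracIdealM => //; apply: OK_rmorph.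
- exists (f d); first by rewrite fmorph_eq0; split => //; exact: OK_rmorph.
  by move=> y /= /dP /(OK_rmorph f); rewrite rmorphM fK.
Qed.

Definition conj_aut (e : bool * bool) : {rmorphism K -> K} :=
  (if e.1 then s else idfun) \o (if e.2 then t else idfun).

Lemma conj_autK e : involutive (conj_aut e).
Proof.
case: e => [[] []] x //=; rewrite ?s_involutive ?t_involutive //.
by rewrite st_comm s_involutive t_involutive.
Qed.

Lemma traceE x : trace x = \sum_(e : bool * bool) conj_aut e x.
Proof.
rewrite (eq_bigr (fun e => conj_aut (e.1, e.2) x)); last by case.
rewrite -(pair_bigA _ (fun i j => conj_aut (i, j) x)) !big_bool /= /trace; ring.
Qed.

Definition conj_ideal e P := FracIdeal (conj_ideal_subproof P (conj_autK e)).

Lemma conj_ideal_prime e (P : fracIdeal K) : prime_ideal P -> prime_ideal (conj_ideal e P).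
Proof.
move=> hP; have [[PO nP] PM] := hP; split; first split.
- by move=> x /= /PO /(OK_rmorph (conj_aut e)); rewrite conj_autK.
- move=> h; apply: (prime_ideal1 hP).
  have : ideal_set P (conj_aut e 1) := h 1 (@OK_1 K).
  by rewrite rmorph1.
- move=> x y Ox Oy h.
  have : ideal_set P (conj_aut e (x * y)) := h.
  by rewrite rmorphM => /PM; apply; exact: OK_rmorph.
Qed.

Lemma conj_ideal_nat e (P : fracIdeal K) (n : nat) : ideal_set (conj_ideal e P) n%:R <-> ideal_set P n%:R.
Proof. by rewrite -[ideal_set (conj_ideal e P) _]/(ideal_set P (conj_aut e n%:R)) rmorph_nat. Qed.

Lemma OK_natX_dvd (P : fracIdeal K) (m : int) p : prime p -> prime_ideal P ->
  ideal_set P p%:R -> ideal_set P m%:~R -> exists k : int, m%:~R = p%:R * k%:~R :> K.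
Proof.
move=> p_pr hP Pp Pm; case: (boolP (p %| absz m)%N) => [pm|].
  have : (p %| m)%Z by [].
  by move=> /dvdzP[k ->]; exists k; rewrite intrM mulrC.
rewrite -prime_coprime // => co; case: (prime_ideal1 hP).
have : coprimez p m by [].
move=> /coprimezP[[u v] /= uv].
have -> : 1 = u%:~R * p%:R + v%:~R * m%:~R :> K.
  by rewrite -[p%:R]/(p%:Z%:~R) -!intrM -intrD uv.
by apply: fracIdealD; apply: fracIdealM => //; apply: OK_int.
Qed.

Section PrimeOver.
Variables (p : nat) (p_pr : prime p).
Let p0 : (0 < p)%N := prime_gt0 p_pr.
Let p0K : p%:R != 0 :> K. Proof. exact: natK_neq0. Qed.
Let maximal := prime_ideal_sub_eq p_pr (colour_mod p_pr).

Lemma ideal_over_sub (Q : fracIdeal K) : prime_ideal Q -> ideal_set Q p%:R -> ideal_over p_pr `<=` Q.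
Proof.
move=> hQ Qp x /ideal_over_square hx.
have Ox : OK x by apply: (radical_OK p0).
apply: (@prime_idealX _ Q x 2 hQ Ox); rewrite -[x ^+ 2](mulfVK p0K).
exact: fracIdealM.
Qed.

(** If every conjugate of P contains x, then P contains all conjugates of x z for integral z, hence
    their trace, an integer in P and so a multiple of p; [trace_dvd_ideal_over] concludes. *)
Lemma ideal_overE (P : fracIdeal K) x : prime_ideal P -> ideal_set P p%:R ->
  ideal_set (ideal_over p_pr) x <-> forall e, ideal_set (conj_ideal e P) x.
Proof.
move=> hP Pp; split=> [hx e|h].
  apply: ideal_over_sub hx; first exact: conj_ideal_prime.
  exact/conj_ideal_nat.
have Ox : OK x by apply: (prime_ideal_sub hP); have := h (false, false).
apply: trace_dvd_ideal_over => // z Oz.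
have [m mE] := OK_trace (OK_mul Ox Oz); rewrite mE.
apply: (OK_natX_dvd p_pr hP Pp); rewrite -mE traceE.
apply: fracIdeal_sum => e _; rewrite rmorphM mulrC.
by apply: fracIdealM; [exact: OK_rmorph|exact: h].
Qed.

(** If Q were no conjugate of P, each conjugate would contain an element outside Q. The product of
    these four lies in every conjugate, hence in [ideal_over p_pr] and in Q, which is prime. *)
Lemma prime_over_conj (P Q : fracIdeal K) : prime_ideal P -> ideal_set P p%:R ->
  prime_ideal Q -> ideal_set Q p%:R -> exists e, Q = conj_ideal e P.
Proof.
move=> hP Pp hQ Qp; apply: contrapT => no.
have [y [yP Oy nQy]] : exists y : bool * bool -> K,
    [/\ forall e, ideal_set (conj_ideal e P) (y e), forall e, OK (y e) &
        forall e, ~ ideal_set Q (y e)].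
  have h e : exists z, [/\ ideal_set (conj_ideal e P) z, OK z & ~ ideal_set Q z].
    have hPe := conj_ideal_prime e hP.
    apply: contrapT => no'; apply: no; exists e; symmetry.
    apply: maximal => //; first exact/conj_ideal_nat.
    move=> z Pz; apply: contrapT => nQz; apply: no'; exists z; split => //.
    exact: prime_ideal_sub hPe Pz.
  have /boolp.choice[y hy] := h; exists y.
  by split => e; case: (hy e).
pose x := y (false, false) * (y (false, true) * (y (true, false) * y (true, true))).
have : ideal_set Q x.
  apply: (@ideal_over_sub Q) => //; apply/(ideal_overE x hP Pp) => e.
  have Py : ideal_set (conj_ideal e P) (y e) by [].
  suff [c Oc ->] : exists2 c, OK c & x = c * y e by apply: fracIdealM.
  case: e {Py} => [[] []].
  - by exists (y (false, false) * y (false, true) * y (true, false)); [do 2!apply: OK_mul => //|rewrite /x; ring].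
  - by exists (y (false, false) * y (false, true) * y (true, true)); [do 2!apply: OK_mul => //|rewrite /x; ring].
  - by exists (y (false, false) * y (true, false) * y (true, true)); [do 2!apply: OK_mul => //|rewrite /x; ring].
  - by exists (y (false, true) * y (true, false) * y (true, true)); [do 2!apply: OK_mul => //|rewrite /x; ring].
have [_ QM] := hQ.
move=> /QM; case; [exact: Oy|by do ?apply: OK_mul|exact: nQy|].
move=> /QM; case; [exact: Oy|by do ?apply: OK_mul|exact: nQy|].
by move=> /QM; case; [exact: Oy|exact: Oy|exact: nQy|exact: nQy].
Qed.

Lemma absNorm_over (P : fracIdeal K) : prime_ideal P -> ideal_set P p%:R ->
  exists2 k, (0 < k)%N & absNorm P = (p ^ k)%N.
Proof.
move=> hP Pp.
have [k k0 [g hg]] := residue_system_exists p_pr (colour_mod p_pr) Pp (prime_ideal1 hP).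
by exists k => //; rewrite (absNorm_residue_system hg) card_ffun !card_ord.
Qed.

Lemma absNorm_conj_ideal e (P : fracIdeal K) : prime_ideal P -> ideal_set P p%:R ->
  absNorm (conj_ideal e P) = absNorm P.
Proof.
move=> hP Pp.
have [k k0 [g hg]] := residue_system_exists p_pr (colour_mod p_pr) Pp (prime_ideal1 hP).
have hge : residue_system (conj_ideal e P) (conj_aut e \o g).
  by apply: (absNorm_conj (conj_autK e) _ hg).
by rewrite (absNorm_residue_system hg) (absNorm_residue_system hge).
Qed.

End PrimeOver.

Lemma prime_ideal_nat (P : fracIdeal K) (n : nat) : prime_ideal P -> (0 < n)%N -> ideal_set P n%:R ->
  exists2 l, prime l & ideal_set P l%:R.
Proof.
move=> hP; elim/ltn_ind: n => n IH n0 Pn.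
have n1 : (1 < n)%N.
  rewrite ltn_neqAle n0 andbT; apply/eqP => n1; apply: (prime_ideal1 hP).
  by move: Pn; rewrite -n1.
have l_pr := pdiv_prime n1; have nE := divnK (pdiv_dvd n).
have [_ PM] := hP; move: Pn; rewrite -nE natrM => /PM; case; try exact: OK_nat; last by exists (pdiv n).
apply: IH; first by rewrite ltn_Pdiv ?prime_gt1.
by rewrite divn_gt0 ?prime_gt0 // dvdn_leq ?pdiv_dvd.
Qed.

Lemma prime_ideal_over (P : fracIdeal K) : prime_ideal P -> exists2 l, prime l & ideal_set P l%:R.
Proof.
move=> hP; have [[x Px x0] _ _ _] := fracIdealP P.
have Ox := prime_ideal_sub hP Px.
pose y := s x * (t x * s (t x)).
have Oy : OK y by do !apply: OK_mul; do !apply: OK_rmorph.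
have y0 : y != 0 by rewrite /y !mulf_neq0 ?fmorph_eq0.
have [||q qE] := @fixed_rat (y * x).
- by rewrite /y !rmorphM /= !s_involutive; ring.
- by rewrite /y !rmorphM /= -!st_comm !t_involutive; ring.
have Oyx : OK (y * x) by exact: OK_mul.
have [m mE] : exists m : int, y * x = m%:~R.
  by move: Oyx; rewrite qE => /OK_rat[m ->]; exists m; exact: (rmorph_int (in_alg K)).
have m0 : m != 0.
  by apply: contra_neq (mulf_neq0 y0 x0) => m0; rewrite mE m0.
apply: (@prime_ideal_nat P (absz m)) => //; first by rewrite absz_gt0.
have Pm : ideal_set P m%:~R by rewrite -mE; apply: fracIdealM.
have -> : (absz m)%:R = (sgz m)%:~R * m%:~R :> K.
  by rewrite -intrM -[LHS]/((absz m)%:Z%:~R) abszEsg.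
by apply: fracIdealM => //; apply: OK_int.
Qed.

(** The norm determines p, and all primes over p are conjugate with equal norms; so the product runs
    over the distinct conjugates of P, and equals their intersection. *)
Lemma ostrowskiIdeal_over p (p_pr : prime p) (P : fracIdeal K) : prime_ideal P -> ideal_set P p%:R ->
  ostrowskiIdeal K (absNorm P) = ideal_over p_pr.
Proof.
move=> hP Pp; have [k k0 qE] := absNorm_over p_pr hP Pp.
rewrite /ostrowskiIdeal asboolT; last by exists p, k.
set A := [set Q | _]; set S := finite_support _ _ _.
have AE Q : A Q <-> exists e, Q = conj_ideal e P.
  split=> [[hQ nQ]|[e ->]].
    have [l l_pr Ql] := prime_ideal_over hQ.
    have lp : l = p.
      have [k' k'0 lE] := absNorm_over l_pr hQ Ql.
      have : (l %| p ^ k)%N by rewrite -qE -nQ lE dvdn_exp.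
      by rewrite Euclid_dvdX // k0 andbT dvdn_prime2 // => /eqP.
    by apply: (prime_over_conj p_pr hP Pp hQ); rewrite -lp.
  by split; [exact: conj_ideal_prime|exact: (absNorm_conj_ideal p_pr)].
have Afin : finite_set A.
  apply: (@sub_finite_set _ A [set` [seq conj_ideal e P | e in {: bool * bool}]]).
    by move=> Q /AE[e ->] /=; apply/mapP; exists e => //; rewrite mem_enum.
  exact: finite_seq.
(* The finite support leaves out factors equal to the unit ideal; no prime ideal is one. *)
have SA Q : Q \in S <-> A Q.
  rewrite /S in_finite_support; last exact: finite_setIl.
  split => [/set_mem[]//|AQ]; apply/mem_set; split => //= Q1.
  by case: AQ => hQ _; apply: (prime_ideal1 hQ); rewrite Q1; exact: OK_1.
have hS Q : Q \in S -> prime_ideal Q /\ ideal_set Q p%:R.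
  by move=> /SA/AE[e ->]; split; [exact: conj_ideal_prime|exact/conj_ideal_nat].
have cap := prime_product_cap p_pr (colour_mod p_pr) (finite_support_uniq _ _ _) hS.
apply: fracIdeal_eq => x.
  move=> /cap[Ox hx]; apply/(ideal_overE p_pr x hP Pp) => e.
  by apply: hx; apply/SA/AE; exists e.
move=> hx; apply/cap; split.
  by apply: (radical_OK (prime_gt0 p_pr)); apply: ideal_over_square hx.
by move=> Q /SA/AE[e ->]; move: e; apply/(ideal_overE p_pr x hP Pp).
Qed.

Lemma ostrowskiIdeal_cases q :
  ostrowskiIdeal K q = 1%g \/ exists p (p_pr : prime p), ostrowskiIdeal K q = ideal_over p_pr.
Proof.
case: (pselect (exists P : fracIdeal K, prime_ideal P /\ absNorm P = q)) => [[P [hP <-]]|no].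
  have [l l_pr Pl] := prime_ideal_over hP; right; exists l, l_pr.
  exact: ostrowskiIdeal_over.
left; rewrite /ostrowskiIdeal; case: ifP => // _.
have -> : [set P : fracIdeal K | prime_ideal P /\ absNorm P = q] = set0.
  by apply/seteqP; split => // P hP; apply: no; exists P.
set S := finite_support _ _ _.
suff -> : S = [::] by rewrite big_nil.
case ES: S => [//|Q S']; have : Q \in S by rewrite ES mem_head.
rewrite /S in_finite_support; last by rewrite set0I; exact: finite_set0.
by move=> /set_mem[].
Qed.

Lemma ostrowskiIdeal_exists p (p_pr : prime p) :
  exists2 q, (0 < q)%N & ostrowskiIdeal K q = ideal_over p_pr.
Proof.
have [P hP Pp] := prime_ideal_exists p_pr (colour_mod p_pr).
exists (absNorm P); last exact: ostrowskiIdeal_over.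
by have [k _ ->] := absNorm_over p_pr hP Pp; rewrite expn_gt0 prime_gt0.
Qed.

(** * Squares in [K] and units of the quadratic subfields *)

Lemma rational_square (m : int) (z : K) : m != 0 -> z ^+ 2 = m%:~R ->
  exists (i j : bool) (k : nat), m * (a ^ i * b ^ j)%N%:Z = (k ^ 2)%N%:Z.
Proof.
move=> m0 z2.
have sgn (f : {rmorphism K -> K}) : exists i : bool, f z = (-1) ^+ i * z.
  have /eqP : (f z) ^+ 2 = z ^+ 2 by rewrite -rmorphXn z2 rmorph_int.
  rewrite eqf_sqr => /orP[/eqP->|/eqP->]; first by exists false; rewrite expr0 mul1r.
  by exists true; rewrite expr1 mulN1r.
(* Kummer theory by hand: s and t act on z by the same signs as on ra^i rb^j, so the product of the
   two is rational. *)
have [i sz] := sgn s; have [j tz] := sgn t; exists i, j.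
pose w := ra ^+ i * rb ^+ j.
have w0 : w != 0 by rewrite mulf_neq0 // expf_neq0.
have w2 : w ^+ 2 = (a ^ i * b ^ j)%N%:R.
  by rewrite /w natrM !natrX exprMn -ra2 -rb2 -!exprM ![(2 * _)%N]mulnC.
have sw : s w = (-1) ^+ i * w.
  by rewrite /w rmorphM !rmorphXn s_ra s_rb [(- ra) ^+ i]exprNn mulrA.
have tw : t w = (-1) ^+ j * w.
  by rewrite /w rmorphM !rmorphXn t_ra t_rb [(- rb) ^+ j]exprNn mulrCA.
have sg0 (e : bool) : (-1) ^+ e != 0 :> K by rewrite signr_eq0.
have [||q qE] := @fixed_rat (z * w).
- by rewrite rmorphM sz sw mulrACA -expr2 sqrr_sign mul1r.
- by rewrite rmorphM tz tw mulrACA -expr2 sqrr_sign mul1r.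
have q2 : (z * w) ^+ 2 = (m * (a ^ i * b ^ j)%N%:Z)%:~R.
  by rewrite exprMn z2 w2 intrM.
have : OK (z * w) by apply: (@OK_root K _ 2) => //; rewrite q2; apply: OK_int.
rewrite qE => /OK_rat[k kE]; exists (absz k).
have : (k ^+ 2)%:~R = (m * (a ^ i * b ^ j)%N%:Z)%:~R :> K.
  by rewrite -q2 qE kE -[_%:A]/(in_alg K _) rmorph_int rmorphXn.
have intrK_inj : injective (intr : int -> K).
  move=> u v e; apply: (@intr_inj rat); apply: (fmorph_inj (in_alg K)).
  by rewrite !rmorph_int.
move=> /intrK_inj <-.
by rewrite absz_sqr.
Qed.

(** N = q D is an integer and D divides N^2; as D is squarefree, D divides N. *)
Lemma rational_int_square (q : rat) (D : nat) (M : int) : squarefree D ->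
  q ^+ 2 * D%:R = M%:~R -> exists Y : int, q = Y%:~R.
Proof.
move=> sD E; have D0 := sD.1.
have D0Q : D%:R != 0 :> rat by rewrite pnatr_eq0 -lt0n.
have [N NE] : exists N : int, q * D%:R = N%:~R.
  apply: OK_rat; apply: (@OK_root K _ 2) => //.
  have -> : (q * D%:R)%:A ^+ 2 = (M * D%:Z)%:~R :> K.
    rewrite -[_%:A]/(in_alg K _) -rmorphXn exprMn [D%:R ^+ 2]expr2 mulrA E.
    by rewrite -[D%:R]/(D%:Z%:~R) -intrM rmorph_int.
  exact: OK_int.
have N2 : N ^+ 2 = M * D%:Z.
  apply: (@intr_inj rat); rewrite rmorphXn /= -NE exprMn [D%:R ^+ 2]expr2 mulrA E.
  by rewrite intrM.
have DN : (D %| absz N)%N.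
  have : (D %| absz N ^ 2)%N.
    by rewrite -abszX N2 abszM /= dvdn_mull.
  pose g := gcdn (absz N) D; have gD : (g %| D)%N := dvdn_gcdr _ _.
  have DE : D = (g * (D %/ g))%N by rewrite mulnC divnK.
  have cg : coprime g (D %/ g) by apply: squarefree_coprimeM; rewrite -DE.
  have co : coprime (D %/ g) (absz N).
    rewrite /coprime; set h := gcdn _ _.
    have hg : (h %| g)%N.
      rewrite dvdn_gcd dvdn_gcdr DE; apply: dvdn_mull; exact: dvdn_gcdl.
    have : (h %| gcdn g (D %/ g))%N by rewrite dvdn_gcd hg dvdn_gcdl.
    by rewrite (eqP cg) dvdn1.
  move=> DN2; have : (D %/ g %| 1)%N.
    rewrite -(@Gauss_dvdr _ (absz N ^ 2)) ?coprimeXr // muln1.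
    by apply: dvdn_trans DN2; rewrite {2}DE dvdn_mull.
  rewrite dvdn1 => /eqP e; rewrite DE e muln1; exact: dvdn_gcdl.
have /dvdzP[Y YE] : (D %| N)%Z by [].
by exists Y; apply: (mulIf D0Q); rewrite NE YE intrM.
Qed.

Lemma quadratic_unit_pell (D : nat) (r e : K) (f : {rmorphism K -> K}) (sg : int) :
  squarefree D -> r != 0 -> r ^+ 2 = D%:R -> OK e ->
  (exists q : rat, e + f e = q%:A) -> (exists q : rat, (e - f e) / r = q%:A) ->
  e * f e = sg%:~R ->
  exists X Y : int, X ^+ 2 = D%:Z * Y ^+ 2 + 4 * sg /\ e + f e = X%:~R.
Proof.
move=> sD r0 r2 Oe [q qE] [y yE] nE.
have [X XE] : exists X : int, q = X%:~R.
  by apply: (@OK_rat K); rewrite -qE; apply: OK_add => //; exact: OK_rmorph.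
have XK : e + f e = X%:~R by rewrite qE XE; exact: (rmorph_int (in_alg K)).
have E1 : (e - f e) ^+ 2 = (X ^+ 2 - 4 * sg)%:~R.
  rewrite intrB rmorphXn /= -XK intrM -nE; ring.
have E2 : y ^+ 2 * D%:R = (X ^+ 2 - 4 * sg)%:~R.
  have yA : in_alg K y = (e - f e) / r by rewrite yE.
  apply: (fmorph_inj (in_alg K)); rewrite rmorph_int -E1 rmorphM rmorphXn rmorph_nat.
  by rewrite /= in yA *; rewrite yA -r2 -exprMn mulfVK.
have [Y YE] := rational_int_square sD E2.
exists X, Y; split => //; apply/eqP; rewrite -subr_eq; apply/eqP.
by apply: (@intr_inj rat); rewrite -E2 YE intrM rmorphXn mulrC.
Qed.

(** Passing from e to -e when the trace is negative makes the trace X' = |X|; then (1 + e)^2 = e (X'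
    + 2), as e has norm 1. *)
Lemma pell_square_class (D : nat) (e fe : K) (X Y : int) :
  X ^+ 2 = D%:Z * Y ^+ 2 + 4 -> e + fe = X%:~R -> e * fe = 1 ->
  exists (sg : bool) (X' Y' : nat) (z : K),
    [/\ pell4 D X' Y', z != 0 & z ^+ 2 = (-1) ^+ sg * e * (X' + 2)%:R].
Proof.
move=> XY eX en; have e0 : e != 0.
  by apply: contra_eq_neq en => ->; rewrite mul0r eq_sym oner_eq0.
pose sg := X < 0; exists sg, (absz X), (absz Y), (1 + (-1) ^+ sg * e).
have XE : (-1) ^+ sg * X = (absz X)%:Z.
  by rewrite /sg; case: ltrP => h; rewrite ?expr1 ?expr0 ?mulN1r ?mul1r; lia.
have E : (1 + (-1) ^+ sg * e) ^+ 2 = (-1) ^+ sg * e * (absz X + 2)%:R.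
  have -> : (absz X + 2)%:R = (-1) ^+ sg * X%:~R + 2 :> K.
    rewrite natrD -[(absz X)%:R]/((absz X)%:Z%:~R) -XE intrM.
    by rewrite rmorphXn rmorphN rmorph1.
  have s2 : ((-1) ^+ sg) ^+ 2 = 1 :> K by rewrite sqrr_sign.
  rewrite -eX; move: ((-1) ^+ sg : K) s2 => u u2.
  have -> : u * e * (u * (e + fe) + 2) = u ^+ 2 * (e * e + e * fe) + 2 * u * e by ring.
  by rewrite en u2; transitivity (1 + 2 * u * e + u ^+ 2 * e ^+ 2); [ring|rewrite u2; ring].
split => //.
- by rewrite /pell4; apply/eqP; rewrite -eqz_nat PoszD PoszM !absz_sqr XY.
- have : (1 + (-1) ^+ sg * e) ^+ 2 != 0.
    by rewrite E !mulf_neq0 ?signr_eq0 // natK_eq0 addn2.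
  by apply: contra_neq => ->; rewrite expr0n.
Qed.

(* e1, e2, e3 below are the norms of x to the three quadratic subfields divided by d;
   they are units with a common norm n, and d e1 e2 e3 = n x^2. *)
Lemma unit_relation_square (d : nat) (x u : K) :
  (forall X Y, b * Y ^ 2 <> X ^ 2 + 4)%N ->
  (0 < d)%N -> x != 0 -> OK u -> OK u^-1 -> x ^+ 2 = d%:R * u ->
  exists X1 Y1 X2 Y2 X3 Y3 (i j : bool),
    [/\ pell4 a X1 Y1, pell4 b X2 Y2, pell4 (a * b) X3 Y3 &
        perfect_square (d * (X1 + 2) * (X2 + 2) * (X3 + 2) * (a ^ i * b ^ j))].
Proof.
move=> noneg d0 x0 Ou Ou' xE; have d0K := @natK_neq0 K d d0.
have ss := s_involutive; have tt := t_involutive.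
have sx0 : s x != 0 by rewrite fmorph_eq0.
have tx0 : t x != 0 by rewrite fmorph_eq0.
have stx0 : s (t x) != 0 by rewrite !fmorph_eq0.
pose e1 := x * t x / d%:R; pose e2 := x * s x / d%:R; pose e3 := x * s (t x) / d%:R.
pose n := x * s x * t x * s (t x) / d%:R ^+ 2.
have sd : s d%:R = d%:R by rewrite rmorph_nat.
have td : t d%:R = d%:R by rewrite rmorph_nat.
have xsE : s x ^+ 2 = d%:R * s u by rewrite -rmorphXn xE rmorphM sd.
have xtE : t x ^+ 2 = d%:R * t u by rewrite -rmorphXn xE rmorphM td.
have xstE : s (t x) ^+ 2 = d%:R * s (t u) by rewrite -rmorphXn xtE rmorphM sd.
have OK_sq (y : K) (v w : K) : OK v -> OK w -> y ^+ 2 = v * w -> OK y.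
  by move=> Ov Ow yE; apply: (@OK_root K _ 2) => //; rewrite yE; apply: OK_mul.
have Osu := OK_rmorph s Ou; have Otu := OK_rmorph t Ou; have Ostu := OK_rmorph s Otu.
have O1 : OK e1.
  apply: (OK_sq _ u (t u)) => //; rewrite /e1 expr_div_n exprMn xE xtE; field; exact: d0K.
have O2 : OK e2.
  apply: (OK_sq _ u (s u)) => //; rewrite /e2 expr_div_n exprMn xE xsE; field; exact: d0K.
have O3 : OK e3.
  apply: (OK_sq _ u (s (t u))) => //; rewrite /e3 expr_div_n exprMn xE xstE; field; exact: d0K.
have se1 : s e1 = s x * s (t x) / d%:R by rewrite /e1 !rmorphM fmorphV sd.
have te1 : t e1 = e1 by rewrite /e1 !rmorphM fmorphV td tt [t x * x]mulrC.
have se2 : s e2 = e2 by rewrite /e2 !rmorphM fmorphV sd ss [s x * x]mulrC.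
have te2 : t e2 = t x * s (t x) / d%:R by rewrite /e2 !rmorphM fmorphV td -st_comm.
have se3 : s e3 = s x * t x / d%:R by rewrite /e3 !rmorphM fmorphV sd ss.
have te3 : t e3 = s e3 by rewrite se3 /e3 !rmorphM fmorphV td -st_comm tt [t x * _]mulrC.
have n1 : e1 * s e1 = n by rewrite se1 /e1 /n; field; exact: d0K.
have n2' : e2 * t e2 = n by rewrite te2 /e2 /n; field; exact: d0K.
have n3 : e3 * s e3 = n by rewrite se3 /e3 /n; field; exact: d0K.
have sn : s n = n by rewrite -n1 rmorphM ss mulrC.
have tn : t n = n by rewrite -n1 rmorphM -st_comm te1.
have [q qE] := fixed_rat sn tn.
have On : OK n by rewrite -n1; apply: OK_mul => //; apply: OK_rmorph.
have n0 : n != 0 by rewrite /n mulf_neq0 ?invr_eq0 ?expf_neq0 //; do !apply: mulf_neq0.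
have On' : OK n^-1.
  apply: (@OK_root K _ 2) => //.
  have -> : n^-1 ^+ 2 = u^-1 * (s u^-1) * (t u^-1) * s (t u^-1).
    rewrite !fmorphV /n exprVn expr_div_n !exprMn xE xsE xtE xstE.
    have x20 : x ^+ 2 != 0 by rewrite expf_neq0.
    have u0 : u != 0 by apply: contra_neq x20 => u0; rewrite xE u0 mulr0.
    by field; rewrite d0K !fmorph_eq0 u0.
  by do !apply: OK_mul => //; do !apply: OK_rmorph.
have [m mE] : exists m : int, q = m%:~R by apply: (@OK_rat K); rewrite -qE.
have nm : n = m%:~R by rewrite qE mE; exact: (rmorph_int (in_alg K)).
have [m' m'E] : exists m' : int, q^-1 = m'%:~R.
  apply: (@OK_rat K); have -> // : q^-1%:A = n^-1.
  by rewrite qE -[LHS]/(in_alg K _) fmorphV.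
have mm' : m * m' = 1.
  apply: (@intr_inj rat); rewrite intrM -mE -m'E divff //.
  by apply: contra_neq n0 => q0; rewrite qE q0 scale0r.
have e1t : t (s e1) = s e1 by rewrite -st_comm te1.
have e2s : s (t e2) = t e2 by rewrite st_comm se2.
have e3t : t (s e3) = e3 by rewrite -te3 tt.
have [r1 r1'] : (exists q : rat, e1 + s e1 = q%:A) /\ (exists q : rat, (e1 - s e1) / ra = q%:A).
  split; apply: fixed_rat.
  - by rewrite rmorphD ss addrC.
  - by rewrite rmorphD te1 e1t.
  - by rewrite rmorphM fmorphV rmorphB ss s_ra invrN mulrN -mulNr opprB.
  - by rewrite rmorphM fmorphV rmorphB te1 e1t t_ra.
have [r2 r2'] : (exists q : rat, e2 + t e2 = q%:A) /\ (exists q : rat, (e2 - t e2) / rb = q%:A).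
  split; apply: fixed_rat.
  - by rewrite rmorphD se2 e2s.
  - by rewrite rmorphD tt addrC.
  - by rewrite rmorphM fmorphV rmorphB se2 e2s s_rb.
  - by rewrite rmorphM fmorphV rmorphB tt t_rb invrN mulrN -mulNr opprB.
have [r3 r3'] : (exists q : rat, e3 + s e3 = q%:A) /\
    (exists q : rat, (e3 - s e3) / (ra * rb) = q%:A).
  split; apply: fixed_rat.
  - by rewrite rmorphD ss addrC.
  - by rewrite rmorphD te3 e3t addrC.
  - by rewrite rmorphM fmorphV rmorphB ss [s (ra * rb)]rmorphM s_ra s_rb mulNr invrN mulrN -mulNr opprB.
  - by rewrite rmorphM fmorphV rmorphB te3 e3t [t (ra * rb)]rmorphM t_ra t_rb mulrN invrN mulrN -mulNr opprB.
have rab2 : (ra * rb) ^+ 2 = (a * b)%:R by rewrite exprMn ra2 rb2 natrM.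
have sa : squarefree a by apply: squarefree_dvd ab_sqf; rewrite dvdn_mulr.
have sb : squarefree b by apply: squarefree_dvd ab_sqf; rewrite dvdn_mull.
have [X2 [Y2 [E2 S2]]] := quadratic_unit_pell sb rb0 rb2 O2 r2 r2' (etrans n2' nm).
(* n is an integer with integral inverse, so 1 or -1. Being the norm of e2 from Q(sqrt b), it is not
   -1 by [noneg]; this settles all three subfields at once. *)
have m1 : m = 1.
  have : (absz m * absz m')%N = 1%N by rewrite -abszM mm'.
  move=> /eqP; rewrite muln_eq1 => /andP[/eqP am _].
  have : m = 1 \/ m = -1 by move: am; clear; lia.
  case=> // mN; case: (noneg (absz X2) (absz Y2)).
  apply/eqP; rewrite -eqz_nat PoszM PoszD !absz_sqr E2 mN; apply/eqP; ring.
have n1' : n = 1 by rewrite nm m1.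
rewrite m1 mulr1 in E2.
have nm1 : n = (1 : int)%:~R by rewrite n1'.
have [X1 [Y1 [E1 S1]]] := quadratic_unit_pell sa ra0 ra2 O1 r1 r1' (etrans n1 nm1).
have [X3 [Y3 [E3 S3]]] :=
  quadratic_unit_pell ab_sqf (mulf_neq0 ra0 rb0) rab2 O3 r3 r3' (etrans n3 nm1).
rewrite mulr1 in E1 E3.
have [g1 [X1' [Y1' [z1 [P1 z10 Z1]]]]] := pell_square_class E1 S1 (etrans n1 n1').
have [g2 [X2' [Y2' [z2 [P2 z20 Z2]]]]] := pell_square_class E2 S2 (etrans n2' n1').
have [g3 [X3' [Y3' [z3 [P3 z30 Z3]]]]] := pell_square_class E3 S3 (etrans n3 n1').
pose M := (d * (X1' + 2) * (X2' + 2) * (X3' + 2))%N.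
have M0 : (0 < M)%N by rewrite /M !muln_gt0 d0 !addn2.
have e0 : [/\ e1 != 0, e2 != 0 & e3 != 0].
  by split; rewrite mulf_neq0 ?invr_eq0 // mulf_neq0.
have [e10 e20 e30] := e0.
have xx : x ^+ 2 = d%:R * (e1 * e2 * e3).
  transitivity (x ^+ 2 * n); first by rewrite n1' mulr1.
  by rewrite /n /e1 /e2 /e3; field; exact: d0K.
clearbody e1 e2 e3.
(* With n = 1, x^2 = d e1 e2 e3, and each e_i is, up to sign, z_i^2 / (X_i' + 2). *)
have key : (x * z1 * z2 * z3 / (e1 * e2 * e3)) ^+ 2 = ((-1) ^+ (g1 + g2 + g3) * M%:Z)%:~R.
  rewrite expr_div_n 3!exprMn Z1 Z2 Z3 xx intrM rmorphXn rmorphN rmorph1 !exprD.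
  rewrite -[(M%:Z)%:~R]/(M%:R) /M !natrM.
  move: ((-1) ^+ g1 : K) ((-1) ^+ g2 : K) ((-1) ^+ g3 : K) => c1 c2 c3.
  by field; rewrite e10 e20 e30.
have m0 : (-1) ^+ (g1 + g2 + g3) * M%:Z != 0 :> int.
  by rewrite mulf_neq0 ?signr_eq0 // eqz_nat -lt0n.
have [i [j [k kE]]] := rational_square m0 key.
exists X1', Y1', X2', Y2', X3', Y3', i, j; split => //; exists k.
have [a0 b0] : (0 < a /\ 0 < b)%N by split; [case: sa|case: sb].
have c0 : (0 < a ^ i * b ^ j)%N by rewrite muln_gt0 !expn_gt0 a0 b0.
(* The sign must be +, because [M] is positive and k^2 is not negative. *)
rewrite -/M; move: kE; rewrite -signr_odd; case: (odd _) => /=; rewrite ?expr0 ?expr1.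
  rewrite mulN1r; have : (0 < M * (a ^ i * b ^ j))%N by rewrite muln_gt0 M0.
  by rewrite mulNr -PoszM; move: (_ * _)%N (_ ^ 2)%N => u1 u2; clear; lia.
by rewrite mul1r -PoszM => -[].
Qed.

Definition principal_relation (d : nat) : Prop :=
  exists x u : K, [/\ x != 0, OK u, OK u^-1 & x ^+ 2 = d%:R * u].

Lemma principal_relation_sqrt (r : K) d : r != 0 -> r ^+ 2 = d%:R -> principal_relation d.
Proof.
move=> r0 r2; exists r, 1; split => //; rewrite ?invr1 ?mulr1 //; exact: OK_1.
Qed.

(** For the unit e = (X + Y r)/2 the identity (1 + e)^2 = e (X + 2) = e A u^2 shows that x = (1 +
    e)/u satisfies x^2 = A e. *)
Lemma principal_relation_pell (r : K) D X Y A u : r ^+ 2 = D%:R -> pell4 D X Y ->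
  (X + 2 = A * u ^ 2)%N -> principal_relation A.
Proof.
move=> r2 XY uE; pose e := (X%:R + Y%:R * r) / 2; pose e' := (X%:R - Y%:R * r) / 2.
have ee : e * e' = 1.
  have : X%:R ^+ 2 = D%:R * Y%:R ^+ 2 + 4 :> K by rewrite -!natrX XY natrD natrM.
  move=> E; have -> : e * e' = (X%:R ^+ 2 - r ^+ 2 * Y%:R ^+ 2) / 4 by rewrite /e /e'; field; rewrite n2 (@natK_neq0 K 4 isT).
  rewrite r2 E addrAC subrr add0r divff //; exact: (@natK_neq0 K 4 isT).
have sum : e + e' = X%:R by rewrite /e /e'; field; exact: n2.
have O_root (y y' : K) : y * y' = 1 -> y + y' = X%:R -> OK y.
  move=> h1 h2; apply: (@integral_root_monic _ _ _ _ ('X^2 - (X%:R *: 'X - 1))).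
  - rewrite monicE lead_coefDl ?lead_coefXn // size_polyXn size_polyN.
    rewrite (leq_ltn_trans (size_polyD _ _)) // gtn_max size_polyN size_poly1 andbT.
    by rewrite (leq_ltn_trans (size_scale_leq _ _)) // size_polyX.
  - by rewrite /root !hornerE -h2 -h1; apply/eqP; ring.
  - move=> z /(nthP 0)[i _ <-]; rewrite !coefB coefXn coefZ coefX coef1.
    apply: integral_sub; first exact: integral_nat.
    apply: integral_sub; last exact: integral_nat.
    by apply: integral_mul; apply: integral_nat.
have u0 : (0 < u)%N by case: (posnP u) uE => // ->; rewrite muln0 addn2.
have u0K := @natK_neq0 K u u0.
have E2 : (1 + e) ^+ 2 = e * (A * u ^ 2)%:R.
  rewrite -uE natrD -sum; transitivity (e * e' + 2 * e + e * e); first by rewrite ee; ring.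
  by ring.
have e'E : e^-1 = e' by apply: (mulfI (_ : e != 0)); rewrite ?mulfV ?ee //;
  apply: contra_eq_neq ee => ->; rewrite mul0r eq_sym oner_eq0.
have e0 : e != 0 by apply: contra_eq_neq ee => ->; rewrite mul0r eq_sym oner_eq0.
exists ((1 + e) / u%:R), e; split.
- have : (1 + e) ^+ 2 != 0 by rewrite E2 mulf_neq0 // natK_eq0 -uE addn2.
  by move=> h; rewrite mulf_neq0 ?invr_eq0 //; apply: contra_neq h => ->; rewrite expr0n.
- exact: O_root ee sum.
- by rewrite e'E; apply: (O_root _ e); [rewrite mulrC|rewrite addrC].
- by rewrite expr_div_n E2 natrM natrX; field; exact: u0K.
Qed.

End Biquadratic.

(** * Exponent vectors modulo 2 *)

(** C is a basis of a complement of the row space of W; its coordinates parametrise the quotient by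
    the relations. *)
Lemma row_complement (F : fieldType) (r n m : nat) (W : 'M[F]_(r, m)) :
  row_free W -> m = (n + r)%N ->
  exists C : 'M[F]_(n, m), (forall v : 'rV_m, exists u w, v = u *m C + w *m W) /\
    (forall (u : 'rV_n) (w : 'rV_r), u *m C = w *m W -> u = 0).
Proof.
move=> Wf mE; have rW : \rank W = r by apply/eqP.
have rC : \rank W^C%MS = n by rewrite mxrank_compl rW mE addnK.
have fC := row_base_free W^C%MS; have eC := eq_row_base W^C%MS.
move: (row_base W^C%MS) fC eC; rewrite rC => C fC eC.
exists C; split=> [v|u w E].
  have : (v <= C + W)%MS.
    by rewrite (adds_eqmx eC (eqmx_refl W)) addsmxC submx_full // addsmx_compl_full.
  by move=> /sub_addsmxP[[u w] /= ->]; exists u, w.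
have : (u *m C <= W :&: W^C)%MS.
  by rewrite sub_capmx -eC submxMl E submxMl.
rewrite capmx_compl submx0 => /eqP uC.
by apply: (row_free_inj fC); rewrite uC mul0mx.
Qed.

Lemma logn_prod (I : Type) (s : seq I) (P : pred I) (F : I -> nat) q :
  (forall i, P i -> 0 < F i)%N ->
  logn q (\prod_(i <- s | P i) F i) = (\sum_(i <- s | P i) logn q (F i))%N.
Proof.
move=> F0; have : (0 < \prod_(i <- s | P i) F i)%N /\
    logn q (\prod_(i <- s | P i) F i) = (\sum_(i <- s | P i) logn q (F i))%N.
  apply: (big_rec2 (fun m l => 0 < m /\ logn q m = l)%N); first by rewrite logn1.
  move=> i l m Pi [m0 ml]; rewrite muln_gt0 F0 ?m0 //; split=> //.
  by rewrite lognM ?F0 ?ml.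
by case.
Qed.

Section ValuationVector.
Variable ps : seq nat.
Hypotheses (ps_pr : forall q, q \in ps -> prime q) (ps_uniq : uniq ps).
Local Notation t := (size ps).
Local Notation pr i := (nth 0%N ps i).

Definition monomial (v : 'rV['F_2]_t) : nat := (\prod_(i < t) pr i ^ (v 0%R i : nat))%N.
Definition valuation (m : nat) : 'rV['F_2]_t := \row_i (logn (pr i) m)%:R.

Lemma pr_prime (i : 'I_t) : prime (pr i).
Proof. by apply: ps_pr; rewrite mem_nth. Qed.

Lemma monomial_gt0 v : (0 < monomial v)%N.
Proof. by apply: prodn_gt0 => i; rewrite expn_gt0 prime_gt0 ?pr_prime. Qed.

Lemma logn_monomial v (i : 'I_t) : logn (pr i) (monomial v) = v 0%R i.
Proof.
rewrite logn_prod => [|j _]; last by rewrite expn_gt0 prime_gt0 ?pr_prime.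
rewrite (bigD1 i) //= lognX logn_prime ?pr_prime // eqxx muln1 big1 ?addn0 //.
move=> j ji; rewrite lognX logn_prime ?pr_prime // nth_uniq //.
by rewrite (negPf (_ : (i : nat) != j)) ?muln0 //; rewrite eq_sym.
Qed.

Lemma logn_monomial_notin v q : q \notin ps -> logn q (monomial v) = 0%N.
Proof.
move=> qps; rewrite logn_prod => [|j _]; last by rewrite expn_gt0 prime_gt0 ?pr_prime.
apply: big1 => i _; rewrite lognX logn_prime ?pr_prime //.
case: eqP => [qE|]; last by rewrite muln0.
by move: qps; rewrite qE mem_nth.
Qed.

Lemma F2_val (x : 'F_2) : (x <= 1)%N.
Proof. by rewrite -ltnS; apply: ltn_ord x. Qed.

Lemma F2_natr (x : 'F_2) : (x : nat)%:R = x.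
Proof. exact: natr_Zp. Qed.

Lemma F2_odd (n : nat) : (n%:R == 0 :> 'F_2) = ~~ odd n.
Proof. by rewrite -(dvdn_pcharf (pchar_Fp (isT : prime 2))) dvdn2. Qed.

Lemma F2_addv m (v : 'M['F_2]_(1, m)) : v + v = 0.
Proof. by apply/rowP => i; rewrite !mxE -mulr2n -mulr_natr pchar_Zp // mulr0. Qed.

Lemma valuation_monomial v : valuation (monomial v) = v.
Proof. by apply/rowP => i; rewrite mxE logn_monomial F2_natr. Qed.

Lemma valuationM m n : (0 < m)%N -> (0 < n)%N ->
  valuation (m * n) = valuation m + valuation n.
Proof. by move=> m0 n0; apply/rowP => i; rewrite !mxE lognM // natrD. Qed.

Lemma valuation1 : valuation 1 = 0.
Proof. by apply/rowP => i; rewrite !mxE logn1. Qed.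

Lemma valuation_square m : perfect_square m -> valuation m = 0.
Proof.
by move=> sq; apply/rowP => i; rewrite !mxE; apply/eqP; rewrite F2_odd square_even_logn.
Qed.

Lemma square_of_valuation m : (0 < m)%N -> (forall q, prime q -> (q %| m)%N -> q \in ps) ->
  valuation m = 0 -> perfect_square m.
Proof.
move=> m0 mps vm; apply: even_logn_square => // q.
case: (posnP (logn q m)) => [->//|]; rewrite logn_gt0 mem_primes => /and3P[q_pr _ qm].
have qps := mps q q_pr qm.
have lt : (index q ps < t)%N by rewrite index_mem.
have := congr1 (fun v : 'rV_t => v 0 (Ordinal lt)) vm.
by rewrite !mxE /= nth_index // => /eqP; rewrite F2_odd.
Qed.

Lemma monomial_valuation m : squarefree m -> (forall q, prime q -> (q %| m)%N -> q \in ps) ->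
  monomial (valuation m) = m.
Proof.
move=> [m0 hm] mps; apply: eqn_from_log => //; first exact: monomial_gt0.
move=> q; case: (boolP (q \in ps)) => qps.
  have lt : (index q ps < t)%N by rewrite index_mem.
  have := logn_monomial (valuation m) (Ordinal lt); rewrite /= nth_index // => ->.
  rewrite mxE /= nth_index //.
  by case: (logn q m) (hm q) => [|[|]].
rewrite logn_monomial_notin //; case: (posnP (logn q m)) => [->//|].
rewrite logn_gt0 mem_primes => /and3P[q_pr _ qm].
by move: qps; rewrite (mps q).
Qed.

Lemma monomial_squarefree v : squarefree (monomial v).
Proof.
split; first exact: monomial_gt0.
move=> q; case: (boolP (q \in ps)) => qps; last by rewrite logn_monomial_notin.
have lt : (index q ps < t)%N by rewrite index_mem.
have := logn_monomial v (Ordinal lt); rewrite /= nth_index // => ->.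
exact: F2_val.
Qed.

Lemma monomial_dvd v m : (forall q, q \in ps -> q %| m)%N -> (0 < m)%N -> (monomial v %| m)%N.
Proof.
move=> hm m0; have [_ sq] := monomial_squarefree v.
apply/dvdn_partP; first exact: monomial_gt0.
move=> q; rewrite inE /= => qv; rewrite p_part.
have q_pr : prime q by move: qv; rewrite mem_primes => /and3P[].
apply: (dvdn_trans (dvdn_exp2l _ (sq q))); rewrite expn1; apply: hm.
by apply: contraLR qv => /(logn_monomial_notin v); rewrite -logn_gt0 => ->.
Qed.

Lemma monomialD v w : exists g, (monomial v * monomial w = monomial (v + w) * g ^ 2)%N.
Proof.
(* For bits x and y, x + y as integers is their sum modulo 2 plus 2 x y, so g gathers the common
   primes. *)
exists (\prod_(i < t) pr i ^ ((v 0%R i : nat) * (w 0%R i : nat)))%N.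
rewrite (big_morph (expn^~ 2) (fun a b => expnMn a b 2) (exp1n 2)) -!big_split /=.
apply: eq_bigr => i _; rewrite -!expnM -!expnD; congr (_ ^ _)%N; rewrite mxE.
move: (v 0 i) (w 0 i) => x y.
have := F2_val x; have := F2_val y; rewrite /= /Zp_trunc /=.
case: x => [[|[|x]] //= ?]; case: y => [[|[|y]] //= ?].
Qed.

Lemma monomial0 : monomial 0 = 1%N.
Proof. by apply: big1 => i _; rewrite mxE. Qed.

Lemma monomial_delta (i : 'I_t) : monomial (delta_mx 0 i) = pr i.
Proof.
rewrite /monomial (bigD1 i) //= mxE !eqxx expn1 big1 ?muln1 // => j ji.
by rewrite mxE (negPf ji) andbF.
Qed.

End ValuationVector.

(** * The group of ambiguous classes *)

Section PolyaGroup.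
Variables (K : fieldExtType rat) (ls : seq nat) (n : nat) (ra rb : K)
  (s t : {rmorphism K -> K}).
Local Notation OK := (@ringOfIntegers K).
Local Notation b := (radicand ls).
Hypotheses (ls_good : forall l, l \in ls -> good_prime l) (ls_uniq : uniq ls)
  (ls13 : 13%N \in ls) (ls_size : size ls = n.+1).
Hypotheses (ra2 : ra ^+ 2 = 5%N%:R) (rb2 : rb ^+ 2 = b%:R)
  (s_ra : s ra = - ra) (s_rb : s rb = rb) (t_ra : t ra = ra) (t_rb : t rb = - rb)
  (dec : forall x : K, exists x0 x1 x2 x3 : rat,
     x = x0%:A + x1%:A * ra + x2%:A * rb + x3%:A * (ra * rb)).

Let ps := [:: 5, 3, 7 & ls]%N.

Let b_mod4 : (b %% 4 = 1)%N. Proof. exact: radicand_mod4. Qed.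
Let sqf5b : squarefree (5 * b). Proof. exact: radicand5_squarefree. Qed.

Let ps_pr q : q \in ps -> prime q.
Proof. by rewrite inE => /orP[/eqP->//|/(radicand_primes ls_good)[]]. Qed.

Let prod_ps : (\prod_(l <- ps) l = 5 * b)%N.
Proof. by rewrite !big_cons /radicand; ring. Qed.

Let ps_uniq : uniq ps.
Proof.
rewrite /= !inE ls_uniq andbT /=; apply/and3P; split; apply/negP => /ls_good[] //.
by move=> _ _ [].
Qed.

Let mem_ps q : prime q -> (q %| 5 * b)%N -> q \in ps.
Proof. by move=> q_pr; rewrite -prod_ps => /prime_dvd_prod; apply. Qed.

Let ps_dvd q : q \in ps -> (q %| 5 * b)%N.
Proof. by move=> qps; rewrite -prod_ps (big_rem q) //= dvdn_mulr. Qed.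

Let b_gt1 : (1 < b)%N. Proof. exact: radicand_gt1. Qed.
Let N0 : (0 < 5 * b)%N. Proof. by case: sqf5b. Qed.
Let b0 : (0 < b)%N. Proof. by move: N0; rewrite muln_gt0. Qed.

Let w2 : (ra * rb) ^+ 2 = (5 * b)%N%:R.
Proof. by rewrite exprMn ra2 rb2 natrM. Qed.

Let ra0 : ra != 0.
Proof.
have : ra ^+ 2 != 0 by rewrite ra2 natK_eq0.
by apply: contra_neq => ->; rewrite expr0n.
Qed.
Let rb0 : rb != 0.
Proof.
have : rb ^+ 2 != 0 by rewrite rb2 natK_eq0 -lt0n.
by apply: contra_neq => ->; rewrite expr0n.
Qed.

Let monomial_dvdN (v : 'rV['F_2]_(size ps)) : (monomial v %| 5 * b)%N.
Proof. exact: monomial_dvd. Qed.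

Let F (v : 'rV['F_2]_(size ps)) : classGroup K :=
  ideal_class (radical K (monomial_gt0 ps_pr v)).

Let FD (v w : 'rV['F_2]_(size ps)) : F (v + w) = (F v * F w)%g.
Proof.
have [g gE] := monomialD v w.
by symmetry; apply: (ideal_class_radicalM _ _ _ w2 sqf5b) gE; apply: monomial_dvdN.
Qed.

Let F_eq1 (v : 'rV['F_2]_(size ps)) : F v = 1%g <-> principal_relation K (monomial v).
Proof. exact/ideal_class_radical_eq1/(radical_sqr _ w2 sqf5b)/monomial_dvdN. Qed.

Let F0 : F 0 = 1%g.
Proof.
apply/F_eq1; rewrite monomial0; apply: (@principal_relation_sqrt K 1) => //.
  exact: oner_neq0.
by rewrite expr1n.
Qed.

Let FF (v : 'rV['F_2]_(size ps)) : (F v * F v)%g = 1%g.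
Proof. by rewrite -FD F2_addv F0. Qed.

Section Relations.
Variables (X2 Y2 X3 Y3 A B C D u v w z : nat).
Hypotheses (f2 : fundamental b X2 Y2) (f3 : fundamental (5 * b) X3 Y3)
  (AB : (A * B = b)%N) (uE : (X2 + 2 = A * u ^ 2)%N) (vE : (X2 = B * v ^ 2 + 2)%N)
  (CD : (C * D = 5 * b)%N) (wE : (X3 + 2 = C * w ^ 2)%N) (zE : (X3 = D * z ^ 2 + 2)%N).

Let gen (i : 'I_4) : nat := nth 0%N [:: 5; b; A; C]%N i.

Let gen_dvd i : (gen i %| 5 * b)%N.
Proof.
case: i => [[|[|[|[|//]]]] ?]; rewrite /gen /=.
- exact: dvdn_mulr.
- exact: dvdn_mull.
- by rewrite -AB mulnA mulnAC dvdn_mull // mulnC.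
- by rewrite -CD dvdn_mulr.
Qed.

Let gen_gt0 i : (0 < gen i)%N.
Proof. exact: dvdn_gt0 (gen_dvd i). Qed.

Let W : 'M['F_2]_(4, size ps) := \matrix_i valuation ps (gen i).

Let gprod (c : 'rV['F_2]_4) : nat := (\prod_(i < 4) gen i ^ (c 0%R i : nat))%N.

Let gprod_gt0 c : (0 < gprod c)%N.
Proof. by apply: prodn_gt0 => i; rewrite expn_gt0 gen_gt0. Qed.

Let valuation_gprod c : valuation ps (gprod c) = c *m W.
Proof.
rewrite mulmx_sum_row /gprod.
have : (0 < \prod_(i < 4) gen i ^ (c 0%R i : nat))%N /\
    valuation ps (\prod_(i < 4) gen i ^ (c 0%R i : nat))%N = \sum_i c 0 i *: row i W.
  apply: (big_rec2 (fun m l => (0 < m)%N /\ valuation ps m = l)).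
    by rewrite valuation1.
  move=> i l m _ [m0 <-]; rewrite muln_gt0 expn_gt0 gen_gt0 m0; split => //.
  rewrite valuationM ?expn_gt0 ?gen_gt0 //; congr (_ + _).
  rewrite rowK; have := F2_val (c 0 i); rewrite -{3}[c 0 i]F2_natr.
  by case: (c 0 i : nat) => [|[|//]] _; rewrite ?scale0r ?scale1r ?expn0 ?valuation1 ?expn1.
by case.
Qed.

Let gprodE c : exists i j k l : bool, [/\ gprod c = (5 ^ i * b ^ j * A ^ k * C ^ l)%N &
  [&& ~~ i, ~~ j, ~~ k & ~~ l] -> c = 0].
Proof.
have bb (x : 'F_2) : exists e : bool, (x : nat) = e.
  have := F2_val x; case: (x : nat) => [|[|//]] _; by [exists false|exists true].
have [i iE] := bb (c 0 0); have [j jE] := bb (c 0 1).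
have [k kE] := bb (c 0 (inord 2)); have [l lE] := bb (c 0 (inord 3)).
exists i, j, k, l; split.
  rewrite /gprod !big_ord_recl big_ord0 muln1 -iE -jE -kE -lE !mulnA.
  congr (_ ^ _ * _ ^ _ * _ ^ _ * _ ^ _)%N; congr (nat_of_ord (c _ _)); apply: val_inj => //=.
    by rewrite inordK.
  by rewrite inordK.
move=> /and4P[/negPf i0 /negPf j0 /negPf k0 /negPf l0].
apply/rowP => m; rewrite mxE; apply: val_inj => /=.
case: m => [[|[|[|[|//]]]] m4].
- by have -> : Ordinal m4 = 0 by [apply: val_inj]; rewrite iE i0.
- by have -> : Ordinal m4 = 1 by [apply: val_inj]; rewrite jE j0.
- by have -> : Ordinal m4 = inord 2 by [apply: val_inj; rewrite /= inordK]; rewrite kE k0.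
- by have -> : Ordinal m4 = inord 3 by [apply: val_inj; rewrite /= inordK]; rewrite lE l0.
Qed.

Let W_free : row_free W.
Proof.
apply: inj_row_free => c; rewrite -valuation_gprod => vc.
have sq : perfect_square (gprod c).
  apply: (square_of_valuation (gprod_gt0 c) _ vc).
  move=> q q_pr; rewrite /gprod; apply: (big_ind (fun m => q %| m -> q \in ps)%N).
  - by rewrite dvdn1 => /eqP q1; rewrite q1 in q_pr.
  - by move=> x y hx hy; rewrite Euclid_dvdM // => /orP[/hx|/hy].
  - move=> i _; rewrite Euclid_dvdX // => /andP[qg _]; apply: mem_ps => //.
    exact: dvdn_trans (gen_dvd i).
have [i [j [k [l [gE]]]]] := gprodE c; apply.
by rewrite gE in sq; apply: relations_independent f2 f3 AB uE vE CD wE zE sq.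
Qed.

Let gen_relation i : F (valuation ps (gen i)) = 1%g.
Proof.
apply/F_eq1; rewrite monomial_valuation //; last first.
- by move=> q q_pr qg; apply: mem_ps => //; apply: dvdn_trans (gen_dvd i).
- exact: squarefree_dvd (gen_dvd i) sqf5b.
case: i => [[|[|[|[|//]]]] ?]; rewrite /gen /=.
- exact: principal_relation_sqrt ra2.
- exact: principal_relation_sqrt rb2.
- by have [P2 _ _] := f2; exact: principal_relation_pell rb2 P2 uE.
- by have [P3 _ _] := f3; exact: principal_relation_pell w2 P3 wE.
Qed.

Let F_W c : F (c *m W) = 1%g.
Proof.
rewrite mulmx_sum_row; apply: (big_ind (fun v => F v = 1%g)) => //.
  by move=> v1 v2 h1 h2; rewrite FD h1 h2 mul1g.
move=> i _; rewrite rowK; have := F2_val (c 0 i); rewrite -{2}[c 0 i]F2_natr.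
by case: (c 0 i : nat) => [|[|//]] _; rewrite ?scale0r ?scale1r.
Qed.

Let F_ker vv : F vv = 1%g -> exists c, vv = c *m W.
Proof.
move=> /F_eq1[x [e [x0 Oe Oe' xE]]].
have noneg X Y : (b * Y ^ 2 <> X ^ 2 + 4)%N by apply: no_negative_pell.
have [X1' [Y1' [X2' [Y2' [X3' [Y3' [i [j [P1 P2 P3 sq]]]]]]]]] :=
  unit_relation_square ra2 rb2 s_ra s_rb t_ra t_rb dec sqf5b (erefl _) b_mod4 noneg
    (monomial_gt0 ps_pr vv) x0 Oe Oe' xE.
(* For D = 5 no fundamental solution is required: A1 divides 5, so X1' + 2 is a square or 5 times a
   square. *)
have [A1 [B1 [u1 [v1 [AB1 uE1 _]]]]] := pell4_split (squarefree_prime (isT : prime 5)) (erefl _) P1.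
have X20 m : (0 < m + 2)%N by rewrite addn2.
have val1 : exists c, valuation ps (X1' + 2) = c *m W.
  have : (A1 %| 5)%N by rewrite -AB1 dvdn_mulr.
  have u10 : (0 < u1)%N by case: (posnP u1) uE1 => // ->; rewrite muln0 addn2.
  have sqv : valuation ps (u1 ^ 2) = 0 by apply: valuation_square; exists u1.
  rewrite uE1; rewrite dvdn_divisors // !inE => /orP[/eqP->|].
    by exists 0; rewrite mul1n sqv mul0mx.
  rewrite ?inE => /eqP->; exists (delta_mx 0 0); rewrite valuationM ?expn_gt0 ?u10 // sqv addr0.
  by rewrite -rowE rowK.
have sub_class X Y D' A' i0 u' : fundamental D' X Y ->
    (X + 2 = A' * u' ^ 2)%N -> A' = gen i0 -> forall X',
    perfect_square (X' + 2) \/ perfect_square ((X' + 2) * (X + 2)) ->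
    exists c, valuation ps (X' + 2) = c *m W.
  move=> fD uE' gE X' [sq'|sq']; first by exists 0; rewrite valuation_square // mul0mx.
  exists (delta_mx 0 i0); rewrite -rowE rowK -gE.
  have u'0 : (0 < u')%N by case: (posnP u') uE' => // ->; rewrite muln0 addn2.
  have A'0 : (0 < A')%N by rewrite gE.
  have := valuation_square ps sq'; rewrite valuationM // uE' valuationM ?expn_gt0 ?u'0 //.
  rewrite [valuation ps (u' ^ 2)]valuation_square ?addr0; last by exists u'.
  by move=> e2; rewrite -[LHS]addr0 -(F2_addv (valuation ps A')) addrA e2 add0r.
have val2 : exists c, valuation ps (X2' + 2) = c *m W.
  apply: (sub_class _ _ _ _ (inord 2) _ f2 uE); first by rewrite /gen inordK.
  exact: (pell4_class b_mod4 b_gt1 f2 P2).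
have val3 : exists c, valuation ps (X3' + 2) = c *m W.
  apply: (sub_class _ _ _ _ (inord 3) _ f3 wE); first by rewrite /gen inordK.
  apply: (pell4_class (radicand5_mod4 ls_good) _ f3 P3).
  by apply: leq_trans b_gt1 _; rewrite leq_pmull.
have [c1 E1] := val1; have [c2 E2] := val2; have [c3 E3] := val3.
have val4 : exists c, valuation ps (5 ^ i * b ^ j) = c *m W.
  exists (i%:R *: delta_mx 0 0 + j%:R *: delta_mx 0 1).
  rewrite mulmxDl -!scalemxAl -!rowE !rowK valuationM ?expn_gt0 ?b0 //.
  by congr (_ + _); [case: (i)|case: (j)]; rewrite ?scale0r ?scale1r ?expn0 ?valuation1 ?expn1.
have [c4 E4] := val4.
have := valuation_square ps sq.
rewrite !valuationM ?muln_gt0 ?monomial_gt0 ?X20 ?expn_gt0 ?b0 //.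
rewrite valuation_monomial // E1 E2 E3 -[X in _ + X]valuationM ?expn_gt0 ?b0 // E4 => e2.
exists (c1 + c2 + c3 + c4); rewrite !mulmxDl.
rewrite -[LHS]addr0 -(F2_addv (c1 *m W + c2 *m W + c3 *m W + c4 *m W)) addrA.
by rewrite -[RHS]add0r; congr (_ + _); rewrite -e2 !addrA.
Qed.

Let F_polya vv : polyaGroup K (F vv).
Proof.
move=> S [hS gS]; have [S1 SM _] := hS.
rewrite (row_sum_delta vv); apply: (big_ind (fun v => S (F v))).
- by rewrite F0.
- by move=> v1 v2 h1 h2; rewrite FD; apply: SM.
move=> i _; have := F2_val (vv 0 i); rewrite -{2}[vv 0 i]F2_natr.
case: (vv 0 i : nat) => [|[|//]] _; rewrite ?scale0r ?scale1r; first by rewrite F0.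
have p_pr := pr_prime ps_pr i.
have [q q0 qE] := ostrowskiIdeal_exists ra2 rb2 s_ra s_rb t_ra t_rb dec sqf5b (erefl _) b_mod4 p_pr.
apply: gS; exists q => //=; rewrite qE /ideal_over ps_dvd ?mem_nth //.
rewrite /F; congr (ideal_class _); apply: val_inj => /=.
by rewrite monomial_delta.
Qed.

(** The image of F is a subgroup, every element being its own inverse, and it contains the classes
    of O, pO and R_p. *)
Let polya_F c : polyaGroup K c -> exists vv, c = F vv.
Proof.
pose S : set (classGroup K) := [set c | exists vv, c = F vv].
move=> h; apply: (h S); split.
  split.
  - by exists 0; rewrite F0.
  - by move=> _ _ [v1 ->] [v2 ->]; exists (v1 + v2); rewrite FD.
  - move=> _ d [v1 ->] e; exists v1; rewrite -[d]mul1g -(FF v1) -mulgA e mulg1 //.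
move=> _ [q _ <-].
have [->|[p [p_pr ->]]] := ostrowskiIdeal_cases ra2 rb2 s_ra s_rb t_ra t_rb dec sqf5b (erefl _) b_mod4 q.
  by exists 0; rewrite F0.
rewrite /ideal_over; case: ifP => pN; last by exists 0; rewrite F0 ideal_class_nat_ideal.
have pps := mem_ps p_pr pN.
have lt : (index p ps < size ps)%N by rewrite index_mem.
exists (delta_mx 0 (Ordinal lt)); rewrite /F; congr (ideal_class _); apply: val_inj => /=.
by rewrite monomial_delta //= nth_index.
Qed.

Lemma polya_elementary_aux : isom_elementary n (polyaGroup K).
Proof.
have sz : size ps = (n + 4)%N by rewrite /= ls_size; lia.
have [C0 [Cspan Cinj]] := row_complement W_free sz.
pose f (u0 : 'rV['F_2]_n) := F (u0 *m C0).
have fD : {morph f : x y / x + y >-> (x * y)%g}.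
  by move=> x y; rewrite /f mulmxDl FD.
exists (f : 'rV['Z_2]_n -> classGroup K); split; first exact: fD.
split.
- by move=> u0 _; apply: F_polya.
- move=> x y _ _ fxy; have : f (x + y) = 1%g by rewrite fD fxy FF.
  move=> /F_ker[c /Cinj xy0].
  by rewrite -[x]addr0 -(F2_addv y) addrA xy0 add0r.
- move=> c /polya_F[vv ->]; have [u0 [w0 ->]] := Cspan vv.
  by exists u0 => //; rewrite FD F_W mulg1.
Qed.

End Relations.

Lemma polya_elementary : isom_elementary n (polyaGroup K).
Proof.
have sb : squarefree b by exact: radicand_squarefree.
have b51 : (1 < 5 * b)%N by apply: leq_trans b_gt1 _; rewrite leq_pmull.
have [X2 [Y2 f2]] := fundamental_exists sb b_mod4 b_gt1 Rdefinitions.R.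
have [X3 [Y3 f3]] := fundamental_exists sqf5b (radicand5_mod4 ls_good) b51 Rdefinitions.R.
have [P2 _ _] := f2; have [P3 _ _] := f3.
have [A [B [u [v [AB uE vE]]]]] := pell4_split sb b_mod4 P2.
have [C [D [w [z [CD wE zE]]]]] := pell4_split sqf5b (radicand5_mod4 ls_good) P3.
exact: polya_elementary_aux f2 f3 AB uE vE CD wE zE.
Qed.

End PolyaGroup.

(** * Existence of the fields *)

Section Construction.

Definition spanned4 (K : fieldExtType rat) (ra rb : K) : Prop :=
  forall x : K, exists x0 x1 x2 x3 : rat,
    x = x0%:A + x1%:A * ra + x2%:A * rb + x3%:A * (ra * rb).

Lemma Fadjoin_sqrt (F : fieldType) (L : fieldExtType F) (E : {subfield L}) (r x : L) :
  r ^+ 2 \in E -> x \in <<E; r>>%VS -> exists u v, [/\ u \in E, v \in E & x = u + v * r].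
Proof.
move=> r2 /Fadjoin_polyP[p pE ->]; rewrite horner_coef.
apply: (big_ind (fun z => exists u v, [/\ u \in E, v \in E & z = u + v * r])).
- by exists 0, 0; rewrite !mem0v mul0r addr0.
- move=> _ _ [u [v [uE vE ->]]] [u' [v' [uE' vE' ->]]]; exists (u + u'), (v + v').
  by rewrite !memvD // mulrDl addrACA.
move=> i _; have pi : p`_i \in E by move/polyOverP: pE.
have -> : r ^+ i = (r ^+ 2) ^+ i./2 * r ^+ odd i.
  by rewrite -exprM -exprD mul2n addnC odd_double_half.
have cE : p`_i * (r ^+ 2) ^+ i./2 \in E by rewrite rpredM // rpredX.
rewrite mulrA; case: (odd i); rewrite ?expr1 ?expr0.
  by exists 0, (p`_i * (r ^+ 2) ^+ i./2); rewrite mem0v add0r.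
by exists (p`_i * (r ^+ 2) ^+ i./2), 0; rewrite mem0v mul0r addr0 mulr1.
Qed.

Lemma spanned4_adjoin (K : fieldExtType rat) (ra rb : K) (a b : nat) :
  ra ^+ 2 = a%:R -> rb ^+ 2 = b%:R -> <<1 & [:: ra; rb]>>%VS = fullv -> spanned4 ra rb.
Proof.
move=> ra2 rb2 gen x; have : x \in <<1 & [:: ra; rb]>>%VS by rewrite gen memvf.
rewrite adjoin_cons adjoin_seq1 => /Fadjoin_sqrt[|u [v [uE vE ->]]].
  by rewrite rb2 rpred_nat.
have split1 w : w \in <<1; ra>>%VS -> exists q0 q1 : rat, w = q0%:A + q1%:A * ra.
  move=> /Fadjoin_sqrt[|u' [v' [uE' vE' ->]]]; first by rewrite ra2 rpred_nat.
  by move: uE' vE' => /vlineP[k ->] /vlineP[l ->]; exists k, l.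
have [x0 [x1 ->]] := split1 u uE; have [x2 [x3 ->]] := split1 v vE.
by exists x0, x1, x2, x3; ring.
Qed.

Lemma rat_nonsquare (q : rat) (n : nat) : ~ perfect_square n -> q ^+ 2 <> n%:R.
Proof.
(* Any number field will do here; it gives access to [OK_rat]. *)
move=> nsq E; have [K _] := num_field_exists [::].
have : @ringOfIntegers K q%:A.
  apply: (@OK_root K _ 2) => //.
  rewrite -[q%:A]/(in_alg K q) -rmorphXn E rmorph_nat; exact: OK_nat.
move=> /OK_rat[k kE]; apply: nsq; exists (absz k).
move: E; rewrite kE -rmorphXn -[n%:R]/(n%:Z%:~R) => /(@intr_inj rat) E.
by apply/eqP; rewrite -eqz_nat -E absz_sqr.
Qed.

Section Fixed.
Variables (a b : nat).
Hypotheses (a_nsq : ~ perfect_square a) (b_nsq : ~ perfect_square b)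
  (ab_nsq : ~ perfect_square (a * b)).

Lemma sqrt_pair_free (K : fieldExtType rat) (ra : K) (q0 q1 : rat) :
  ra ^+ 2 = a%:R -> q0%:A + q1%:A * ra = 0 -> q0 = 0 /\ q1 = 0.
Proof.
move=> ra2 E; case: (eqVneq q1 0) => [q10|q10].
  move: E; rewrite q10 scale0r mul0r addr0 => /eqP; rewrite scaler_eq0 oner_eq0 orbF.
  by move=> /eqP->.
case: (@rat_nonsquare (- q0 / q1) a a_nsq).
apply: (fmorph_inj (in_alg K)); rewrite rmorph_nat rmorphXn fmorph_div rmorphN -ra2.
have q1K : in_alg K q1 != 0 by rewrite fmorph_eq0.
congr (_ ^+ 2); apply: (mulIf q1K); rewrite mulfVK // mulrC; apply/eqP.
by rewrite -subr_eq0 -opprD oppr_eq0; apply/eqP; exact: E.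
Qed.

(** If the coefficient of rb is nonzero, dividing by it gives rb = u0 + u1 ra with rational u0, u1.
    Squaring gives u0 u1 = 0, so b or ab would be a perfect square. *)
Lemma sqrt_basis_free (K : fieldExtType rat) (ra rb : K) (x0 x1 x2 x3 : rat) :
  ra ^+ 2 = a%:R -> rb ^+ 2 = b%:R ->
  x0%:A + x1%:A * ra + x2%:A * rb + x3%:A * (ra * rb) = 0 ->
  [/\ x0 = 0, x1 = 0, x2 = 0 & x3 = 0].
Proof.
move=> ra2 rb2 E; pose v := x2%:A + x3%:A * ra : K.
have E' : x0%:A + x1%:A * ra + v * rb = 0 by rewrite -E /v; ring.
case: (eqVneq v 0) => [v0|v0].
  have [-> ->] := sqrt_pair_free ra2 v0.
  by move: E'; rewrite v0 mul0r addr0 => /(sqrt_pair_free ra2)[-> ->].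
pose v' := x2%:A - x3%:A * ra : K; pose n := x2 ^+ 2 - a%:R * x3 ^+ 2.
have nE : in_alg K n = v * v'.
  rewrite !(rmorphB, rmorphXn, rmorphM, rmorph_nat) -ra2 /v /v' /=; ring.
have v'0 : v' != 0.
  apply/eqP => v'0; case/eqP: v0; move: v'0; rewrite /v' -mulNr -scaleNr => /(sqrt_pair_free ra2)[x20 /eqP].
  by rewrite oppr_eq0 => /eqP x30; rewrite /v x20 x30 !scale0r mul0r addr0.
have n0 : in_alg K n != 0 by rewrite nE mulf_neq0.
have nq0 : n != 0 by rewrite -(fmorph_eq0 (in_alg K)).
pose u0 := - (x0 * x2 - a%:R * (x1 * x3)) / n; pose u1 := - (x1 * x2 - x0 * x3) / n.
have rbE : rb = in_alg K u0 + in_alg K u1 * ra.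
  apply: (mulIf n0); rewrite mulrDl mulrAC /u0 /u1 !fmorph_div !mulfVK //.
  rewrite nE [rb * _]mulrA; have -> : rb * v = - (x0%:A + x1%:A * ra).
    by apply/eqP; rewrite -subr_eq0 opprK addrC [rb * v]mulrC E'.
  rewrite !(rmorphN, rmorphB, rmorphM, rmorph_nat) -ra2 /v' /=; ring.
clearbody u0 u1.
have : in_alg K (u0 ^+ 2 + a%:R * u1 ^+ 2 - b%:R) + in_alg K (u0 * u1 *+ 2) * ra = 0.
  have -> : in_alg K (u0 ^+ 2 + a%:R * u1 ^+ 2 - b%:R) =
      in_alg K u0 ^+ 2 + ra ^+ 2 * in_alg K u1 ^+ 2 - rb ^+ 2.
    have h (f : {rmorphism rat -> K}) x y :
        f (x ^+ 2 + a%:R * y ^+ 2 - b%:R) = f x ^+ 2 + a%:R * f y ^+ 2 - b%:R.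
      by rewrite rmorphB rmorphD !rmorphXn [f (_ * _)]rmorphM rmorphXn !rmorph_nat.
    by rewrite ra2 rb2; exact: h.
  have -> : in_alg K (u0 * u1 *+ 2) = in_alg K u0 * in_alg K u1 *+ 2.
    by rewrite rmorphMn rmorphM.
  rewrite rbE; move: (in_alg K u0) (in_alg K u1) => U0 U1; ring.
move=> /(sqrt_pair_free ra2)[/eqP e1 /eqP].
rewrite -mulr_natl !mulf_eq0 /= => /orP[/eqP u00|/eqP u10].
- case: (@rat_nonsquare (a%:R * u1) (a * b) ab_nsq).
  move: e1; rewrite u00 expr0n add0r subr_eq0 => /eqP e1.
  by rewrite natrM -e1; ring.
- case: (@rat_nonsquare u0 b b_nsq).
  by move: e1; rewrite u10 expr0n mulr0 addr0 subr_eq0 => /eqP.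
Qed.

Lemma dim_spanned4 (K : fieldExtType rat) (ra rb : K) :
  ra ^+ 2 = a%:R -> rb ^+ 2 = b%:R -> spanned4 ra rb -> \dim {:K} = 4%N.
Proof.
move=> ra2 rb2 sp; pose X := [tuple 1; ra; rb; ra * rb].
have fX : free X.
  apply/freeP => k; rewrite !big_ord_recl big_ord0 /= addr0.
  rewrite -[k _ *: ra]mulr_algl -[k _ *: rb]mulr_algl -[k _ *: (ra * rb)]mulr_algl !addrA.
  move=> /(sqrt_basis_free ra2 rb2)[k0 k1 k2 k3] [[|[|[|[|//]]]] i4].
  - by rewrite -k0; congr k; apply: val_inj.
  - by rewrite -k1; congr k; apply: val_inj.
  - by rewrite -k2; congr k; apply: val_inj.
  - by rewrite -k3; congr k; apply: val_inj.
have : <<X>>%VS = {:K}%VS.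
  apply/eqP; rewrite eqEsubv subvf /=; apply/subvP => x _.
  have [x0 [x1 [x2 [x3 ->]]]] := sp x.
  rewrite !mulr_algl; do !apply: memvD; apply: memvZ; apply: memv_span;
  by rewrite !inE eqxx ?orbT.
by move=> <-; have /eqP := fX; rewrite /free => ->.
Qed.

Lemma biquadratic_exists : exists (K : splittingFieldType rat) (ra rb : K),
  [/\ ra ^+ 2 = a%:R, rb ^+ 2 = b%:R, spanned4 ra rb, \dim {:K} = 4%N & galois 1 {:K}].
Proof.
have [Q [QC [s1 s1E genQ]]] := num_field_exists [:: sqrtC a%:R; sqrtC b%:R].
case: s1 s1E genQ => [|ra [|rb [|]]] //= [raE rbE] genQ.
have ra2 : ra ^+ 2 = a%:R.
  by apply: (fmorph_inj QC); rewrite rmorphXn raE sqrtCK rmorph_nat.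
have rb2 : rb ^+ 2 = b%:R.
  by apply: (fmorph_inj QC); rewrite rmorphXn rbE sqrtCK rmorph_nat.
have sp := spanned4_adjoin ra2 rb2 genQ.
have nK (m : nat) : ~ perfect_square m -> m%:R != 0 :> Q.
  by move=> nsq; rewrite natK_eq0; apply/eqP => m0; apply: nsq; exists 0%N; rewrite m0.
have sq_neq0 (r : Q) m : ~ perfect_square m -> r ^+ 2 = m%:R -> r != 0.
  by move=> nsq r2; apply: contra_neq (nK m nsq) => r0; rewrite -r2 r0 expr0n.
have ra0 := sq_neq0 _ _ a_nsq ra2; have rb0 := sq_neq0 _ _ b_nsq rb2.
have ab : ra ^+ 2 != rb ^+ 2.
  rewrite ra2 rb2; apply/eqP => e; apply: ab_nsq; exists a.
  have : in_alg Q a%:R = in_alg Q b%:R by rewrite !rmorph_nat.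
  by move=> /fmorph_inj/eqP; rewrite eqr_nat => /eqP <-; rewrite mulnn.
(* The opposites make the product of the X - z rational. *)
pose rs := [:: ra; - ra; rb; - rb].
pose p : {poly Q} := \prod_(z <- rs) ('X - z%:P).
have pE : p = ('X^2 - a%:R%:P) * ('X^2 - b%:R%:P).
  rewrite /p !big_cons big_nil mulr1 -ra2 -rb2 !polyCN !rmorphXn /=; ring.
have p1 : p \is a polyOver 1%VS.
  by rewrite pE rpredM // rpredB ?rpredX ?polyOverX // polyOverC rpred_nat.
have genrs : <<1 & rs>>%VS = {:Q}%VS.
  apply/eqP; rewrite eqEsubv subvf -genQ; apply: adjoin_seqSr.
  by move=> z; rewrite !inE => /orP[->|->]; rewrite ?orbT.
have spl : splittingFieldFor 1 p {:Q} by exists rs; [exact: eqpxx|exact: genrs].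
have Q_ax : FieldExt_isSplittingField _ Q by constructor; exists p.
exists (HB.pack_for (splittingFieldType rat) Q Q_ax), ra, rb; split => //.
  exact: dim_spanned4 ra2 rb2 sp.
apply/splitting_galoisField; exists p; split => //.
have two r : r != 0 -> r != - r :> Q.
  by move=> r0; rewrite -addr_eq0 -mulr2n -mulr_natl mulf_neq0 // natK_eq0.
have [n1 n2] : ra != rb /\ ra != - rb.
  by split; apply: contraNneq ab => ->; rewrite ?sqrrN.
rewrite /p separable_prod_XsubC /= !inE !negb_or two // two // n1 n2 /= andbT.
by rewrite eqr_oppLR n2 eqr_opp n1.
Qed.

End Fixed.
End Construction.

(** * The Galois group as a group of signs *)

Section GaloisGroup.
Variables (K : splittingFieldType rat) (a b : nat) (ra rb : K).
Hypotheses (ra2 : ra ^+ 2 = a%:R) (rb2 : rb ^+ 2 = b%:R) (sp : spanned4 ra rb)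
  (dimK : \dim {:K} = 4%N) (galK : galois 1 {:K}).

Let G := 'Gal({:K} / 1)%G.

Let cardG : #|G| = 4%N.
Proof. by rewrite -galois_dim // dimv1 divn1. Qed.

Let gal_sqrt (g : gal_of {:K}) (r : K) (m : nat) : r ^+ 2 = m%:R -> g r = (-1) ^+ (g r != r) * r.
Proof.
move=> r2; have /eqP : (g r) ^+ 2 = r ^+ 2 by rewrite -rmorphXn r2 rmorph_nat.
rewrite eqf_sqr; case: eqVneq => [->|_] /=; first by rewrite expr0 mul1r.
by move=> /eqP->; rewrite mulN1r.
Qed.

Let sign (g : gal_of {:K}) : bool * bool := (g ra != ra, g rb != rb).

Let galE (g : gal_of {:K}) x0 x1 x2 x3 :
  g (x0%:A + x1%:A * ra + x2%:A * rb + x3%:A * (ra * rb)) =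
  x0%:A + x1%:A * ((-1) ^+ (sign g).1 * ra) + x2%:A * ((-1) ^+ (sign g).2 * rb) +
  x3%:A * (((-1) ^+ (sign g).1 * ra) * ((-1) ^+ (sign g).2 * rb)).
Proof.
have h (f : {rmorphism K -> K}) : f (x0%:A + x1%:A * ra + x2%:A * rb + x3%:A * (ra * rb)) =
    x0%:A + x1%:A * f ra + x2%:A * f rb + x3%:A * (f ra * f rb).
  by rewrite !(rmorphD, rmorphM, rmorph_ratK).
by rewrite -(gal_sqrt g ra2) -(gal_sqrt g rb2); apply: h.
Qed.

Let sign_inj : injective sign.
Proof.
move=> g h gh; apply/eqP/gal_eqP => x _.
by have [x0 [x1 [x2 [x3 ->]]]] := sp x; rewrite !galE gh.
Qed.

(** Counting: [sign] is injective from a group of order 4 to four pairs of signs. *)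
Let sign_surj e : exists g, sign g = e.
Proof.
have : e \in [set sign g | g in G]%SET.
  have -> : [set sign g | g in G]%SET = [set: bool * bool]%SET.
    apply/eqP; rewrite eqEcard finset.subsetT card_imset // cardsT card_prod card_bool.
    by rewrite cardG.
  by rewrite finset.in_setT.
by move=> /imsetP[g _ ->]; exists g.
Qed.

Lemma automorphism_exists (e : bool * bool) : exists f : {rmorphism K -> K},
  f ra = (-1) ^+ e.1 * ra /\ f rb = (-1) ^+ e.2 * rb.
Proof.
have [g gE] := sign_surj e; exists (g : 'AEnd(K)).
by rewrite -gE; split; [apply: gal_sqrt ra2|apply: gal_sqrt rb2].
Qed.

Let gal_involutive (g : gal_of {:K}) : (g * g = 1)%g.
Proof.
apply/eqP/gal_eqP => x _; rewrite galM ?memvf // gal_id.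
have [x0 [x1 [x2 [x3 ->]]]] := sp x; rewrite galE.
have -> : x0%:A + x1%:A * ((-1) ^+ (sign g).1 * ra) + x2%:A * ((-1) ^+ (sign g).2 * rb) +
   x3%:A * ((-1) ^+ (sign g).1 * ra * ((-1) ^+ (sign g).2 * rb)) =
   x0%:A + (x1 * (-1) ^+ (sign g).1)%:A * ra + (x2 * (-1) ^+ (sign g).2)%:A * rb +
   (x3 * ((-1) ^+ (sign g).1 * (-1) ^+ (sign g).2))%:A * (ra * rb) :> K.
  by case: (sign g) => [[] []] /=;
    rewrite ?expr0 ?expr1 ?mulr1 ?mul1r ?mulrN1 ?mulN1r ?opprK ?scaleNr; ring.
rewrite galE.
by case: (sign g) => [[] []] /=;
  rewrite ?expr0 ?expr1 ?mulr1 ?mul1r ?mulrN1 ?mulN1r ?opprK ?scaleNr; ring.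
Qed.

Lemma biquadratic_of_spanned : biquadratic K.
Proof.
split=> //.
have abG : (2.-abelem G)%g.
  apply/(abelemP (isT : prime 2)); split; last by move=> x _; rewrite expgS expg1 gal_involutive.
  apply/centsP => x _ y _; rewrite /commute.
  have inv (z : gal_of {:K}) : z^-1%g = z by apply/eqP; rewrite eq_invg_mul gal_involutive.
  by rewrite -[LHS]inv invMg !inv.
rewrite (isog_abelem_card _ abG) cardsT card_prod !card_ord cardG eqxx andbT.
apply/(abelemP (isT : prime 2)); split.
  by apply/centsP => x _ y _; rewrite /commute; apply: (addrC x y).
move=> x _; rewrite expgS expg1; case: x => x y.
by apply/eqP; rewrite xpair_eqE; move: x y => [[|[|[]]] //= ?] [[|[|[]]] //= ?].
Qed.

End GaloisGroup.

(** * Total reality *)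

Lemma totally_real_of_spanned (K : fieldExtType rat) (ra rb : K) (a b : nat) :
  ra ^+ 2 = a%:R -> rb ^+ 2 = b%:R -> spanned4 ra rb -> totally_real K.
Proof.
move=> ra2 rb2 sp f x.
have Im_add (z w : Rdefinitions.R[i]) : complex.Im z = 0 -> complex.Im w = 0 -> complex.Im (z + w) = 0.
  by case: z w => [z1 z2] [w1 w2] /= -> ->; rewrite addr0.
have Im_mul (z w : Rdefinitions.R[i]) : complex.Im z = 0 -> complex.Im w = 0 -> complex.Im (z * w) = 0.
  by case: z w => [z1 z2] [w1 w2] /= -> ->; rewrite mulr0 mul0r addr0.
have Im_nat (m : nat) : complex.Im (m%:R : Rdefinitions.R[i]) = 0.
  by elim: m => [|m IH] //; rewrite -natr1; apply: Im_add.
have Im_opp (z : Rdefinitions.R[i]) : complex.Im z = 0 -> complex.Im (- z) = 0.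
  by case: z => [z1 z2] /= ->; rewrite oppr0.
have Im_int (m : int) : complex.Im (m%:~R : Rdefinitions.R[i]) = 0.
  case: m => m; first exact: Im_nat.
  by rewrite NegzE intrN; apply: Im_opp; exact: Im_nat.
have Im_inv (z : Rdefinitions.R[i]) : complex.Im z = 0 -> complex.Im (z^-1) = 0.
  by case: z => [z1 z2] /= ->; rewrite mul0r oppr0.
have Im_rat (q : rat) : complex.Im (f q%:A) = 0.
  rewrite alg_ratE rmorphM fmorphV !rmorph_int; apply: Im_mul; first exact: Im_int.
  by apply: Im_inv; exact: Im_int.
have Im_sqrt (r : K) (m : nat) : r ^+ 2 = m%:R -> complex.Im (f r) = 0.
  move=> r2; have : (f r) ^+ 2 = m%:R by rewrite -rmorphXn r2 rmorph_nat.
  case: (f r) => [u v] E.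
  have hI : complex.Im ((u +i* v)%C ^+ 2) = 0 by rewrite E Im_nat.
  have hR : complex.Re ((u +i* v)%C ^+ 2) >= 0.
    rewrite E; elim: (m) => [|k IH]; first by [].
    rewrite -natr1; case: (k%:R : Rdefinitions.R[i]) IH => [k1 k2] /= h; exact: addr_ge0.
  move: hI hR; rewrite /= => hI hR.
  (* (u + i v)^2 is a nonnegative real, so u v = 0, and u = 0 would leave -v^2 >= 0. *)
  have : u * v = 0 by move: hI; lra.
  by move=> /eqP; rewrite mulf_eq0 => /orP[/eqP u0|/eqP//]; move: hR; rewrite u0; nra.
have [x0 [x1 [x2 [x3 ->]]]] := sp x.
rewrite !rmorphD !rmorphM.
have Ia := Im_sqrt ra a ra2; have Ib := Im_sqrt rb b rb2.
apply: (Im_add _ _ (Im_add _ _ (Im_add _ _ _ _) _) _).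
- exact: Im_rat.
- exact: Im_mul.
- exact: Im_mul.
- by apply: (Im_mul _ _ (Im_rat _)); exact: Im_mul.
Qed.

(** * The infinite family of fields *)

Definition admissible (n : nat) (ls : seq nat) : Prop :=
  [/\ forall l, l \in ls -> good_prime l, uniq ls, 13%N \in ls & size ls = n.+1].

(** The last two clauses are there to tell the fields apart: [K] contains a root of its radicand b,
    and a positive integer is a square in [K] only if it is one up to factors 5 and b. *)
Lemma field_of_primes (n : nat) (ls : seq nat) : admissible n ls ->
  exists K : splittingFieldType rat,
    [/\ biquadratic K, totally_real K, isom_elementary n (polyaGroup K),
        exists r : K, r ^+ 2 = (radicand ls)%:R &
        forall (m : nat) (z : K), (0 < m)%N -> z ^+ 2 = m%:R ->
          exists i j : bool, perfect_square (m * (5 ^ i * radicand ls ^ j))].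
Proof.
move=> [ls_good ls_uniq ls13 ls_size].
have sqf5b : squarefree (5 * radicand ls) by apply: radicand5_squarefree.
have sqfb : squarefree (radicand ls) by apply: radicand_squarefree.
have b_gt1 : (1 < radicand ls)%N by apply: radicand_gt1.
have b_mod4 : (radicand ls %% 4 = 1)%N by apply: radicand_mod4.
have nsq5 : ~ perfect_square 5 by apply: squarefree_nonsquare => //; apply: squarefree_prime.
have nsqb : ~ perfect_square (radicand ls) by apply: squarefree_nonsquare.
have nsq5b : ~ perfect_square (5 * radicand ls).
  by apply: squarefree_nonsquare => //; apply: leq_trans b_gt1 _; rewrite leq_pmull.
have [K [ra [rb [ra2 rb2 sp dimK galK]]]] := biquadratic_exists nsq5 nsqb nsq5b.
have [s [s_ra s_rb]] := automorphism_exists ra2 rb2 sp dimK galK (true, false).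
have [t [t_ra t_rb]] := automorphism_exists ra2 rb2 sp dimK galK (false, true).
rewrite /= expr1 mulN1r in s_ra; rewrite /= expr0 mul1r in s_rb.
rewrite /= expr0 mul1r in t_ra; rewrite /= expr1 mulN1r in t_rb.
exists K; split.
- exact: biquadratic_of_spanned ra2 rb2 sp dimK galK.
- exact: totally_real_of_spanned ra2 rb2 sp.
- exact: polya_elementary ls_good ls_uniq ls13 ls_size ra2 rb2 s_ra s_rb t_ra t_rb sp.
- by exists rb.
move=> m z m0 z2; have m0' : m%:Z != 0 by rewrite eqz_nat -lt0n.
have [i [j [k kE]]] := rational_square ra2 rb2 s_ra s_rb t_ra t_rb sp (erefl _) b_mod4 m0' z2.
by exists i, j, k; move/eqP: kE; rewrite -PoszM eqz_nat => /eqP.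
Qed.

Lemma good_prime_sequence : exists g : nat -> nat,
  [/\ forall i, good_prime (g i), injective g & forall i, (13 < g i)%N].
Proof.
have ex M : exists l, good_prime l /\ (M < l)%N.
  by have [l hl Ml] := good_prime_exists M; exists l.
have [h hP] := boolp.choice ex.
pose g := fix g i := if i is i'.+1 then h (g i') else h 13%N.
have gS i : (g i < g i.+1)%N by have [] := hP (g i).
have g_mono : {homo g : i j / (i < j)%N}.
  by apply: homo_ltn => //; exact: ltn_trans.
exists g; split.
- by case=> [|i] /=; [have [] := hP 13%N|have [] := hP (g i)].
- move=> i j gij; case: (ltngtP i j) => // /g_mono; by rewrite gij ltnn.
- elim=> [|i IH]; first by have [] := hP 13%N.
  exact: ltn_trans IH (gS i).
Qed.

Theorem theorem1 (n : nat) (hn : (1 <= n)%N) :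
  infinitely_many (fun K : splittingFieldType rat =>
    [/\ biquadratic K,
        totally_real K &
        isom_elementary n (polyaGroup K)]).
Proof.
have [g [g_good g_inj g13]] := good_prime_sequence.
(* Only [g (n.-1 + i)] varies with i; with 13 and the n - 1 fixed primes this makes n + 1. *)
pose ls i := [:: 13, g (n.-1 + i) & [seq g k | k <- iota 0 n.-1]]%N.
have nin i : (n.-1 + i)%N \notin iota 0 n.-1.
  by rewrite mem_iota add0n negb_and -leqNgt leq_addr orbT.
have ls_adm i : admissible n (ls i).
  split.
  - move=> l; rewrite !inE => /or3P[/eqP->|/eqP->|/mapP[k _ ->]] //; exact: good_prime13.
  - rewrite /= map_inj_uniq // iota_uniq andbT mem_map // nin andbT.
    rewrite inE negb_or; apply/andP; split; first by apply: contraTneq (g13 (n.-1 + i)%N) => <-.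
    by apply/mapP => -[k _ e]; have := g13 k; rewrite -e.
  - by rewrite inE eqxx.
  - by rewrite /= size_map size_iota prednK.
have [K KP] := boolp.choice (fun i => field_of_primes (ls_adm i)).
exists K; split=> [i|i j ij [f _]]; first by have [] := KP i.
have [_ _ _ [r r2] _] := KP i; have [_ _ _ _ sqK] := KP j.
have lsi_good : forall l, l \in ls i -> good_prime l by case: (ls_adm i).
have lsj_good : forall l, l \in ls j -> good_prime l by case: (ls_adm j).
have sqf k : squarefree (radicand (ls k)).
  by have [h1 h2 h3 _] := ls_adm k; exact: (radicand_squarefree h1 h2 h3).
have sqi := sqf i; have sqj := sqf j.
have fr2 : (f r) ^+ 2 = (radicand (ls i))%:R by rewrite -rmorphXn r2 rmorph_nat.
have [e1 [e2 sq]] := sqK _ _ sqi.1 fr2.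
(* An embedding of K_i into K_j makes the radicand of K_i a square in K_j; but l divides this
   radicand exactly once, and divides neither 5 nor the radicand of K_j. *)
pose l := g (n.-1 + i)%N; have l13 : (13 < l)%N := g13 _.
have l_pr : prime l by case: (g_good (n.-1 + i)%N).
have li : (l %| radicand (ls i))%N by apply: dvd_radicand; rewrite !inE eqxx !orbT.
have lj : ~~ (l %| radicand (ls j))%N.
  apply/negP => /(prime_dvd_radicand lsj_good l_pr).
  rewrite !inE => /or3P[/eqP E|/eqP E|/or3P[/eqP E|/eqP E|]]; try by rewrite E in l13.
    by move/g_inj/eqP: E; rewrite eqn_add2l => /eqP.
  by rewrite mem_map // (negPf (nin i)).
have l5 : logn l 5 = 0%N.
  by rewrite logn_prime //; case: eqP => // E; move: l13; rewrite E.
have := square_even_logn l sq.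
have c0 : (0 < 5 ^ e1 * radicand (ls j) ^ e2)%N by rewrite muln_gt0 !expn_gt0 sqj.1.
rewrite lognM ?sqi.1 // lognM ?expn_gt0 ?sqj.1 // !lognX l5.
have -> : logn l (radicand (ls j)) = 0%N.
  by apply/eqP; rewrite -leqn0 leqNgt logn_gt0 mem_primes l_pr sqj.1.
rewrite !muln0 !addn0.
have := sqi.2 l; have : (0 < logn l (radicand (ls i)))%N by rewrite logn_gt0 mem_primes l_pr sqi.1.
by case: (logn _ _) => [|[|]].
Qed.
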